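(* Given a graph $G$ with edge weights, integers $k\in\mathbb{N}^+$ and $d\in\mathbb{N}^+$, and a nice tree decomposition of $G$ of width $\mathrm{tw}$, there exists an algorithm that solves the counting version of $d$-Scattered Set (i.e., computes the number of $d$-scattered sets of size $k$ in $G$) in time $O^*(d^{\mathrm{tw}})$.
   Context: For a graph $G=(V,E)$ with edge-length function $w:E\to\mathbb{N}^+$, $d(u,v)$ denotes the shortest-path distance. A $d$-scattered set is a set $K\subseteq V$ such that $d(u,v)\ge d$ for all distinct $u,v\in K$. A nice tree decomposition is a rooted binary tree decomposition whose nodes are leaf nodes (bag of size 1), introduce nodes (one child, bag = child's bag plus one vertex), forget nodes (one child, bag = child's bag minus one vertex), and join nodes (two children with identical bags); its width is the maximum bag size minus one. $O^*(\cdot)$ hides factors polynomial in the input size. *)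

(* Defs.v *)
From mathcomp Require Import all_boot.

Set Implicit Arguments.
Unset Strict Implicit.
Unset Printing Implicit Defensive.

(** * Random access machine under the logarithmic cost criterion

  A RAM in the style of Aho, Hopcroft and Ullman, with structured control
  instead of jumps.  Each operation is charged according to the bit lengths of
  the numbers and addresses it handles, so that long numbers are not free and
  the model is polynomially related to Turing machines. *)

Definition bits (a : nat) : nat := (trunc_log 2 a).+1.

Record state := State { reg : nat -> nat; mem : nat -> nat }.

Definition upd (f : nat -> nat) (i a : nat) : nat -> nat :=
  fun j => if j == i then a else f j.

(* [Sub] is truncated subtraction; [a / 0] is [0]. *)
Inductive binop := Add | Sub | Mul | Div.

Definition op_val (o : binop) (a b : nat) : nat :=
  match o with
  | Add => a + b
  | Sub => a - b
  | Mul => a * b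
  | Div => a %/ b
  end.

Inductive expr :=
  | Cst of nat
  | Reg of nat
  | Read of expr
  | Op of binop & expr & expr.

Fixpoint eval (s : state) (e : expr) : nat :=
  match e with
  | Cst a => a
  | Reg i => reg s i
  | Read e1 => mem s (eval s e1)
  | Op o e1 e2 => op_val o (eval s e1) (eval s e2)
  end.

(* Arithmetic is charged at the schoolbook rate for multiplication. *)
Fixpoint ecost (s : state) (e : expr) : nat :=
  match e with
  | Cst a => bits a
  | Reg i => bits i + bits (reg s i)
  | Read e1 => ecost s e1 + bits (eval s e1) + bits (mem s (eval s e1))
  | Op o e1 e2 =>
      ecost s e1 + ecost s e2 + bits (eval s e1) * bits (eval s e2)
  end.

Inductive com :=
  | Skip
  | Set_ of nat & expr
  | Store of expr & expr
  | Seq of com & com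
  | If of expr & com & com
  | While of expr & com.

(* [exec P s s' t]: started in [s], [P] halts in [s'] after time [t].
   A test succeeds when its value is nonzero. *)
Inductive exec : com -> state -> state -> nat -> Prop :=
  | ExecSkip s : exec Skip s s 1
  | ExecSet i e s :
      exec (Set_ i e) s (State (upd (reg s) i (eval s e)) (mem s))
        (ecost s e + bits i + bits (eval s e))
  | ExecStore e1 e2 s :
      exec (Store e1 e2) s
        (State (reg s) (upd (mem s) (eval s e1) (eval s e2)))
        (ecost s e1 + ecost s e2 + bits (eval s e1) + bits (eval s e2))
  | ExecSeq P Q s s1 s2 t1 t2 :
      exec P s s1 t1 -> exec Q s1 s2 t2 -> exec (Seq P Q) s s2 (t1 + t2)
  | ExecIfT e P Q s s1 t :
      eval s e != 0 -> exec P s s1 t -> exec (If e P Q) s s1 (ecost s e + 1 + t)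
  | ExecIfF e P Q s s1 t :
      eval s e = 0 -> exec Q s s1 t -> exec (If e P Q) s s1 (ecost s e + 1 + t)
  | ExecWhileT e P s s1 s2 t1 t2 :
      eval s e != 0 -> exec P s s1 t1 -> exec (While e P) s1 s2 t2 ->
      exec (While e P) s s2 (ecost s e + 1 + t1 + t2)
  | ExecWhileF e P s :
      eval s e = 0 -> exec (While e P) s s (ecost s e + 1).

(* The input words occupy memory cells 0, 1, ...; everything else is 0. *)
Definition init (I : seq nat) : state :=
  State (fun=> 0) (fun j => nth 0 I j).

(* The output is read from register 0. *)
Definition runs (P : com) (I : seq nat) (out t : nat) : Prop :=
  exists2 s : state, exec P (init I) s t & reg s 0 = out.

Definition input_size (I : seq nat) : nat := \sum_(a <- I) bits a.

(** * Weighted graphs and scattered sets *)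

(* [weight u v] is meaningful only when [u] and [v] are adjacent. *)
Record wgraph (n : nat) := WGraph {
  adj : rel 'I_n;
  weight : 'I_n -> 'I_n -> nat;
  adj_sym : forall u v, adj u v = adj v u;
  adj_irr : forall u, adj u u = false;
  weight_sym : forall u v, adj u v -> weight u v = weight v u;
  weight_gt0 : forall u v, adj u v -> 0 < weight u v
}.

Section Graph.
Variables (n : nat) (G : wgraph n).
Implicit Types (u v : 'I_n) (p : seq 'I_n).

Fixpoint path_length u p : nat :=
  if p is v :: p' then weight G u v + path_length v p' else 0.

Definition is_path u v p : bool :=
  [&& path (adj G) u p, last u p == v & uniq (u :: p)].

(* Distances live in [option nat], where [None] stands for infinity. *)
Definition omin (x y : option nat) : option nat :=
  match x, y with
  | Some a, Some b => Some (minn a b)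
  | Some _, None => x
  | None, _ => y
  end.

(* A path has at most n vertices, so fewer than n after the first one. *)
Definition dist u v : option nat :=
  \big[omin/None]_(m < n) \big[omin/None]_(p : m.-tuple 'I_n | is_path u v p)
    Some (path_length u p).

Definition dist_ge u v (d : nat) : bool :=
  if dist u v is Some l then d <= l else true.

Definition scattered (d : nat) (K : {set 'I_n}) : bool :=
  [forall u in K, forall v in K, (u != v) ==> dist_ge u v d].

Definition num_scattered (d k : nat) : nat :=
  #|[set K : {set 'I_n} | scattered d K && (#|K| == k)]|.

End Graph.

(** * Nice tree decompositions *)

Inductive ntd (n : nat) :=
  | Leaf of 'I_n
  | Introduce of 'I_n & ntd n
  | Forget of 'I_n & ntd n
  | Join of ntd n & ntd n.
Arguments Leaf {n}.

Section Decomposition.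
Variable n : nat.
Implicit Types (v : 'I_n) (T : ntd n) (a b : seq bool).

Fixpoint bag T : {set 'I_n} :=
  match T with
  | Leaf v => [set v]
  | Introduce v T1 => v |: bag T1
  | Forget v T1 => bag T1 :\ v
  | Join T1 _ => bag T1
  end.

Fixpoint nice T : bool :=
  match T with
  | Leaf _ => true
  | Introduce v T1 => (v \notin bag T1) && nice T1
  | Forget v T1 => (v \in bag T1) && nice T1
  | Join T1 T2 => [&& bag T1 == bag T2, nice T1 & nice T2]
  end.

(* Nodes are addressed by the branch leading to them from the root; an only
   child is reached by [false]. *)
Fixpoint subtree T a : option (ntd n) :=
  match a with
  | [::] => Some T
  | c :: a' =>
      match T with
      | Leaf _ => None
      | Introduce _ T1 | Forget _ T1 => if c then None else subtree T1 a'
      | Join T1 T2 => subtree (if c then T2 else T1) a'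
      end
  end.

(* Addresses of no node get the empty bag. *)
Definition bag_at T a : {set 'I_n} :=
  if subtree T a is Some T' then bag T' else set0.

Definition tree_adj a b : bool :=
  [exists c : bool, (b == rcons a c) || (a == rcons b c)].

Record tree_decomposition (G : wgraph n) T : Prop := TreeDecomposition {
  td_vertex : forall v, exists a, v \in bag_at T a;
  td_edge : forall u v, adj G u v ->
    exists a, (u \in bag_at T a) && (v \in bag_at T a);
  td_connected : forall v a b, v \in bag_at T a -> v \in bag_at T b ->
    exists p, [&& path tree_adj a p, last a p == b
                & all (fun x => v \in bag_at T x) p]
}.

Fixpoint max_bag T : nat :=
  match T with
  | Leaf _ => #|bag T|
  | Introduce _ T1 | Forget _ T1 => maxn #|bag T| (max_bag T1)
  | Join T1 T2 => maxn #|bag T| (maxn (max_bag T1) (max_bag T2))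
  end.

Definition width T : nat := (max_bag T).-1.

(** * Machine input

  The instance is written as n, k, d, the n x n matrix of edge lengths row by
  row (0 for a non-edge), then the decomposition in postorder, one
  (tag, vertex) pair per node, closed by 0. *)

Fixpoint encode_ntd T : seq nat :=
  match T with
  | Leaf v => [:: 1; val v]
  | Introduce v T1 => encode_ntd T1 ++ [:: 2; val v]
  | Forget v T1 => encode_ntd T1 ++ [:: 3; val v]
  | Join T1 T2 => encode_ntd T1 ++ encode_ntd T2 ++ [:: 4; 0]
  end.

Definition encode_graph (G : wgraph n) : seq nat :=
  [seq if adj G u v then weight G u v else 0 | u <- enum 'I_n, v <- enum 'I_n].

Definition encode (G : wgraph n) (k d : nat) T : seq nat :=
  [:: n; k; d] ++ encode_graph G ++ encode_ntd T ++ [:: 0].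

End Decomposition.

(* Main.v *)
(** Let [D] be the distance capped at [d], and consider a node of the
  decomposition with bag [B] whose subtree contains the vertices [U].  A
  scattered set [K] inside [U] acts on the rest of the graph only through its
  profile on [B]: whether [b] belongs to [K], and otherwise the number
  [min (d - 1, D b (K \ B))].  This leaves [d] states per vertex, and since
  [D b u] takes at most [n] values while [u] varies, one of the [#|B|] factors
  [d] may be replaced by [n + 1]: every table has at most
  [(n + 1) * d ^ width] entries.  An entry is the single number
  [sum_K X ^ #|K \ B|], over the sets [K] with the given profile, for a large
  power of two [X]; the digits of the final number in base [X] are the counts.

  Introducing and forgetting a vertex act on profiles one by one.  At a join,
  two sets that agree on [B] have a scattered union iff their states satisfy
  [x + y >= d] at each [b] outside both, and the union then has state
  [min (x, y)].  Hence at most one of [x], [y] is low (below [d / 2]).  Allow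
  collisions of equal low states, each at the price of a factor [t]: the
  resulting product on the state space of one vertex is diagonalized by the
  characters [chi], so that a join consists of one linear transform per bag
  vertex, a pointwise product and the inverse transforms.  As [t] exceeds every
  true count, reduction modulo [t] discards the collisions.

  The machine's memory serves as a hash table: an entry is stored at an address
  computed from its profile, read as a number in base [d + 1]. *)

Require Import Defs.
From mathcomp Require Import all_boot zify.

Set Implicit Arguments.
Unset Strict Implicit.
Unset Printing Implicit Defensive.

(** A low state glued with itself gives nothing, so in the true join product it squares to zero, and
    nilpotent elements rule out a basis of characters. The price [t] turns this square into [t]
    times the state. The inverse transform then divides by [t], exactly, and the true product is
    what remains modulo [t]. One subtraction per digit suffices for the inverse, because the larger
    states compatible with a given one form an interval ending at [d - 1], and the indicator of such
    an interval, restricted to the candidate states, is again a character.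

    Logarithmic cost makes the length of every number part of the argument: all values are kept
    below [2 ^ l] with [l] cubic in the input size, and an elementary operation costs a multiple of
    [l * l]. To get the factor [d ^ width] to the first power only, the program is written in a
    small language whose loops are labelled by one of two bounds; its running time is a polynomial
    in these bounds, of degree one in the table size. *)

Inductive aexp :=
  | Lit of nat
  | Var of nat
  | Len
  | Inp of aexp
  | Arr of nat & aexp & aexp
  | Bin of binop & aexp & aexp.

(* The boolean of a loop says which of two bounds limits its number of rounds:
   the table size if it is true, a polynomial if it is false. *)
Inductive acom :=
  | Nop
  | Let of nat & aexp
  | Put of nat & aexp & aexp & aexp
  | Then of acom & acom
  | Cond of aexp & acom & acom
  | For of bool & nat & aexp & acom.

(** * A loop language with arrays and its Hoare triples *)

Record store := Sto { rg : nat -> nat; ar : nat -> nat -> nat -> nat }.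

(** [eqn] on numerals reduces by simplification, so reads of the concrete registers of the program
    compute. *)
Definition setr i a s := Sto (fun j => if eqn j i then a else rg s j) (ar s).

Definition putr k a b x s :=
  Sto (rg s) (fun k' => if eqn k' k then
      fun a' b' => if (a' == a) && (b' == b) then x else ar s k a' b'
    else ar s k').

Fixpoint wr c : seq nat :=
  match c with
  | Nop | Put _ _ _ _ => [::]
  | Let i _ => [:: i]
  | Then c1 c2 | Cond _ c1 c2 => wr c1 ++ wr c2
  | For _ i _ c1 => i :: wr c1
  end.

Fixpoint wa c : seq nat :=
  match c with
  | Nop | Let _ _ => [::]
  | Put k _ _ _ => [:: k]
  | Then c1 c2 | Cond _ c1 c2 => wa c1 ++ wa c2
  | For _ _ _ c1 => wa c1
  end.

Fixpoint wf c : bool :=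
  match c with
  | Nop | Let _ _ | Put _ _ _ _ => true
  | Then c1 c2 | Cond _ c1 c2 => wf c1 && wf c2
  | For _ i _ c1 => (i \notin wr c1) && wf c1
  end.

Section Semantics.
Variables (I : seq nat) (l : nat) (bnd : bool -> nat).

Fixpoint ev s e : nat :=
  match e with
  | Lit a => a
  | Var i => rg s i
  | Len => size I
  | Inp e1 => nth 0 I (ev s e1)
  | Arr k a b => ar s k (ev s a) (ev s b)
  | Bin o a b => op_val o (ev s a) (ev s b)
  end.

Fixpoint run c s : store :=
  match c with
  | Nop => s
  | Let i e => setr i (ev s e) s
  | Put k a b e => putr k (ev s a) (ev s b) (ev s e) s
  | Then c1 c2 => run c2 (run c1 s)
  | Cond e c1 c2 => if ev s e != 0 then run c1 s else run c2 s
  | For _ i e c1 =>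
      iter (ev s e) (fun s1 => let s2 := run c1 s1 in setr i (rg s2 i).+1 s2)
        (setr i 0 s)
  end.

(** [run] is total and carries no cost. [ok] collects what the time bound asks for: assigned values
    fit in [l] bits, and each loop respects the bound named by its label. The lengths of addresses
    follow, an address being a fixed expression over cells of at most [l] bits. *)
Fixpoint ok c s : Prop :=
  match c with
  | Nop => True
  | Let i e => ev s e < 2 ^ l
  | Put k a b e => ev s e < 2 ^ l
  | Then c1 c2 => ok c1 s /\ ok c2 (run c1 s)
  | Cond e c1 c2 => if ev s e != 0 then ok c1 s else ok c2 s
  | For b i e c1 =>
      ev s e <= bnd b /\ forall k, k < ev s e ->
      ok c1 (iter k (fun s1 => let s2 := run c1 s1 in setr i (rg s2 i).+1 s2)
        (setr i 0 s))
  end.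

Definition tri s c (Q : store -> Prop) := ok c s /\ Q (run c s).

Lemma tri_nop s (Q : store -> Prop) : Q s -> tri s Nop Q.
Proof. by []. Qed.

Lemma tri_let s i e (Q : store -> Prop) :
  ev s e < 2 ^ l -> Q (setr i (ev s e) s) -> tri s (Let i e) Q.
Proof. by []. Qed.

Lemma tri_put s k a b e (Q : store -> Prop) :
  ev s e < 2 ^ l -> Q (putr k (ev s a) (ev s b) (ev s e) s) ->
  tri s (Put k a b e) Q.
Proof. by []. Qed.

Lemma tri_then s c1 c2 Q :
  tri s c1 (fun s1 => tri s1 c2 Q) -> tri s (Then c1 c2) Q.
Proof. by rewrite /tri /=; tauto. Qed.

Lemma tri_cond s e c1 c2 Q :
  (ev s e != 0 -> tri s c1 Q) -> (ev s e = 0 -> tri s c2 Q) ->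
  tri s (Cond e c1 c2) Q.
Proof.
rewrite /tri /=; case: eqVneq => [E _ H2|_ H1 _]; [exact: H2 | exact: H1].
Qed.

Lemma tri_weaken s c (P Q : store -> Prop) :
  tri s c P -> (forall s', P s' -> Q s') -> tri s c Q.
Proof. by move=> [? ?] H; split=> //; exact: H. Qed.

Lemma iter_frame i c1 s m : (forall s, forall r, r \notin wr c1 -> rg (run c1 s) r = rg s r) ->
  forall r, r \notin i :: wr c1 ->
  rg (iter m (fun s1 => let s2 := run c1 s1 in setr i (rg s2 i).+1 s2) s) r = rg s r.
Proof.
move=> IH r; rewrite inE negb_or => /andP[ri rc].
by elim: m => //= m IHm; rewrite -[eqn r i]/(r == i) (negPf ri) IH.
Qed.

Lemma iter_aframe i c1 s m : (forall s, forall r, r \notin wa c1 -> ar (run c1 s) r = ar s r) ->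
  forall r, r \notin wa c1 ->
  ar (iter m (fun s1 => let s2 := run c1 s1 in setr i (rg s2 i).+1 s2) s) r = ar s r.
Proof. by move=> IH r rc; elim: m => //= m IHm; rewrite IH. Qed.

Lemma run_frame c s r : r \notin wr c -> rg (run c s) r = rg s r.
Proof.
elim: c s r => //= [i e|c1 IH1 c2 IH2|e c1 IH1 c2 IH2|b i e c1 IH] s r.
- by rewrite inE -[eqn r i]/(r == i) => /negPf->.
- by rewrite mem_cat negb_or => /andP[h1 h2]; rewrite IH2 ?IH1.
- by rewrite mem_cat negb_or => /andP[h1 h2]; case: ifP => _; rewrite ?IH2 ?IH1.
move=> h; rewrite iter_frame //=.
by move: h; rewrite inE negb_or -[eqn r i]/(r == i) => /andP[/negPf-> _].
Qed.

Lemma run_aframe c s r : r \notin wa c -> ar (run c s) r = ar s r.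
Proof.
elim: c s r => //= [k a b e|c1 IH1 c2 IH2|e c1 IH1 c2 IH2|b i e c1 IH] s r.
- by rewrite inE -[eqn r k]/(r == k) => /negPf->.
- by rewrite mem_cat negb_or => /andP[h1 h2]; rewrite IH2 ?IH1.
- by rewrite mem_cat negb_or => /andP[h1 h2]; case: ifP => _; rewrite ?IH2 ?IH1.
by move=> h; rewrite iter_aframe.
Qed.

Definition frame (R A : seq nat) s s' :=
  (forall r, r \notin R -> rg s' r = rg s r) /\
  (forall k, k \notin A -> ar s' k = ar s k).

Lemma tri_frame s c Q :
  tri s c Q -> tri s c (fun s' => Q s' /\ frame (wr c) (wa c) s s').
Proof.
move=> [h1 h2]; split=> //; split=> //; split=> r.
  exact: run_frame.
exact: run_aframe.
Qed.

(** Each round may use the frame relative to the state before the loop, so an invariant mentions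
    only what the body changes. The body does not write [i], whose value is therefore the number of
    the round. *)
Lemma tri_for (Inv : nat -> store -> Prop) s b i e c (Q : store -> Prop) :
  i \notin wr c -> ev s e <= bnd b ->
  Inv 0 (setr i 0 s) ->
  (forall k s', k < ev s e -> rg s' i = k -> frame (i :: wr c) (wa c) s s' ->
     Inv k s' -> tri s' c (fun s2 => Inv k.+1 (setr i k.+1 s2))) ->
  (forall s', rg s' i = ev s e -> frame (i :: wr c) (wa c) s s' ->
     Inv (ev s e) s' -> Q s') ->
  tri s (For b i e c) Q.
Proof.
move=> ic le0 I0 IS IQ; rewrite /tri /=.
set m := ev s e in IS IQ *; set F := (fun s1 => _).
have FE x : F x = setr i (rg (run c x) i).+1 (run c x) by [].
have fr k : frame (i :: wr c) (wa c) s (iter k F (setr i 0 s)).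
  split=> r h.
    rewrite iter_frame //=; last by move=> *; exact: run_frame.
    by move: h; rewrite inE negb_or -[eqn r i]/(r == i) => /andP[/negPf-> _].
  by rewrite iter_aframe //= => *; exact: run_aframe.
have H k : k <= m -> [/\ rg (iter k F (setr i 0 s)) i = k,
    Inv k (iter k F (setr i 0 s)) &
    forall j, j < k -> ok c (iter j F (setr i 0 s))].
  elim: k => [_|k IH km].
    by split=> //=; rewrite -[eqn i i]/(i == i) eqxx.
  have [r1 r2 r3] := IH (ltnW km).
  have [o1 o2] := IS k _ km r1 (fr k) r2.
  have ri : rg (run c (iter k F (setr i 0 s))) i = k by rewrite run_frame.
  split; rewrite ?iterS ?FE ?ri //.
    by rewrite /= -[eqn i i]/(i == i) eqxx.
  move=> j; rewrite ltnS leq_eqVlt => /orP[/eqP->//|]; exact: r3.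
have [r1 r2 r3] := H m (leqnn m).
split; first by split.
exact: IQ.
Qed.

End Semantics.

(** * Compilation to the machine and the cost of compiled code *)

Definition pr a b := (a + b) * (a + b) + a.

(** As [a <= a + b], the value lies between the squares of [a + b] and [(a + b).+1], so its integer
    root is [a + b] and the remainder is [a]. A polynomial pairing keeps addresses short. *)
Lemma pr_inj a b a' b' : pr a b = pr a' b' -> a = a' /\ b = b'.
Proof.
rewrite /pr => H.
have E : a + b = a' + b'.
  case: (ltngtP (a + b) (a' + b')) => // h; exfalso.
    have : (a + b).+1 * (a + b).+1 <= (a' + b') * (a' + b') by rewrite leq_mul.
    lia.
  have : (a' + b').+1 * (a' + b').+1 <= (a + b) * (a + b) by rewrite leq_mul.
  lia.
by move: H; rewrite E; lia.
Qed.

Definition prE a b := Op Add (Op Mul (Op Add a b) (Op Add a b)) a.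

Fixpoint cexp e : expr :=
  match e with
  | Lit a => Cst a
  | Var i => Reg i.*2
  | Len => Reg 1
  | Inp e1 => (* the second factor is 1 on the input words and 0 beyond *)
      Op Mul (Read (cexp e1))
        (Op Defs.Sub (Cst 1) (Op Defs.Sub (Cst 1) (Op Defs.Sub (Reg 1) (cexp e1))))
  | Arr k a b => Read (Op Add (Reg 1) (prE (Cst k) (prE (cexp a) (cexp b))))
  | Bin o a b => Op o (cexp a) (cexp b)
  end.

(* Variable [i] lives in register [2i], register 1 holds the input length, and
   register [2i + 3] counts the remaining rounds of a loop on [i]. *)
Fixpoint compile c : com :=
  match c with
  | Nop => Skip
  | Let i e => Set_ i.*2 (cexp e)
  | Put k a b e =>
      Store (Op Add (Reg 1) (prE (Cst k) (prE (cexp a) (cexp b)))) (cexp e)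
  | Then c1 c2 => Seq (compile c1) (compile c2)
  | Cond e c1 c2 => If (cexp e) (compile c1) (compile c2)
  | For _ i e c1 =>
      Seq (Set_ i.*2.+3 (cexp e)) (Seq (Set_ i.*2 (Cst 0))
        (While (Reg i.*2.+3) (Seq (compile c1)
          (Seq (Set_ i.*2 (Op Add (Reg i.*2) (Cst 1)))
               (Set_ i.*2.+3 (Op Defs.Sub (Reg i.*2.+3) (Cst 1)))))))
  end.

(** [esz] bounds the length of the value in units of [l] bits, and [ecst] the evaluation cost in
    units of [l * l]; both depend on the expression alone. *)
Fixpoint esz e :=
  match e with
  | Cst a => a.+1
  | Reg _ | Read _ => 1
  | Op _ e1 e2 => esz e1 + esz e2
  end.

Fixpoint ecst e :=
  match e with
  | Cst a => a.+1
  | Reg i => i.+2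
  | Read e1 => ecst e1 + esz e1 + 1
  | Op _ e1 e2 => ecst e1 + ecst e2 + esz e1 * esz e2
  end.

Definition setcost i e := ecst e + i.+1 + esz e.

Fixpoint tm (bnd : bool -> nat) c :=
  match c with
  | Nop => 1
  | Let i e => setcost i.*2 (cexp e)
  | Put k a b e =>
      let a' := Op Add (Reg 1) (prE (Cst k) (prE (cexp a) (cexp b))) in
      ecst a' + ecst (cexp e) + esz a' + esz (cexp e)
  | Then c1 c2 => tm bnd c1 + tm bnd c2
  | Cond e c1 c2 => ecst (cexp e) + 1 + (tm bnd c1 + tm bnd c2)
  | For b i e c1 =>
      setcost i.*2.+3 (cexp e) + (setcost i.*2 (Cst 0) +
       (bnd b * (i.*2.+3.+3 + (tm bnd c1 +
          (setcost i.*2 (Op Add (Reg i.*2) (Cst 1)) +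
           setcost i.*2.+3 (Op Defs.Sub (Reg i.*2.+3) (Cst 1))))) +
        i.*2.+3.+3))
  end.

Lemma bits_le a l : 0 < l -> a < 2 ^ l -> bits a <= l.
Proof.
move=> l0 h; rewrite /bits; case: (posnP a) => [->|a0]; first by rewrite trunc_log0.
by rewrite -(ltn_exp2l (m := 2)) //; apply: leq_ltn_trans h; exact: trunc_logP.
Qed.

Lemma bits_leS a : bits a <= a.+1.
Proof. by apply: bits_le => //; rewrite ltnW // ltn_expl. Qed.

Section Cost.
Variables (l : nat).
Hypothesis l0 : 0 < l.

Definition bounded (s : state) :=
  (forall i, reg s i < 2 ^ l) /\ (forall j, Defs.mem s j < 2 ^ l).

Lemma esz_gt0 e : 0 < esz e.
Proof. by elim: e => //= o e1 h1 e2 h2; rewrite addn_gt0 h1. Qed.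

Lemma eval_lt s e : bounded s -> eval s e < 2 ^ (l * esz e).
Proof.
move=> [br bm]; elim: e => [a|i|e _|o e1 h1 e2 h2] /=.
- apply: (@leq_trans (2 ^ a.+1)); first by rewrite ltnW // ltn_expl.
  by rewrite leq_exp2l // leq_pmull.
- by rewrite muln1.
- by rewrite muln1.
set A := 2 ^ (l * esz e1) in h1; set B := 2 ^ (l * esz e2) in h2.
have A2 : 2 <= A.
  by rewrite -[2]/(2 ^ 1) /A leq_exp2l // muln_gt0 l0 esz_gt0.
have B2 : 2 <= B.
  by rewrite -[2]/(2 ^ 1) /B leq_exp2l // muln_gt0 l0 esz_gt0.
rewrite mulnDr expnD -/A -/B.
case: o => /=.
- apply: (@leq_ltn_trans (A.-1 + B.-1)); first by lia.
  case: A A2 {h1} => [|[|a]] // _; case: B B2 {h2} => [|[|b]] // _; lia.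
- apply: (@leq_ltn_trans (eval s e1)); first exact: leq_subr.
  by apply: (leq_trans h1); rewrite leq_pmulr // ltnW.
- by rewrite ltn_mul.
apply: (@leq_ltn_trans (eval s e1)); first exact: leq_div.
by apply: (leq_trans h1); rewrite leq_pmulr // ltnW.
Qed.

Lemma eval_bits s e : bounded s -> bits (eval s e) <= l * esz e.
Proof. by move=> b; apply: bits_le; rewrite ?muln_gt0 ?l0 ?esz_gt0 //; exact: eval_lt. Qed.

Lemma l_le : l <= l * l. Proof. by rewrite leq_pmulr. Qed.

Lemma eval_bits2 s e : bounded s -> bits (eval s e) <= esz e * (l * l).
Proof.
move=> b; apply: (leq_trans (eval_bits e b)).
by rewrite mulnC leq_pmul2l ?esz_gt0 // l_le.
Qed.

Lemma bits_i i : bits i <= i.+1 * (l * l).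
Proof. by apply: (leq_trans (bits_leS i)); rewrite leq_pmulr // muln_gt0 l0. Qed.

Lemma ecost_le s e : bounded s -> ecost s e <= ecst e * (l * l).
Proof.
move=> b; elim: e => [a|i|e h|o e1 h1 e2 h2] /=.
- exact: bits_i.
- rewrite -[i.+2]addn1 mulnDl leq_add ?bits_i // mul1n (leq_trans _ l_le) //.
  by apply: bits_le => //; case: b.
- rewrite !mulnDl !leq_add ?eval_bits2 //.
  by rewrite mul1n (leq_trans _ l_le) //; apply: bits_le => //; case: b.
rewrite !mulnDl !leq_add // [in X in _ <= X]mulnACA.
by rewrite leq_mul // mulnC eval_bits.
Qed.

Lemma bounded_set s i a : a < 2 ^ l -> bounded s ->
  bounded (State (upd (reg s) i a) (Defs.mem s)).
Proof.
by move=> h [b1 b2]; split=> //= j; rewrite /upd; case: eqP.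
Qed.

Lemma exec_set s i e : bounded s -> eval s e < 2 ^ l ->
  exists2 t, exec (Set_ i e) s (State (upd (reg s) i (eval s e)) (Defs.mem s)) t
   & t <= setcost i e * (l * l).
Proof.
move=> b h; eexists; first exact: ExecSet.
rewrite /setcost !mulnDl leq_add ?eval_bits2 // leq_add ?bits_i //.
exact: ecost_le.
Qed.

Variables (I : seq nat) (bnd : bool -> nat).
Hypothesis hbnd : forall b, bnd b < 2 ^ l.

(** Arrays live beyond the input in memory, where cells start at 0 as in an empty store; the input
    words themselves are never overwritten. *)
Definition rep (s : store) (g : state) :=
  [/\ forall i, reg g i.*2 = rg s i, reg g 1 = size I,
      forall j, j < size I -> Defs.mem g j = nth 0 I j
    & forall k a b, Defs.mem g (size I + pr k (pr a b)) = ar s k a b].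

Lemma rep_ev s g e : rep s g -> eval g (cexp e) = ev I s e.
Proof.
move=> [h1 h2 h3 h4]; elim: e => //= [e ->|k a -> b ->|o a -> b ->] //.
  rewrite h2; case: (ltnP (ev I s e) (size I)) => h.
    rewrite h3 //; have -> : 1 - (1 - (size I - ev I s e)) = 1 by lia.
    by rewrite muln1.
  have -> : 1 - (1 - (size I - ev I s e)) = 0 by lia.
  by rewrite muln0 nth_default.
by rewrite h2 -h4.
Qed.

Lemma rep_setr s g i a : rep s g ->
  rep (setr i a s) (State (upd (reg g) i.*2 a) (Defs.mem g)).
Proof.
move=> [h1 h2 h3 h4]; split=> //= [j|].
  rewrite /upd -[eqn j i]/(j == i).
  have -> : (j.*2 == i.*2) = (j == i) by lia.
  by rewrite h1.
by rewrite /upd; have -> : (1 == i.*2) = false by lia.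
Qed.

Lemma rep_upd_hidden s g i a : rep s g ->
  rep s (State (upd (reg g) i.*2.+3 a) (Defs.mem g)).
Proof.
move=> [h1 h2 h3 h4]; split=> //= j.
by rewrite /upd h1; have -> : (j.*2 == i.*2.+3) = false by lia.
Qed.

Lemma rep_putr s g k a b x : rep s g ->
  rep (putr k a b x s)
    (State (reg g) (upd (Defs.mem g) (size I + pr k (pr a b)) x)).
Proof.
move=> [h1 h2 h3 h4]; split=> //= [j jI|k' a' b'].
  by rewrite /upd ltn_eqF ?h3 // ltn_addr.
rewrite /upd h4 -[eqn k' k]/(k' == k) eqn_add2l.
case: (eqVneq k' k) => [->|nk].
  case: (eqVneq a' a) => [->|na] /=.
    case: (eqVneq b' b) => [->|nb] /=; first by rewrite eqxx.
    by case: eqP => // /pr_inj[_ /pr_inj[_ /eqP]]; rewrite (negPf nb).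
  by case: eqP => // /pr_inj[_ /pr_inj[/eqP]]; rewrite (negPf na).
by case: eqP => // /pr_inj[/eqP]; rewrite (negPf nk).
Qed.

(** The last conjunct carries the induction: the body of a loop on [i] must preserve the hidden
    counter in register [i.*2.+3], and it does so because well-formedness keeps [i] out of the
    variables written there, inner loop variables included. *)
Lemma compile_ok c s g : wf c -> rep s g -> bounded g -> ok I l bnd c s ->
  exists g' t, [/\ exec (compile c) g g' t, rep (run I c s) g', bounded g',
    t <= tm bnd c * (l * l)
    & forall i, i \notin wr c -> reg g' i.*2.+3 = reg g i.*2.+3].
Proof.
have ll : 0 < l * l by rewrite muln_gt0 l0.
elim: c s g => [|i e|k a b e|c1 IH1 c2 IH2|e c1 IH1 c2 IH2|b i e c1 IH] s g /=.
- by move=> _ r bd _; exists g, 1; split=> //; [exact: ExecSkip | rewrite mul1n].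
- move=> _ r bd h; have E := rep_ev e r.
  have h' : eval g (cexp e) < 2 ^ l by rewrite E.
  have [t t1 t2] := exec_set i.*2 bd h'.
  exists (State (upd (reg g) i.*2 (eval g (cexp e))) (Defs.mem g)), t; split=> //.
  + by rewrite -E; exact: rep_setr.
  + exact: bounded_set.
  by move=> j _ /=; rewrite /upd; have -> : (j.*2.+3 == i.*2) = false by lia.
- move=> _ r bd h; have E := rep_ev e r.
  set A := Op Add _ _; pose C := cexp e.
  exists (State (reg g) (upd (Defs.mem g) (eval g A) (eval g C))).
  exists (ecost g A + ecost g C + bits (eval g A) + bits (eval g C)); split=> //.
  + exact: ExecStore.
  + rewrite /C E; have -> : eval g A = size I + pr k (pr (ev I s a) (ev I s b)).
      by rewrite /= !(rep_ev _ r); case: r => _ -> _ _.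
    exact: rep_putr.
  + case: bd => b1 b2; split=> //= j; rewrite /upd; case: eqP => // _.
    by rewrite /C E.
  change (ecost g A + ecost g C + bits (eval g A) + bits (eval g C) <=
    (ecst A + ecst C + esz A + esz C) * (l * l)).
  move: (ecost_le A bd) (ecost_le C bd) (eval_bits2 A bd) (eval_bits2 C bd).
  move: (ecst A) (ecst C) (esz A) (esz C) (ecost g A) (ecost g C) => ? ? ? ? ? ?.
  by rewrite !mulnDl => *; rewrite !leq_add.
- move=> /andP[w1 w2] r bd [o1 o2].
  have [g1 [t1 [e1 r1 b1 h1 f1]]] := IH1 s g w1 r bd o1.
  have [g2 [t2 [e2 r2 b2 h2 f2]]] := IH2 _ g1 w2 r1 b1 o2.
  exists g2, (t1 + t2); split=> //; first exact: ExecSeq e1 e2.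
    by rewrite mulnDl leq_add.
  by move=> i; rewrite mem_cat negb_or => /andP[n1 n2]; rewrite f2 ?f1.
- move=> /andP[w1 w2] r bd; have E := rep_ev e r.
  case: eqVneq => [e0|e0] o.
    have [g2 [t2 [e2 r2 b2 h2 f2]]] := IH2 s g w2 r bd o.
    exists g2, (ecost g (cexp e) + 1 + t2); split=> //.
    + by apply: ExecIfF => //; rewrite E.
    + by rewrite !mulnDl !leq_add ?ecost_le ?mul1n // (leq_trans h2) // leq_addl.
    by move=> i; rewrite mem_cat negb_or => /andP[n1 n2]; rewrite f2.
  have [g2 [t2 [e2 r2 b2 h2 f2]]] := IH1 s g w1 r bd o.
  exists g2, (ecost g (cexp e) + 1 + t2); split=> //.
  + by apply: ExecIfT => //; rewrite E.
  + by rewrite !mulnDl !leq_add ?ecost_le ?mul1n // (leq_trans h2) // leq_addr.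
  by move=> i; rewrite mem_cat negb_or => /andP[n1 n2]; rewrite f2.
move=> /andP[nl w] r bd [o1 o2]; have E := rep_ev e r.
set m := ev I s e in E o1 o2 *.
set F := (fun s1 : store => setr i (rg (run I c1 s1) i).+1 (run I c1 s1)) in o2 *.
have Em : eval g (cexp e) < 2 ^ l by rewrite E; exact: leq_ltn_trans (hbnd b).
have [ta ea ha] := exec_set i.*2.+3 bd Em.
have Bd1 := bounded_set i.*2.+3 Em bd.
set g1 := State _ _ in ea Bd1.
have r1 : rep s g1 by exact: rep_upd_hidden.
have E0 : eval g1 (Cst 0) < 2 ^ l by rewrite /= expn_gt0.
have [tb eb hb] := exec_set i.*2 Bd1 E0.
have Bd2 := bounded_set i.*2 E0 Bd1.
set g2 := State _ _ in eb Bd2.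
have r2 : rep (setr i 0 s) g2 by exact: rep_setr.
have hid2 : reg g2 i.*2.+3 = m.
  rewrite /g2 /g1 /= /upd; have -> : (i.*2.+3 == i.*2) = false by lia.
  by rewrite eqxx.
set body := (Seq (compile c1) (Seq (Set_ i.*2 _) _)).
pose q := i.*2.+3.+3 + (tm bnd c1 +
          (setcost i.*2 (Op Add (Reg i.*2) (Cst 1)) +
           setcost i.*2.+3 (Op Defs.Sub (Reg i.*2.+3) (Cst 1)))).
have testc s' : bounded s' -> ecost s' (Reg i.*2.+3) + 1 <= i.*2.+3.+3 * (l * l).
  move=> b'; have := @ecost_le s' (Reg i.*2.+3) b'; rewrite /=.
  rewrite -[i.*2.+3.+3]addn1 mulnDl mul1n => h; exact: leq_add.
(* Induction on the number [j] of rounds still to run, which is what the hidden counter holds; the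
   store has then gone through [m - j] rounds. *)
have W j g3 : j <= m -> rep (iter (m - j) F (setr i 0 s)) g3 -> bounded g3 ->
    reg g3 i.*2.+3 = j ->
    exists g' t, [/\ exec (While (Reg i.*2.+3) body) g3 g' t,
      rep (iter m F (setr i 0 s)) g', bounded g',
      t <= (j * q + i.*2.+3.+3) * (l * l)
      & forall i', i' \notin i :: wr c1 ->
           reg g' i'.*2.+3 = reg g3 i'.*2.+3].
  elim: j g3 => [|j IHj] g3 jm r3 b3 hj.
    exists g3, (ecost g3 (Reg i.*2.+3) + 1); split=> //.
    + exact: ExecWhileF.
    + by rewrite subn0 in r3.
    by rewrite mul0n add0n testc.
  have km : m - j.+1 < m by lia.
  have [g4 [t4 [e4 r4 b4 h4 f4]]] := IH _ g3 w r3 b3 (o2 _ km).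
  have hid4 : reg g4 i.*2.+3 = j.+1 by rewrite f4.
  pose s4 := run I c1 (iter (m - j.+1) F (setr i 0 s)).
  have r4' : rep s4 g4 := r4.
  have v4 : rg s4 i = m - j.+1.
    rewrite /s4 run_frame //; move: km {jm hj r3 b3 e4 r4 b4 h4 f4 hid4 r4' s4}.
    elim: (m - j.+1) => [|k IHk] km /=; first by rewrite -[eqn i i]/(i == i) eqxx.
    by rewrite -[eqn i i]/(i == i) eqxx run_frame // IHk // ltnW.
  have v4' : reg g4 i.*2 = m - j.+1 by case: r4' => ->.
  have E5 : eval g4 (Op Add (Reg i.*2) (Cst 1)) < 2 ^ l.
    by rewrite /= v4'; apply: (@leq_ltn_trans (bnd b)) => //; lia.
  have [t5 e5 h5] := exec_set i.*2 b4 E5.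
  have Bd5 := bounded_set i.*2 E5 b4.
  set g5 := State _ _ in e5 Bd5.
  have r5 : rep (iter (m - j) F (setr i 0 s)) g5.
    have -> : m - j = (m - j.+1).+1 by lia.
    rewrite iterS {1}/F -/s4 /g5 /= v4' addn1 v4; exact: rep_setr.
  have hid5 : reg g5 i.*2.+3 = j.+1.
    by rewrite /g5 /= /upd; have -> : (i.*2.+3 == i.*2) = false by lia.
  have E6 : eval g5 (Op Defs.Sub (Reg i.*2.+3) (Cst 1)) < 2 ^ l.
    change (reg g5 i.*2.+3 - 1 < 2 ^ l).
    by rewrite hid5 subn1 /=; apply: (@leq_ltn_trans (bnd b)) => //; lia.
  have [t6 e6 h6] := exec_set i.*2.+3 Bd5 E6.
  have Bd6 := bounded_set i.*2.+3 E6 Bd5.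
  set g6 := State _ _ in e6 Bd6.
  have r6 : rep (iter (m - j) F (setr i 0 s)) g6 by exact: rep_upd_hidden.
  have hid6 : reg g6 i.*2.+3 = j.
    change ((if i.*2.+3 == i.*2.+3 then reg g5 i.*2.+3 - 1 else reg g5 i.*2.+3) = j).
    by rewrite eqxx hid5 subn1.
  have [g7 [t7 [e7 r7 b7 h7 f7]]] := IHj g6 (ltnW jm) r6 Bd6 hid6.
  exists g7, (ecost g3 (Reg i.*2.+3) + 1 + (t4 + (t5 + t6)) + t7); split=> //.
  + apply: ExecWhileT e7; first by rewrite /= hj.
    by apply: ExecSeq e4 _; exact: ExecSeq e5 e6.
  + have -> : j.+1 * q + i.*2.+3.+3 = q + (j * q + i.*2.+3.+3) by rewrite mulSn addnA.
    rewrite mulnDl; apply: leq_add h7.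
    move: (testc g3 b3) h4 h5 h6; rewrite /q.
    move: (setcost _ _) (setcost _ _) (tm _ _) (ecost _ _) => ? ? ? ?.
    rewrite !mulnDl => ? ? ? ?; apply: leq_add => //.
    by apply: leq_add => //; apply: leq_add.
  move=> i' ni; rewrite f7 // /g6 /g5 /= /upd.
  move: (ni); rewrite inE negb_or => /andP[n1 n2].
  have -> : (i'.*2.+3 == i.*2.+3) = false by lia.
  have -> : (i'.*2.+3 == i.*2) = false by lia.
  by rewrite f4.
have [|g' [t [e1 e2 e3 e4 e5]]] := W m g2 (leqnn m) _ Bd2 hid2; first by rewrite subnn.
exists g', (ta + (tb + t)); split=> //.
- by apply: ExecSeq ea _; exact: ExecSeq eb e1.
- move: ha hb e4; rewrite /q; move: (setcost _ (cexp e)) (setcost _ (Cst 0)) => x y.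
  rewrite [(x + _) * _]mulnDl [(y + _) * _]mulnDl => ? ? h; apply: leq_add => //.
  apply: leq_add => //; apply: (leq_trans h).
  by rewrite leq_mul2r leq_add2r leq_mul2r o1 !orbT.
move=> i' ni; rewrite e5 // /g2 /g1 /= /upd.
move: (ni); rewrite inE negb_or => /andP[n1 n2].
have -> : (i'.*2.+3 == i.*2) = false by lia.
by have -> : (i'.*2.+3 == i.*2.+3) = false by lia.
Qed.

End Cost.

(** * Distances *)

Section BigMin.
Variable T : eqType.
Implicit Types (r : seq T) (P : pred T) (F : T -> nat).

Lemma bigminn_le r P F d x : x \in r -> P x -> \big[minn/d]_(i <- r | P i) F i <= F x.
Proof.
elim: r => // y r IH; rewrite inE big_cons => /orP[/eqP<- ->|xr Px]; first exact: geq_minl.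
by case: ifP => _; [apply: leq_trans (geq_minr _ _) _|]; exact: IH.
Qed.

Lemma bigminn_le_idx r P F d : \big[minn/d]_(i <- r | P i) F i <= d.
Proof.
elim: r => [|y r IH]; first by rewrite big_nil.
by rewrite big_cons; case: ifP => // _; apply: leq_trans (geq_minr _ _) IH.
Qed.

Lemma bigminn_glb r P F d m : m <= d -> (forall x, x \in r -> P x -> m <= F x) ->
  m <= \big[minn/d]_(i <- r | P i) F i.
Proof.
move=> md; elim: r => [|y r IH] h; first by rewrite big_nil.
have h' : m <= \big[minn/d]_(i <- r | P i) F i.
  by apply: IH => x xr; apply: h; rewrite inE xr orbT.
by rewrite big_cons; case: ifP => // Py; rewrite leq_min h' h ?inE ?eqxx.
Qed.

Lemma bigminn_attained r P F d :
  \big[minn/d]_(i <- r | P i) F i < d ->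
  exists x, [/\ x \in r, P x & F x = \big[minn/d]_(i <- r | P i) F i].
Proof.
elim: r => [|y r IH]; first by rewrite big_nil ltnn.
rewrite big_cons; case: ifP => Py h.
  case: (leqP (F y) (\big[minn/d]_(i <- r | P i) F i)) => h'.
    by exists y; rewrite inE eqxx.
  move: h; rewrite (minn_idPr (ltnW h')) => /IH[x [xr Px E]].
  by exists x; rewrite inE xr orbT.
by have [x [xr Px E]] := IH h; exists x; rewrite inE xr orbT.
Qed.

Lemma bigomin_le r P (F : T -> option nat) x a : x \in r -> P x -> F x = Some a ->
  exists2 l, \big[omin/None]_(i <- r | P i) F i = Some l & l <= a.
Proof.
elim: r => // y r IH; rewrite inE big_cons => /orP[/eqP<- -> ->|xr Px E].
  by case: (\big[omin/None]_(i <- r | P i) F i) => [b|];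
    [exists (minn a b); rewrite ?geq_minl | exists a].
have [l -> la] := IH xr Px E; case: ifP => _; last by exists l.
case: (F y) => [b|]; last by exists l.
by exists (minn b l) => //; apply: leq_trans (geq_minr _ _) la.
Qed.

Lemma bigomin_attained r P (F : T -> option nat) l :
  \big[omin/None]_(i <- r | P i) F i = Some l ->
  exists x, P x /\ F x = Some l.
Proof.
elim: r l => [|y r IH] l; first by rewrite big_nil.
rewrite big_cons; case: ifP => [Py|_ /IH//].
case E: (F y) => [b|] /=; last by move/IH.
case E': (\big[omin/None]_(i <- r | P i) F i) => [c|] [].
  rewrite /minn; case: ifP => _ h; first by exists y; rewrite E h.
  by apply: IH; rewrite E' h.
by move=> h; exists y; rewrite E h.
Qed.

End BigMin.

Section Dist.
Variables (n : nat) (G : wgraph n) (d : nat).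
Implicit Types (u v w : 'I_n) (p : seq 'I_n).

Definition walk u v p := path (adj G) u p && (last u p == v).

Lemma walk_simple u v p : walk u v p -> exists2 p', is_path G u v p' &
  path_length G u p' <= path_length G u p.
Proof.
rewrite /walk /is_path; elim: p u => [|x p IH] u /=.
  by move=> h; exists [::]; rewrite ?andbT.
move=> /andP[/andP[ux pp] lp].
have [|q /and3P[q1 q2 q3] hq] := IH x; first by rewrite pp lp.
case: (boolP (u \in x :: q)) => uq; last first.
  exists (x :: q); last by rewrite /= leq_add2l.
  by rewrite /= ux q1 q2 uq.
(* When [u] recurs on the simple path [q], the part of [q] after that occurrence is a simple path
   from [u] that is no longer. *)
have : path_length G x q <= weight G u x + path_length G x p by apply: leq_trans hq (leq_addl _ _).
move: (_ + _) => m {pp lp ux hq IH}.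
elim: q x q1 q2 q3 uq => [|y q IH] x /=.
  move=> _ q2 _; rewrite inE => /eqP-> _; exists [::] => //.
  by rewrite /= q2.
move=> /andP[xy q1] q2 /andP[xq q3]; rewrite inE => /orP[/eqP-> h|uq h].
  by exists (y :: q) => //=; rewrite xy q1 q2 xq.
by apply: (IH y) => //; apply: leq_trans h; exact: leq_addl.
Qed.

Lemma is_path_walk u v p : is_path G u v p -> walk u v p.
Proof. by case/and3P => h1 h2 _; rewrite /walk h1. Qed.

Lemma is_path_size u v p : is_path G u v p -> size p < n.
Proof.
case/and3P => _ _ /card_uniqP h; rewrite -[(size p).+1]/(size (u :: p)) -h.
by rewrite -[leqRHS]card_ord max_card.
Qed.

Lemma dist_le u v p : walk u v p ->
  exists2 l, dist G u v = Some l & l <= path_length G u p.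
Proof.
case/walk_simple => q iq hq.
have sq : size q < n := is_path_size iq.
have iq' : is_path G u v (in_tuple q) by [].
have [l1 E1 h1] := @bigomin_le _ (index_enum _)
  (fun p : (size q).-tuple 'I_n => is_path G u v p)
  (fun p : (size q).-tuple 'I_n => Some (path_length G u p)) (in_tuple q) _ (mem_index_enum _) iq' erefl.
have [l E h] := @bigomin_le _ (index_enum _) predT
  (fun m : 'I_n => \big[omin/None]_(p : m.-tuple 'I_n | is_path G u v p)
    Some (path_length G u p)) (Ordinal sq) _ (mem_index_enum _) erefl E1.
by exists l => //; apply: (leq_trans h); exact: leq_trans h1 hq.
Qed.

Lemma dist_attained u v l : dist G u v = Some l ->
  exists2 p, is_path G u v p & path_length G u p = l.
Proof.
case/bigomin_attained => m [_] /bigomin_attained[p [ip [h]]].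
by exists p.
Qed.

Definition dcap u v := if dist G u v is Some l then minn d l else d.

Lemma dcap_le u v : dcap u v <= d.
Proof. by rewrite /dcap; case: dist => // l; exact: geq_minl. Qed.

Lemma dcap_walk u v p : walk u v p -> dcap u v <= path_length G u p.
Proof.
by case/dist_le => l; rewrite /dcap => -> h; apply: leq_trans h; exact: geq_minr.
Qed.

Lemma dcap_attained u v : dcap u v < d ->
  exists2 p, is_path G u v p & path_length G u p = dcap u v.
Proof.
rewrite /dcap; case E: dist => [l|]; last by rewrite ltnn.
have [p ip hp] := dist_attained E.
by rewrite /minn; case: ifP => h; rewrite ?ltnn // => _; exists p.
Qed.

Lemma dist_geE u v : dist_ge G u v d = (d <= dcap u v).
Proof.
by rewrite /dist_ge /dcap; case: dist => [l|]; rewrite ?leqnn // leq_min leqnn.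
Qed.

Lemma dcap_refl u : dcap u u = 0.
Proof. by apply/eqP; rewrite -leqn0; apply: (@dcap_walk u u [::]); rewrite /walk /= eqxx. Qed.

Lemma dcap_gt0 u v : 0 < d -> u != v -> 0 < dcap u v.
Proof.
move=> d0 uv; case: (ltnP (dcap u v) d) => [/dcap_attained[p]|]; last exact: leq_trans.
case: p => [|x p] /and3P[/= h1 h2 _] <-; first by rewrite (negPf uv) in h2.
by case/andP: h1 => h _; rewrite addn_gt0 weight_gt0.
Qed.

Lemma walk_cat u v w p q : walk u v p -> walk v w q -> walk u w (p ++ q).
Proof.
case/andP=> h1 /eqP h2 /andP[h3 /eqP h4].
by rewrite /walk cat_path last_cat h1 h2 h3 h4 eqxx.
Qed.

Lemma path_length_cat u p q :
  path_length G u (p ++ q) = path_length G u p + path_length G (last u p) q.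
Proof. by elim: p u => //= x p IH u; rewrite IH addnA. Qed.

Lemma dcap_tri u v w : dcap u w <= dcap u v + dcap v w.
Proof.
have := dcap_le u w.
case: (ltnP (dcap u v) d) => [/dcap_attained[p /is_path_walk wp <-]|h].
  case: (ltnP (dcap v w) d) => [/dcap_attained[q /is_path_walk wq <-] _|h].
    apply: leq_trans (dcap_walk (walk_cat wp wq)) _.
    by rewrite path_length_cat; case/andP: wp => _ /eqP->.
  by move=> h'; apply: leq_trans h' (leq_trans h (leq_addl _ _)).
by move=> h'; apply: leq_trans h' (leq_trans h (leq_addr _ _)).
Qed.

Lemma walk_rev u v p : walk u v p ->
  exists2 q, walk v u q & path_length G v q = path_length G u p.
Proof.
elim: p u => [|x p IH] u /=; rewrite /walk /=.
  by move/eqP=> <-; exists [::]; rewrite ?eqxx.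
move=> /andP[/andP[ux pp] lp]; have [|q wq hq] := IH x; first by rewrite /walk pp lp.
have wx : walk x u [:: u] by rewrite /walk /= adj_sym ux eqxx.
exists (q ++ [:: u]); first exact: (walk_cat wq wx).
rewrite path_length_cat hq /=; case/andP: wq => _ /eqP->.
by rewrite (weight_sym ux) addn0 addnC.
Qed.

Lemma dcap_sym u v : dcap u v = dcap v u.
Proof.
suff H x y : dcap x y <= dcap y x by apply/eqP; rewrite eqn_leq !H.
case: (ltnP (dcap y x) d) => [/dcap_attained[p /is_path_walk /walk_rev[q wq <-] <-]|h].
  exact: dcap_walk.
exact: leq_trans (dcap_le x y) h.
Qed.

Lemma dcap_weight u v : adj G u v -> dcap u v <= weight G u v.
Proof.
move=> h; have := @dcap_walk u v [:: v]; rewrite /walk /= h eqxx addn0; exact.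
Qed.

Definition closed_off (U B : {set 'I_n}) :=
  forall x y, x \in U -> x \notin B -> adj G x y -> y \in U.

(** Below the cap the distance is the length of a walk. The walk has to leave [U], and by
    [closed_off] it can do so only from a vertex of [B]; it is cut at the first such vertex. *)
Lemma dcap_sep (U B : {set 'I_n}) w v : closed_off U B -> w \in U -> v \notin U ->
  dcap w v < d -> exists2 b, b \in B & dcap w b + dcap b v <= dcap w v.
Proof.
move=> cU wU vU /dcap_attained[p /is_path_walk wp <-].
elim: p w wU wp => [|x p IH] w wU.
  by rewrite /walk /= => /eqP E; rewrite -E wU in vU.
move=> wp; case: (boolP (w \in B)) => wB.
  by exists w => //; rewrite dcap_refl add0n; exact: dcap_walk.
case/andP: wp => /= /andP[wx pp] lp.
have [|b bB hb] := IH x (cU _ _ wU wB wx); first by rewrite /walk pp lp.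
exists b => //; have := dcap_tri w x b; have := dcap_weight wx; lia.
Qed.

(** The Bellman-Ford recursion with all values capped at [d]: level [r] accounts for walks of at
    most [r.+1] edges. *)
Fixpoint bford r u v :=
  let d0 x y := if x == y then 0 else minn d (if adj G x y then weight G x y else d) in
  if r is r'.+1 then \big[minn/d]_(w < n) (d0 u w + bford r' w v) else d0 u v.

Lemma bford0_ge u v : dcap u v <= bford 0 u v.
Proof.
rewrite /=; case: eqP => [->|_]; first by rewrite dcap_refl.
by rewrite leq_min dcap_le; case: ifP => [/dcap_weight|_]; rewrite ?dcap_le.
Qed.

Lemma bford_ge r u v : dcap u v <= bford r u v.
Proof.
elim: r u v => [|r IH] u v; first exact: bford0_ge.
apply: bigminn_glb => [|w _ _]; first exact: dcap_le.
by apply: (leq_trans (dcap_tri u w v)); rewrite leq_add //; exact: bford0_ge.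
Qed.

Lemma bford_le_walk r u v p : size p <= r.+1 -> walk u v p ->
  bford r u v <= path_length G u p.
Proof.
have d0 x y : adj G x y -> bford 0 x y <= weight G x y.
  by rewrite /= => h; case: ifP => // _; rewrite h geq_minr.
elim: r u p => [|r IH] u [|x p] sp; rewrite /walk /=.
- by move=> ->.
- case: p sp => // _; rewrite /= andbT addn0 => /andP[ux /eqP <-]; exact: d0.
- move=> /eqP uv; apply: leq_trans (bigminn_le _ _ (mem_index_enum u) _) _ => //.
  by rewrite eqxx uv; apply: (IH v [::]); rewrite /walk /= ?eqxx.
move=> /andP[/andP[ux pp] lp].
apply: leq_trans (bigminn_le _ _ (mem_index_enum x) _) _ => //.
by rewrite leq_add ?d0 // IH // /walk pp lp.
Qed.

Lemma bford_le r u v : bford r u v <= d.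
Proof.
case: r => [|r] /=; last exact: bigminn_le_idx.
by case: ifP => // _; exact: geq_minl.
Qed.

(** A capped distance below [d] is attained by a simple path, which has fewer than [n] edges, so
    level [n] already sees it. *)
Lemma bfordE u v : bford n u v = dcap u v.
Proof.
apply/eqP; rewrite eqn_leq bford_ge andbT.
case: (ltnP (dcap u v) d) => [/dcap_attained[p ip <-]|]; last exact: leq_trans (bford_le _ _ _).
by apply: bford_le_walk (is_path_walk ip); apply: ltnW; apply: ltnW; rewrite ltnS; exact: is_path_size ip.
Qed.

Lemma scatteredE (K : {set 'I_n}) :
  scattered G d K = [forall u in K, forall v in K, (u != v) ==> (d <= dcap u v)].
Proof. by apply: eq_forallb => u; congr (_ ==> _); apply: eq_forallb => v; rewrite dist_geE. Qed.

End Dist.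

(** * Separation by the bags of a tree decomposition *)

Section Tree.
Variables (n : nat) (G : wgraph n).
Implicit Types (T : ntd n) (v : 'I_n) (a b : seq bool).

Fixpoint verts T : {set 'I_n} :=
  match T with
  | Leaf v => [set v]
  | Introduce v T1 => v |: verts T1
  | Forget _ T1 => verts T1
  | Join T1 T2 => verts T1 :|: verts T2
  end.

(** What the dynamic program uses of a tree decomposition, phrased without node addresses: the graph
    leaves a subtree only through its bag, an introduced vertex is new, and the two sides of a join
    share nothing but the bag. *)
Fixpoint separating T : Prop :=
  closed_off G (verts T) (bag T) /\
  match T with
  | Leaf _ => True
  | Introduce v T1 => v \notin verts T1 /\ separating T1
  | Forget _ T1 => separating T1
  | Join T1 T2 => [/\ bag T1 = bag T2, verts T1 :&: verts T2 \subset bag T1,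
                      separating T1 & separating T2]
  end.

Lemma bag_verts T : nice T -> bag T \subset verts T.
Proof.
elim: T => //= [v T1 IH /andP[_ /IH]|v T1 IH /andP[_ /IH h]|T1 IH1 T2 _ /and3P[_ /IH1 h _]].
- exact: setUS.
- exact: subset_trans (subsetDl _ _) h.
exact: subset_trans h (subsetUl _ _).
Qed.

Lemma subtree_nil T : subtree T [::] = Some T. Proof. by case: T. Qed.

Lemma subtree_cat T T' a b : subtree T a = Some T' -> subtree T (a ++ b) = subtree T' b.
Proof.
elim: a T => [|c a IH] T1; first by rewrite subtree_nil => -[<-].
by case: T1 => [v|v T1|v T1|T1 T2] //=; try case: c => //; move/IH.
Qed.

Lemma bag_at_cat T T' a b : subtree T a = Some T' -> bag_at T (a ++ b) = bag_at T' b.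
Proof. by move=> h; rewrite /bag_at (subtree_cat _ h). Qed.

Lemma bag_at_nil T : bag_at T [::] = bag T. Proof. by case: T. Qed.

Lemma bag_at_verts T a v : nice T -> v \in bag_at T a -> v \in verts T.
Proof.
elim: T a => [u|u T1 IH|u T1 IH|T1 IH1 T2 IH2] [|c a].
- by [].
- by rewrite /bag_at /= inE.
- by move=> h; rewrite bag_at_nil; apply/subsetP/bag_verts.
- move=> /andP[_ h]; case: c; rewrite /bag_at /= ?inE // => vb.
  by rewrite (IH a h vb) orbT.
- by move=> h; rewrite bag_at_nil; apply/subsetP/bag_verts.
- move=> /andP[_ h]; case: c; rewrite /bag_at /= ?inE // => vb.
  exact: (IH a h vb).
- by move=> h; rewrite bag_at_nil; apply/subsetP/bag_verts.
move=> /and3P[_ n1 n2]; rewrite /bag_at /= inE.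
by case: c => vb; [rewrite (IH2 a n2 vb) orbT | rewrite (IH1 a n1 vb)].
Qed.

Lemma verts_bag_at T v : v \in verts T -> exists a, v \in bag_at T a.
Proof.
elim: T => [u|u T1 IH|u T1 IH|T1 IH1 T2 IH2] /=.
- by exists [::].
- rewrite inE => /orP[h|/IH[a h]]; first by exists [::]; rewrite /bag_at /= inE h.
  by exists (false :: a).
- by move=> /IH[a h]; exists (false :: a).
rewrite inE => /orP[/IH1|/IH2] [a h]; first by exists (false :: a).
by exists (true :: a).
Qed.

Variable T : ntd n.
Hypothesis td : tree_decomposition G T.

(** By connectivity [v] is in every bag along some path of nodes from inside the subtree at [a] to
    [b] outside it. Such a path leaves the subtree from its root, so [v] is in the bag at [a]. *)
Lemma leave_subtree T' a b v : nice T' -> subtree T a = Some T' ->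
  v \in verts T' -> v \in bag_at T b -> ~~ prefix a b -> v \in bag T'.
Proof.
move=> nT sT /verts_bag_at[e ve] vb nab.
rewrite -bag_at_nil -(bag_at_cat _ sT) cats0.
have va : v \in bag_at T (a ++ e) by rewrite (bag_at_cat _ sT).
have [p /and3P[p1 /eqP p2 p3]] := td_connected td va vb.
have pa : prefix a (a ++ e) by exact: prefix_prefix.
elim: p (a ++ e) va pa p1 p2 p3 => [|y p IH] x vx ax /=.
  by move=> _ xb; rewrite -xb ax in nab.
move=> /andP[xy py] pl /andP[vy ap].
case: (boolP (prefix a y)) => ay; first exact: (IH y).
case/existsP: xy => c /orP[/eqP E|/eqP E].
  by move: ay; rewrite E -cats1; case/prefixP: ax => z ->; rewrite -catA prefix_prefix.
case/prefixP: ax => z; case/lastP: z => [|z c'] Ex.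
  by rewrite cats0 in Ex; rewrite -Ex.
move: Ex; rewrite E -rcons_cat => /rcons_inj[Ey _].
by rewrite Ey prefix_prefix in ay.
Qed.

(** The edge lies in some bag. Were that bag outside the subtree, [leave_subtree] would put [x] into
    the bag of [T']. *)
Lemma closed_off_subtree T' a : nice T' -> subtree T a = Some T' ->
  closed_off G (verts T') (bag T').
Proof.
move=> nT sT x y xv xb xy.
have [b /andP[xb' yb]] := td_edge td xy.
case: (boolP (prefix a b)) => ab; last by rewrite (leave_subtree nT sT xv xb' ab) in xb.
case/prefixP: ab yb => e ->; rewrite (bag_at_cat _ sT); exact: bag_at_verts.
Qed.

Lemma not_prefix_rcons a c : ~~ prefix (rcons a c) a.
Proof. by apply/negP => /size_prefix; rewrite size_rcons ltnn. Qed.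

Lemma separating_subtree T' a : nice T' -> subtree T a = Some T' -> separating T'.
Proof.
have sub1 T1 T2 c b : subtree T b = Some T1 -> subtree T1 [:: c] = Some T2 ->
    subtree T (rcons b c) = Some T2.
  by move=> h h2; rewrite -cats1 (subtree_cat _ h).
have bagE T1 b v : subtree T b = Some T1 -> (v \in bag_at T b) = (v \in bag T1).
  by move=> h; rewrite /bag_at h.
elim: T' a => [v|v T1 IH|v T1 IH|T1 IH1 T2 IH2] a nT sT; split;
  try exact: (closed_off_subtree nT sT) => //.
- by [].
- have s1 := sub1 _ T1 false _ sT (subtree_nil T1).
  case/andP: nT => vb n1; split; last exact: IH s1.
  (* The bag of the introduce node contains [v] and lies outside the subtree [T1], so an occurrence
     of [v] in [T1] would put [v] into the bag of [T1]. *)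
  apply: contra vb => vT; apply: (leave_subtree n1 s1 vT _ (not_prefix_rcons a false)).
  by rewrite (bagE _ _ _ sT) /= setU11.
- have s1 := sub1 _ T1 false _ sT (subtree_nil T1).
  by case/andP: nT => _ n1; exact: IH s1.
have s1 := sub1 _ T1 false _ sT (subtree_nil T1); have s2 := sub1 _ T2 true _ sT (subtree_nil T2).
case/and3P: nT => /eqP eb n1 n2; split=> //; last 2 first.
- exact: IH1 s1.
- exact: IH2 s2.
apply/subsetP => v; rewrite inE => /andP[v1 /verts_bag_at[e ve]].
apply: (leave_subtree (b := rcons a true ++ e) n1 s1 v1); first by rewrite (bag_at_cat _ s2).
apply/negP => /prefixP[z] /eqP.
by rewrite -!cats1 -!catA eqseq_cat // eqxx.
Qed.

Lemma verts_root v : nice T -> v \in verts T.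
Proof. by move=> nT; have [a] := td_vertex td v; exact: bag_at_verts. Qed.

End Tree.

(** * Profiles of partial solutions *)

Lemma eq_of_leq x y : (forall m, (m <= x) = (m <= y)) -> x = y.
Proof. by move=> h; apply/eqP; rewrite eqn_leq -h leqnn h leqnn. Qed.

Lemma bigminn_leP (T : finType) (P : pred T) (F : T -> nat) e m :
  (m <= \big[minn/e]_(i | P i) F i) = (m <= e) && [forall i, P i ==> (m <= F i)].
Proof.
apply/idP/idP => [h|/andP[h1 /forallP h2]].
  rewrite (leq_trans h (bigminn_le_idx _ _ _ _)); apply/forallP => i; apply/implyP => Pi.
  exact: leq_trans h (bigminn_le _ _ (mem_index_enum i) Pi).
by apply: bigminn_glb => // i _ Pi; have := h2 i; rewrite Pi.
Qed.

(** * Profiles as numbers: digits in a fixed base *)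

Section Radix.
Variable W : nat.
Hypothesis W0 : 0 < W.

Definition digit key b := key %/ W ^ b %% W.
Definition radix (f : nat -> nat) m := \sum_(i < m) f i * W ^ i.

Lemma radix_lt f m : (forall i, i < m -> f i < W) -> radix f m < W ^ m.
Proof.
elim: m => [|m IH] h; first by rewrite /radix big_ord0.
rewrite /radix big_ord_recr /= expnS -/(radix f m).
have h1 : radix f m < W ^ m by apply: IH => i im; apply: h; rewrite ltnW.
apply: (@leq_trans ((f m).+1 * W ^ m)); first by rewrite mulSn ltn_add2r.
by rewrite leq_mul2r h ?orbT.
Qed.

Lemma digit_radix f m b : (forall i, i < m -> f i < W) -> b < m ->
  digit (radix f m) b = f b.
Proof.
move=> h; elim: m h => // m IH h; rewrite ltnS leq_eqVlt => /orP[/eqP->|bm].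
  rewrite /digit /radix big_ord_recr /= addnC divnMDl ?expn_gt0 ?W0 //.
  rewrite divn_small ?addn0 ?modn_small ?h //.
  by apply: radix_lt => i im; apply: h; rewrite ltnW.
have hm i : i < m -> f i < W by move=> im; apply: h; rewrite ltnW.
have IH' := IH hm bm.
rewrite /digit /radix big_ord_recr /= -/(radix f m).
have -> : f m * W ^ m = (f m * W ^ (m - b.+1) * W) * W ^ b.
  by rewrite -!mulnA; congr (_ * _); rewrite -expnS -expnD; congr (_ ^ _); lia.
by rewrite addnC divnMDl ?expn_gt0 ?W0 // modnMDl.
Qed.

Variable n : nat.
Implicit Types q : {ffun 'I_n -> nat}.

Definition code q := \sum_b q b * W ^ b.

Definition extend q i := if insub i is Some b then q b else 0.

Lemma code_radix q : code q = radix (extend q) n.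
Proof. by apply: eq_bigr => i _; rewrite /extend valK. Qed.

Lemma extend_lt q : (forall b, q b < W) -> forall i, i < n -> extend q i < W.
Proof. by move=> h i im; rewrite /extend insubT. Qed.

Lemma digit_code q (b : 'I_n) : (forall b, q b < W) -> digit (code q) b = q b.
Proof.
move=> h; rewrite code_radix digit_radix //; first by rewrite /extend valK.
exact: extend_lt.
Qed.

Lemma code_lt q : (forall b, q b < W) -> code q < W ^ n.
Proof. by move=> h; rewrite code_radix; apply: radix_lt; exact: extend_lt. Qed.

Lemma code_inj q q' : (forall b, q b < W) -> (forall b, q' b < W) ->
  code q = code q' -> q = q'.
Proof. by move=> h h' E; apply/ffunP => b; rewrite -digit_code // E digit_code. Qed.

Definition setq q (b : 'I_n) x : {ffun 'I_n -> nat} := [ffun c => if c == b then x else q c].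

(** The form in which the program replaces a digit. Adding the new digit first keeps the truncated
    subtraction exact. *)
Lemma code_setq q b x : code (setq q b x) = code q + x * W ^ b - q b * W ^ b.
Proof.
rewrite /code (bigD1 b) //= [in RHS](bigD1 b) //= ffunE eqxx.
rewrite (eq_bigr (fun i => q i * W ^ i)); first by rewrite -addnA addKn addnC.
by move=> i /negPf h; rewrite ffunE h.
Qed.

Variable C : nat -> seq nat.
Hypothesis CW : forall i x, x \in C i -> x < W.
Hypothesis Cu : forall i, uniq (C i).

(** The keys whose digit [i] is drawn from [C i], in the order in which the nested loops of the
    program produce them. *)
Fixpoint radix_keys m : seq nat :=
  if m is m'.+1 then [seq k + x * W ^ m' | k <- radix_keys m', x <- C m'] else [:: 0].

Lemma size_keys m : size (radix_keys m) = \prod_(i < m) size (C i).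
Proof.
elim: m => [|m IH] /=; first by rewrite big_ord0.
by rewrite size_allpairs big_ord_recr IH.
Qed.

Lemma keysP m k : reflect (exists2 f : nat -> nat,
    forall i, i < m -> f i \in C i & k = radix f m) (k \in radix_keys m).
Proof.
elim: m k => [|m IH] k.
  rewrite inE; apply: (iffP eqP) => [->|[f _ ->]]; last by rewrite /radix big_ord0.
  by exists (fun=> 0) => //; rewrite /radix big_ord0.
apply: (iffP allpairsP) => [[[k' x] [/= /IH[f hf ->] hx ->]]|[f hf ->]].
  exists (fun i => if i == m then x else f i).
    by move=> i; rewrite ltnS leq_eqVlt; case: eqP => [->|_ /=]; [|exact: hf].
  rewrite /radix big_ord_recr /= eqxx; congr (_ + _).
  by apply: eq_bigr => i _; rewrite ltn_eqF.
exists (radix f m, f m); rewrite hf // /radix big_ord_recr; split=> //.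
by apply/IH; exists f => // i im; apply: hf; rewrite ltnW.
Qed.

Lemma keys_lt m k : k \in radix_keys m -> k < W ^ m.
Proof.
case/keysP => f hf ->; apply: radix_lt => i im; apply: CW; exact: (hf i im).
Qed.

Lemma keys_uniq m : uniq (radix_keys m).
Proof.
elim: m => //= m IH; apply: allpairs_uniq => // -[k1 x1] [k2 x2] /=.
case/allpairsP => -[? ?] [/= h1 _ [-> ->]]; case/allpairsP => -[? ?] [/= h2 _ [-> ->]].
move: (keys_lt h1) (keys_lt h2) => l1 l2 E.
have Wm : 0 < W ^ m by rewrite expn_gt0 W0.
have := congr1 (divn^~ (W ^ m)) E; have := congr1 (modn^~ (W ^ m)) E.
by rewrite ![_ + _ * W ^ m]addnC !modnMDl !modn_small // !divnMDl // !divn_small // !addn0 => -> ->.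
Qed.

Lemma code_keys q : (forall b : 'I_n, q b \in C b) -> code q \in radix_keys n.
Proof.
move=> h; rewrite code_radix; apply/keysP; exists (extend q) => // i im.
by rewrite /extend insubT; exact: h.
Qed.

Lemma keys_code k : k \in radix_keys n ->
  exists2 q : {ffun 'I_n -> nat}, forall b : 'I_n, q b \in C b & k = code q.
Proof.
case/keysP => f hf ->; exists [ffun b : 'I_n => f b].
  by move=> b; rewrite ffunE hf.
by rewrite /code; apply: eq_bigr => i _; rewrite ffunE.
Qed.

End Radix.

Section Profile.
Variables (n d : nat) (D : 'I_n -> 'I_n -> nat).
Hypothesis d2 : 1 < d.
Hypothesis D_refl : forall u, D u u = 0.
Hypothesis D_gt0 : forall u v, u != v -> 0 < D u v.
Hypothesis D_sym : forall u v, D u v = D v u.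
Hypothesis D_tri : forall u v w, D u w <= D u v + D v w.
Implicit Types (u v w b : 'I_n) (U B K : {set 'I_n}).

Definition scat K := [forall u in K, forall v in K, (u != v) ==> (d <= D u v)].

Lemma scatP K : reflect (forall u v, u \in K -> v \in K -> u != v -> d <= D u v) (scat K).
Proof.
apply: (iffP 'forall_in_'forall_in_implyP) => h u; [move=> v uK vK; exact: h|].
by move=> uK v vK; exact: h.
Qed.

(** The only trace of the graph in the treatment of profiles: short distances from [U] to the
    outside factor through [B]. For [dcap] this is [dcap_sep]. *)
Definition sep U B := forall w v, w \in U -> v \notin U -> D w v < d ->
  exists2 b, b \in B & D w b + D b v <= D w v.

(* A member of [K] gets the state [d]: the other states are at most [d - 1]. *)
Definition prof B K : {ffun 'I_n -> nat} :=
  [ffun b => if b \notin B then 0 else if b \in K then d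
             else \big[minn/d.-1]_(u in K :\: B) D u b].

Lemma profN B K b : b \notin B -> prof B K b = 0.
Proof. by move=> h; rewrite ffunE h. Qed.

Lemma profK B K b : b \in B -> b \in K -> prof B K b = d.
Proof. by move=> h h'; rewrite ffunE h h'. Qed.

Lemma prof_mid B K b : b \in B -> b \notin K -> 0 < prof B K b < d.
Proof.
move=> h h'; rewrite ffunE h (negPf h') /=; apply/andP; split; last first.
  by apply: leq_ltn_trans (bigminn_le_idx _ _ _ _) _; lia.
apply: bigminn_glb => [|u _]; first by lia.
by rewrite inE => /andP[uB uK]; apply: D_gt0; apply: contraNneq h' => <-.
Qed.

Lemma prof_le B K b : prof B K b <= d.
Proof.
case: (boolP (b \in B)) => h; last by rewrite profN.
by case: (boolP (b \in K)) => h'; [rewrite profK | case/andP: (prof_mid h h') => _ /ltnW].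
Qed.

Lemma prof_leD B K b u : b \in B -> b \notin K -> u \in K -> u \notin B ->
  prof B K b <= D u b.
Proof.
move=> h h' uK uB; rewrite ffunE h (negPf h') /=.
by apply: bigminn_le (mem_index_enum u) _; rewrite inE uB.
Qed.

Lemma prof_attained B K b : b \in B -> b \notin K -> prof B K b < d.-1 ->
  exists u, [/\ u \in K, u \notin B & prof B K b = D u b].
Proof.
move=> h h'; rewrite ffunE h (negPf h') /= => /bigminn_attained[u [_]].
by rewrite inE => /andP[uB uK] E; exists u.
Qed.

Lemma prof_flag B K b : (prof B K b == d) = (b \in B) && (b \in K).
Proof.
case: (boolP (b \in B)) => h /=; last by rewrite profN //; lia.
by case: (boolP (b \in K)) => h'; [rewrite profK ?eqxx | have := prof_mid h h'; lia].
Qed.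

Lemma prof_pos B K b : (0 < prof B K b) = (b \in B).
Proof.
case: (boolP (b \in B)) => h /=; last by rewrite profN.
by case: (boolP (b \in K)) => h'; [rewrite profK // ltnW | case/andP: (prof_mid h h')].
Qed.

(** Branch-free arithmetic. For [b] other than [v], the added [d] makes the minimum harmless unless
    [v] was selected. At [b = v] the bound is [D v v = 0], which clears the digit. A selected [b]
    keeps its digit [d], since two members are at distance at least [d]. *)
Definition forget_digit v (flag : bool) b z :=
  minn z (D b v + (1 - flag) * (1 - (b == v)) * d).

Lemma prof_forget B K v : scat K ->
  prof (B :\ v) K =
    [ffun b => forget_digit v (prof B K v == d) b (prof B K b)].
Proof.
move=> /scatP sK; apply/ffunP => b; rewrite [in RHS]ffunE /forget_digit.
case: (eqVneq b v) => [->|bv].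
  by rewrite D_refl subnn muln0 minn0 profN ?inE ?eqxx.
have -> : (1 - false) = 1 by []. rewrite muln1.
have -> : prof (B :\ v) K b = if b \notin B then 0 else if b \in K then d
     else \big[minn/d.-1]_(u in K :\: (B :\ v)) D u b by rewrite ffunE !inE bv.
have := prof_flag B K v; case: eqP => _ /= E; last first.
  rewrite subn0 mul1n (minn_idPl _); last by have := prof_le B K b; lia.
  rewrite [in RHS]ffunE; do 2!case: ifP => // _; apply: eq_bigl => u.
  rewrite !inE; case: (eqVneq u v) => [->|//]; move: E.
  by case: (v \in K); rewrite ?andbF // andbT => <-.
have [vB vK] := andP (esym E).
rewrite subnn mul0n addn0.
case: (boolP (b \in B)) => bB /=; last by rewrite profN // min0n.
case: (boolP (b \in K)) => bK.
  by rewrite profK // (minn_idPl _) // sK.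
apply: eq_of_leq => m; rewrite leq_min [prof B K b]ffunE bB (negPf bK) /= !bigminn_leP.
rewrite -andbA; congr (_ && _); apply/forallP/andP => [h|[/forallP h1 h2] u].
  split; last by have := h v; rewrite !inE eqxx vK [D b v]D_sym.
  apply/forallP => u; apply/implyP; rewrite inE => /andP[uB uK].
  by have := h u; rewrite !inE (negPf uB) andbF uK.
apply/implyP; rewrite !inE negb_and negbK => /andP[/orP[/eqP->|uB] uK].
  by rewrite D_sym.
by have := h1 u; rewrite inE uB uK.
Qed.

(** A vertex outside the bag has digit 0 and receives the summand [d], and a member has digit [d];
    neither lowers a minimum that starts at [d - 1]. The other terms are detours through [b] to the
    selected vertices outside the bag. *)
Definition intro_dist (q : {ffun 'I_n -> nat}) v :=
  \big[minn/d.-1]_b (q b + D b v + (1 - q b) * d).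

(** Reduction modulo [d] turns the digit [d] of a member into distance 0, so members and other bag
    vertices obey the same inequality. *)
Definition intro_flag (q : {ffun 'I_n -> nat}) v :=
  [forall b, (0 < q b) ==> (d <= q b %% d + D b v)].

Section Intro.
Variables (U B : {set 'I_n}) (v : 'I_n).
Hypotheses (BU : B \subset U) (vU : v \notin U) (sUB : sep U B).

Lemma intro_notin_bag : v \notin B.
Proof. by apply: contra vU; exact: (subsetP BU). Qed.

Lemma prof_intro_out K : K \subset U -> scat K ->
  prof (v |: B) K = setq (prof B K) v (intro_dist (prof B K) v).
Proof.
move=> KU /scatP sK.
have vK : v \notin K by apply: contra vU; exact: (subsetP KU).
have EK : K :\: (v |: B) = K :\: B.
  apply/setP => u; rewrite !inE; case: (eqVneq u v) => [->|//].
  by rewrite (negPf vK) !andbF.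
apply/ffunP => b; rewrite [in RHS]ffunE [in LHS]ffunE EK !inE.
case: (eqVneq b v) => [->|bv] /=; last by rewrite ffunE.
clear b; rewrite (negPf vK); apply: eq_of_leq => m; rewrite !bigminn_leP; case: leqP => //= md.
apply/forallP/forallP => h c.
  case: (boolP (c \in B)) => cB; last by rewrite profN //; lia.
  case: (boolP (c \in K)) => cK; first by rewrite profK //; lia.
  case: (ltnP (prof B K c) d.-1) => hc; last by lia.
  have [u [uK uB ->]] := prof_attained cB cK hc.
  have := h u; rewrite inE uB uK /= => hu.
  apply: (leq_trans hu); apply: leq_trans (D_tri u c v) _; exact: leq_addr.
apply/implyP; rewrite inE => /andP[cB cK].
case: (ltnP (D c v) d) => hc; last by lia.
have [b bB hb] := sUB (subsetP KU c cK) vU hc.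
(* Lying between [c] and [v], the vertex [b] is closer than [d] to the member [c], so it cannot be a
   member itself. *)
have bK : b \notin K.
  apply/negP => bK; suff: d <= D c b by lia.
  by apply: sK => //; apply: contraNneq cB => ->.
have := h b; have := prof_mid bB bK; have := prof_leD bB bK cK cB; lia.
Qed.

Lemma prof_intro_in K : K \subset U ->
  prof (v |: B) (v |: K) = setq (prof B K) v d.
Proof.
move=> KU; have vK : v \notin K by apply: contra vU; exact: (subsetP KU).
have EK : (v |: K) :\: (v |: B) = K :\: B.
  apply/setP => u; rewrite !inE; case: (eqVneq u v) => [->|//].
  by rewrite (negPf vK) !andbF.
apply/ffunP => b; rewrite [in RHS]ffunE [in LHS]ffunE EK !inE.
by case: eqVneq => [->|bv] //=; rewrite ffunE.
Qed.

Lemma scat_intro K : K \subset U -> scat K ->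
  scat (v |: K) = intro_flag (prof B K) v.
Proof.
move=> KU sK'; have /scatP sK := sK'.
have vK : v \notin K by apply: contra vU; exact: (subsetP KU).
apply/idP/forallP => [/scatP h b|h].
  apply/implyP; rewrite prof_pos => bB.
  have bv : b != v by apply: contraNneq vU => <-; exact: (subsetP BU).
  case: (boolP (b \in K)) => bK.
    by rewrite profK // modnn; apply: h; rewrite ?inE ?eqxx ?bK ?orbT.
  have /andP[p0 pd] := prof_mid bB bK.
  (* The state [d - 1] may be a capped value. It loses nothing: with the positive distance [D b v]
     the sum reaches [d] in any case. *)
  rewrite modn_small //; case: (ltnP (prof B K b) d.-1) => hb; last by have := D_gt0 bv; lia.
  have [u [uK uB ->]] := prof_attained bB bK hb.
  apply: leq_trans (D_tri u b v); apply: h; rewrite ?inE ?eqxx ?uK ?orbT //.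
  by apply: contraNneq vK => <-.
have H u : u \in K -> d <= D u v.
  move=> uK; case: (boolP (u \in B)) => uB.
    by have := h u; rewrite prof_pos uB profK // modnn.
  rewrite leqNgt; apply/negP => hu.
  have [b bB hb] := sUB (subsetP KU u uK) vU hu.
  have bK : b \notin K.
    apply/negP => bK; suff: d <= D u b by lia.
    by apply: sK => //; apply: contraNneq uB => ->.
  have /andP[p0 pd] := prof_mid bB bK.
  have := h b; rewrite prof_pos bB modn_small //=; have := prof_leD bB bK uK uB; lia.
apply/scatP => x y; rewrite !inE => /orP[/eqP->|xK] /orP[/eqP->|yK]; rewrite ?eqxx //.
- by rewrite D_sym => _; exact: H.
- by move=> _; exact: H.
exact: sK.
Qed.

End Intro.

(** * Compatibility of states at a join *)

Definition low z := (0 < z) && (2 * z < d).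
(** The states above [z] that are compatible with [z] are those from the threshold up to [d - 1].
    This interval is empty for [z = 0] and for [z = d], so a vertex outside the bag and a member
    glue only with their like, without a case of their own. *)
Definition threshold z := maxn z.+1 (d - z).
Definition high z x := threshold z <= x < d.
Definition glue z x y :=
  [|| [&& x == z, y == z & ~~ low z], (x == z) && high z y | (y == z) && high z x].

Lemma glueE z x y : x <= d -> y <= d ->
  glue z x y = (z == minn x y) &&
    [|| (x == 0) && (y == 0), (x == d) && (y == d) | [&& 0 < x, 0 < y, x < d, y < d & d <= x + y]].
Proof.
move=> xd yd; rewrite /glue /low /high /threshold geq_max geq_max.
apply/idP/idP; lia.
Qed.

Lemma glue_min z x y : x <= d -> y <= d -> glue z x y -> z = minn x y.
Proof. by move=> xd yd; rewrite glueE // => /andP[/eqP]. Qed.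

Lemma glue_mid z x y : 0 < x < d -> 0 < y < d -> glue z x y -> d <= x + y.
Proof.
move=> /andP[x0 xd] /andP[y0 yd]; rewrite glueE ?(ltnW xd) ?(ltnW yd) // => /andP[_].
by move: x0 xd y0 yd; clear; lia.
Qed.

Lemma glue_flag z x y : x <= d -> y <= d -> glue z x y -> (x == d) = (y == d).
Proof.
move=> xd yd; rewrite glueE // => /andP[_ /or3P[/andP[/eqP-> /eqP->]||]] //.
  by move=> /andP[-> ->].
by move=> /and5P[_ _ h1 h2 _]; rewrite !ltn_eqF.
Qed.

Section Joining.
Variables (U1 U2 B : {set 'I_n}).
Hypotheses (BU : U1 :&: U2 = B) (s1 : sep U1 B).

(** The states decide membership in [B]. Two members on different sides that are too close have a
    bag vertex [b] between them. It is not selected, being too close to a member of a scattered set,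
    so its two states add up to less than [d], which [glue] forbids. *)
Lemma prof_join K1 K2 : K1 \subset U1 -> K2 \subset U2 -> scat K1 -> scat K2 ->
  forall q : {ffun 'I_n -> nat}, [forall b, glue (q b) (prof B K1 b) (prof B K2 b)] =
    [&& K1 :&: B == K2 :&: B, scat (K1 :|: K2) & q == prof B (K1 :|: K2)].
Proof.
move=> K1U K2U sK1 sK2 q; have /scatP h1 := sK1; have /scatP h2 := sK2.
have B1 b : b \in B -> b \in U1 by rewrite -BU inE => /andP[].
have B2 b : b \in B -> b \in U2 by rewrite -BU inE => /andP[].
have UB b : b \in U1 -> b \in U2 -> b \in B by rewrite -BU inE => -> ->.
have PM : K1 :&: B = K2 :&: B -> prof B (K1 :|: K2) = [ffun b => minn (prof B K1 b) (prof B K2 b)].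
  move=> E; apply/ffunP => b; rewrite [in RHS]ffunE.
  case: (boolP (b \in B)) => bB; last by rewrite !profN.
  have Eb : (b \in K1) = (b \in K2) by have := congr1 (fun A : {set _} => b \in A) E; rewrite !inE bB !andbT.
  case: (boolP (b \in K1)) => bK1; have bK2 := bK1; rewrite Eb in bK2.
    by rewrite !profK ?minnn // inE bK1.
  apply: eq_of_leq => m; rewrite leq_min !ffunE bB !inE (negPf bK1) (negPf bK2) /= !bigminn_leP.
  rewrite andbACA andbb; congr (_ && _); apply/forallP/andP.
    by move=> h; split; apply/forallP => u; apply/implyP; rewrite inE => /andP[uB uK];
      have := h u; rewrite !inE uB uK ?orbT.
  move=> [/forallP f1 /forallP f2] u; apply/implyP; rewrite !inE => /andP[uB /orP[uK|uK]].
    by have := f1 u; rewrite inE uB uK.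
  by have := f2 u; rewrite inE uB uK.
apply/forallP/and3P => [h|[/eqP E sK /eqP Eq] b].
  have E : K1 :&: B = K2 :&: B.
    apply/setP => b; rewrite !inE; case: (boolP (b \in B)) => bB; rewrite ?andbF // !andbT.
    have := glue_flag (prof_le B K1 b) (prof_le B K2 b) (h b).
    by rewrite !prof_flag bB.
  split; first by apply/eqP.
    have X u w : u \in K1 -> w \in K2 -> u != w -> d <= D u w.
      move=> uK wK uw; case: (boolP (w \in U1)) => wU.
        apply: h1 => //; have wB : w \in B by apply: UB => //; exact: (subsetP K2U).
        by have := congr1 (fun A : {set _} => w \in A) E; rewrite !inE wB wK !andbT.
      case: (boolP (u \in U2)) => uU.
        apply: h2 => //; have uB : u \in B by apply: UB => //; exact: (subsetP K1U).
        by have := congr1 (fun A : {set _} => u \in A) E; rewrite !inE uB uK !andbT => <-.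
      rewrite leqNgt; apply/negP => lt.
      have [b bB hb] := s1 (subsetP K1U u uK) wU lt.
      have uB : u \notin B by apply: contra uU; exact: B2.
      have wB : w \notin B by apply: contra wU; exact: B1.
      have ub : u != b by apply: contraNneq uB => ->.
      have wb : w != b by apply: contraNneq wB => ->.
      case: (boolP (b \in K1)) => bK1.
        by have := leq_trans (h1 _ _ uK bK1 ub) (leq_trans (leq_addr _ _) hb); rewrite leqNgt lt.
      case: (boolP (b \in K2)) => bK2.
        have := h2 _ _ wK bK2 wb; rewrite [D w b]D_sym => h'.
        by have := leq_trans h' (leq_trans (leq_addl _ _) hb); rewrite leqNgt lt.
      have := glue_mid (prof_mid bB bK1) (prof_mid bB bK2) (h b); apply/negP.
      rewrite -ltnNge; apply: leq_ltn_trans lt; apply: leq_trans hb.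
      by rewrite leq_add ?[D b w]D_sym ?prof_leD.
    apply/scatP => u w; rewrite !inE => /orP[uK|uK] /orP[wK|wK] uw.
    - exact: h1.
    - exact: X.
    - by rewrite D_sym; apply: X => //; rewrite eq_sym.
    - exact: h2.
  apply/eqP; rewrite PM //; apply/ffunP => b; rewrite ffunE.
  exact: glue_min (prof_le _ _ _) (prof_le _ _ _) (h b).
rewrite glueE ?prof_le // Eq PM // ffunE eqxx /=.
case: (boolP (b \in B)) => bB; last by rewrite !profN.
have Eb : (b \in K1) = (b \in K2) by have := congr1 (fun A : {set _} => b \in A) E; rewrite !inE bB !andbT.
case: (boolP (b \in K1)) => bK1; have bK2 := bK1; rewrite Eb in bK2.
  by rewrite !profK // eqxx orbT.
have /andP[p0 pd] := prof_mid bB bK1; have /andP[p0' pd'] := prof_mid bB bK2.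
suff h : d <= prof B K1 b + prof B K2 b by rewrite p0 p0' pd pd' h !orbT.
(* A state equal to the cap [d - 1] reaches [d] together with any positive state; below the cap,
   both states are distances to actual members. *)
case: (ltnP (prof B K1 b) d.-1) => l1; last by clear -p0' l1 d2; lia.
case: (ltnP (prof B K2 b) d.-1) => l2; last by clear -p0 l2 d2; lia.
have [u [uK uB ->]] := prof_attained bB bK1 l1.
have [w [wK wB ->]] := prof_attained bB bK2 l2.
apply: leq_trans (_ : D u w <= _); last by rewrite [D w b]D_sym; exact: D_tri.
have /scatP h := sK; apply: h; rewrite ?inE ?uK ?wK ?orbT //.
by apply: contraNneq uB => E'; apply: UB; [exact: (subsetP K1U) | rewrite E'; exact: (subsetP K2U)].
Qed.

End Joining.
End Profile.

Lemma sum_subset_setU1 (T : finType) (U : {set T}) v (F : {set T} -> nat) : v \notin U ->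
  \sum_(K : {set T} | K \subset v |: U) F K = \sum_(K : {set T} | K \subset U) (F K + F (v |: K)).
Proof.
move=> vU; rewrite (bigID (fun K : {set T} => v \in K)) /= addnC big_split /=; congr (_ + _).
  apply: eq_bigl => K; apply/andP/idP => [[/subsetP h vK]|h].
    apply/subsetP => x xK; have := h x xK; rewrite !inE => /orP[/eqP E|//].
    by rewrite -E xK in vK.
  split; first exact: subset_trans h (subsetUr _ _).
  by apply: contra vU; exact: (subsetP h).
rewrite (reindex_onto (fun K => v |: K) (fun K => K :\ v)) /=; last first.
  by move=> K /andP[_ vK]; rewrite setD1K.
apply: eq_bigl => K; rewrite setU11 andbT; apply/andP/idP => [[h /eqP <-]|h].
  by rewrite subDset.
have vK : v \notin K by apply: contra vU; exact: (subsetP h).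
by rewrite setUS // setU1K.
Qed.

(** A subset of the union is determined by its traces on [U1] and [U2], and two subsets are such
    traces exactly when they agree on [B]. *)
Lemma sum_subset_setU (T : finType) (U1 U2 B : {set T}) (F : {set T} -> nat) : U1 :&: U2 = B ->
  \sum_(K : {set T} | K \subset U1 :|: U2) F K =
  \sum_(K1 : {set T} | K1 \subset U1) \sum_(K2 : {set T} | K2 \subset U2)
    (K1 :&: B == K2 :&: B) * F (K1 :|: K2).
Proof.
move=> UB.
transitivity (\sum_(K1 : {set T} | K1 \subset U1)
  \sum_(K2 : {set T} | (K2 \subset U2) && (K1 :&: B == K2 :&: B)) F (K1 :|: K2)); last first.
  apply: eq_bigr => K1 _; rewrite big_mkcondr /=; apply: eq_bigr => K2 _.
  by case: eqP; rewrite ?mul1n ?mul0n.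
rewrite pair_big_dep /=.
rewrite (reindex_onto (fun K : {set T} => (K :&: U1, K :&: U2)) (fun k => k.1 :|: k.2)) /=.
  apply: eq_big => [K|K h]; last by rewrite -setIUr (setIidPl h).
  rewrite !subsetIr /= -setIUr; apply/idP/andP => [h|[_ /eqP <-]]; last exact: subsetIr.
  rewrite (setIidPl h) eqxx; split=> //; apply/eqP/setP => x; rewrite -UB !inE.
  by case: (x \in U1); case: (x \in U2); rewrite ?andbF.
move=> [K1 K2] /= /and3P[K1U K2U /eqP E].
have h1 : K2 :&: U1 \subset K1.
  rewrite -(setIidPl K2U) -setIA [U2 :&: U1]setIC UB -E; exact: subsetIl.
have h2 : K1 :&: U2 \subset K2.
  rewrite -(setIidPl K1U) -setIA UB E; exact: subsetIl.
by rewrite !setIUl (setIidPl K1U) (setIidPl K2U) (setUidPl h1) (setUidPr h2).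
Qed.

(** * Diagonalization of the deformed join product *)

Section Transform.
Variables (n d t : nat).
Hypotheses (d2 : 1 < d) (t0 : 0 < t).
Notation W := d.+1.
Variables (cand C : nat -> seq nat).
Hypothesis candu : forall i, uniq (cand i).
Hypothesis candd : forall i x, x \in cand i -> 0 < x <= d.
Hypothesis Ccand : forall i, C i = cand i \/ C i = [:: 0].

Lemma C_lt i x : x \in C i -> x < W.
Proof. by case: (Ccand i) => ->; [case/candd/andP | rewrite inE => /eqP->]. Qed.

Lemma C_uniq i : uniq (C i).
Proof. by case: (Ccand i) => ->. Qed.

Lemma high_cand i z x : z \in C i -> high d z x -> C i = cand i.
Proof.
case: (Ccand i) => -> //; rewrite inE => /eqP ->; rewrite /high /threshold; lia.
Qed.

Definition collision_weight z := if low d z then t else 1.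
Definition chi z x := collision_weight z * (x == z) + high d z x.
(** The value [d] signals that no candidate below [d] reaches the threshold. *)
Definition nxt i z := \big[minn/d]_(x <- cand i | threshold d z <= x) x.
(** Structure constants of the deformed product: [glue], plus [t] where a low state collides with
    itself. *)
Definition phi z x y :=
  collision_weight z * ((x == z) && (y == z)) + (x == z) * high d z y + (y == z) * high d z x.

Lemma cz_gt0 z : 0 < collision_weight z. Proof. by rewrite /collision_weight; case: ifP. Qed.

Lemma sum_high i z x : z \in C i -> x \in C i ->
  \sum_(y <- cand i) high d z y * (x == y) = high d z x.
Proof.
move=> zC xC; case hx : (high d z x).
  rewrite (high_cand zC hx) in xC; rewrite (bigD1_seq x) //= hx eqxx.
  by rewrite big1 // => y /negPf; rewrite eq_sym => ->; rewrite muln0.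
by rewrite big1_seq // => y _; case: eqP => [<-|]; rewrite ?muln0 // hx.
Qed.

Lemma nxt_C i z : z \in C i -> nxt i z < d -> nxt i z \in C i.
Proof.
move=> zC /[dup] h /bigminn_attained[x [xc tx E]].
have hx : high d z x by rewrite /high tx E.
by rewrite (high_cand zC hx) /nxt -E.
Qed.

Lemma thr_high z y : threshold d z <= y -> threshold d y = y.+1 /\ low d y = false.
Proof. rewrite /threshold /low; lia. Qed.

(** The least candidate [y] above the threshold of [z] is not low, and its own threshold is [y.+1].
    Hence [chi y] is the indicator of the interval from [y] to [d - 1], which on candidates
    coincides with [high d z]. *)
Lemma chi_nxt i z x : z \in C i -> x \in C i ->
  (nxt i z < d) * chi (nxt i z) x = high d z x.
Proof.
move=> zC xC; case: ltnP => h; rewrite ?mul0n ?mul1n; last first.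
  apply/esym/eqP; rewrite eqb0; apply/negP => hx.
  rewrite (high_cand zC hx) in xC; case/andP: hx => h1 h2.
  have := @bigminn_le _ (cand i) (fun x => threshold d z <= x) id d x xC h1.
  by rewrite leqNgt (leq_trans h2).
have [y [yc ty Ey]] := bigminn_attained h; rewrite -/(nxt i z) /= in Ey.
have [t1 l1] := thr_high ty.
rewrite /chi /collision_weight -Ey l1 mul1n /high t1.
have hC : C i = cand i by apply: (high_cand (x := y) zC); rewrite /high ty Ey.
rewrite hC in xC.
have H : threshold d z <= x -> y <= x.
  by rewrite Ey => tx; exact: (@bigminn_le _ (cand i) (fun x => threshold d z <= x) id d x xC tx).
move: H ty h; rewrite -Ey; clear; case: (ltngtP x y) => h1 H h2 h3.
- rewrite /=; case: (leqP (threshold d z) x) => // h; have := H h; lia.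
- by rewrite (ltnW (leq_ltn_trans h2 h1)).
- by rewrite h1 h2 h3.
Qed.

(** Expanding the left side gives [collision_weight z * phi z x y] and a product of two [high]
    indicators; by [chi_nxt] the latter is the left side again, at the state [nxt i z]. So the
    products of characters determine [phi] by one subtraction and one division. *)
Lemma chi_phi i z x y : z \in C i -> x \in C i -> y \in C i ->
  chi z x * chi z y = collision_weight z * phi z x y +
    (nxt i z < d) * (chi (nxt i z) x * chi (nxt i z) y).
Proof.
move=> zC xC yC.
have -> : (nxt i z < d) * (chi (nxt i z) x * chi (nxt i z) y) = high d z x * high d z y.
  by rewrite -(chi_nxt zC xC) -(chi_nxt zC yC); case: (_ < _); rewrite ?mul1n ?mul0n.
rewrite /chi /phi; case: eqP => _; case: eqP => _; rewrite /= ?muln1 ?muln0 ?mul1n ?mul0n ?addn0 ?add0n //.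
- rewrite !mulnDl !mulnDr; case: (high d z x); case: (high d z y); rewrite /= ?muln1 ?muln0; lia.
- by rewrite mulnDl.
- by rewrite mulnDr [_ * collision_weight z]mulnC.
Qed.

(** One digit per level, as in a fast Fourier transform: a key costs a sum over the candidates of
    each vertex instead of a sum over all keys. *)
Fixpoint fwd (a : nat -> nat) m key :=
  if m is m'.+1 then
    let z := digit W key m' in
    collision_weight z * fwd a m' key +
    \sum_(x <- cand m') high d z x * fwd a m' (key + x * W ^ m' - z * W ^ m')
  else a key.

(** Solves [chi_phi] for [phi] digit by digit. On pointwise products of transformed tables, both the
    truncated subtraction and the division are exact. *)
Fixpoint bwd (a : nat -> nat) m key :=
  if m is m'.+1 then
    let z := digit W key m' in
    (bwd a m' key -
      (nxt m' z < d) * bwd a m' (key + nxt m' z * W ^ m' - z * W ^ m')) %/ collision_weight z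
  else a key.

Lemma key_step m key x : m < n -> key \in radix_keys W C n -> x \in C m ->
  key + x * W ^ m - digit W key m * W ^ m \in radix_keys W C n.
Proof.
move=> mn /keys_code[q hq ->] xC.
have qW b : q b < W by exact: C_lt (hq b).
rewrite (@digit_code W (ltn0Sn d) n q (Ordinal mn)) // -(@code_setq W n q (Ordinal mn)).
apply: code_keys => // b; rewrite ffunE; case: eqP => [->|_] //.
Qed.

Section Families.
Variables (J : finType) (w : J -> nat) (p : J -> {ffun 'I_n -> nat}).
Hypothesis pC : forall j b, p j b \in C b.

Lemma fwdE m (q : {ffun 'I_n -> nat}) : m <= n -> (forall b : 'I_n, q b \in C b) ->
  fwd (fun key => \sum_j w j * (key == code W (p j))) m (code W q) =
  \sum_j w j * \prod_(b < n) (if b < m then chi (q b) (p j b) else p j b == q b).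
Proof.
elim: m q => [|m IH] q mn hq /=.
  apply: eq_bigr => j _; congr (_ * _).
  transitivity ((p j == q) : nat).
    congr nat_of_bool; apply/eqP/eqP => [E|->//]; apply/esym.
    by apply: code_inj E => // b; exact: (C_lt (i := b)).
  case: (eqVneq (p j) q) => [->|ne].
    by rewrite big1 // => b _; rewrite eqxx.
  have [b hb] : exists b, p j b != q b.
    apply/existsP; apply: contraNT ne; rewrite negb_exists => /forallP h.
    by apply/eqP/ffunP => b; apply/eqP; have := h b; rewrite negbK.
  by rewrite (bigD1 b) //= (negPf hb).
set b := Ordinal mn; have qW c : q c < W by exact: C_lt (hq c).
pose R j := \prod_(c < n | c != b) (if c < m then chi (q c) (p j c) else p j c == q c).
have S x : x \in C m ->
    fwd (fun key => \sum_j w j * (key == code W (p j))) m (code W (setq q b x)) =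
    \sum_j w j * ((p j b == x) * R j).
  move=> xC; rewrite IH 1?ltnW // => [|c]; last by rewrite ffunE; case: eqP => [->|_].
  apply: eq_bigr => j _; rewrite (bigD1 b) //= ltnn ffunE eqxx; congr (_ * (_ * _)).
  by apply: eq_bigr => c /negPf nc; rewrite ffunE nc.
have dq : digit W (code W q) m = q b by exact: (@digit_code W (ltn0Sn d) n q b).
have Eq : setq q b (q b) = q by apply/ffunP => c; rewrite ffunE; case: eqP => [->|].
have S0 := S _ (hq b); rewrite Eq in S0; rewrite dq S0.
rewrite (eq_big_seq (fun x => \sum_j w j * (high d (q b) x * (p j b == x) * R j))); last first.
  move=> x xc /=; case hx : (high d (q b) x); last first.
    by rewrite mul0n big1 // => j _; rewrite mul0n muln0.
  rewrite mul1n -(@code_setq W n q b) S; last by rewrite (high_cand (hq b) hx).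
  by apply: eq_bigr => j _; rewrite mul1n.
rewrite exchange_big /= big_distrr -big_split /=; apply: eq_bigr => j _.
rewrite -big_distrr -big_distrl /= sum_high ?hq ?pC // (bigD1 b) //= ltnSn.
have -> : \prod_(i < n | i != b) (if i < m.+1 then chi (q i) (p j i) else p j i == q i) = R j.
  apply: eq_bigr => c nc; rewrite ltnS [c <= m]leq_eqVlt.
  by have -> : (c == m :> nat) = false by apply: contraNF nc.
by rewrite mulnCA -mulnDr mulnA -mulnDl.
Qed.

End Families.

Section Pairs.
Variables (J : finType) (w : J -> nat) (p1 p2 : J -> {ffun 'I_n -> nat}).
Hypothesis p1C : forall j b, p1 j b \in C b.
Hypothesis p2C : forall j b, p2 j b \in C b.

Lemma bwdE a m (q : {ffun 'I_n -> nat}) : m <= n ->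
  (forall q : {ffun 'I_n -> nat}, (forall b : 'I_n, q b \in C b) ->
    a (code W q) = \sum_j w j * \prod_(b < n) (chi (q b) (p1 j b) * chi (q b) (p2 j b))) ->
  (forall b : 'I_n, q b \in C b) ->
  bwd a m (code W q) =
  \sum_j w j * \prod_(b < n) (if b < m then phi (q b) (p1 j b) (p2 j b)
                              else chi (q b) (p1 j b) * chi (q b) (p2 j b)).
Proof.
move=> + aE; elim: m q => [|m IH] q mn hq; first exact: aE.
set b := Ordinal mn; have qW c : q c < W by exact: C_lt (hq c).
pose R j := \prod_(c < n | c != b) (if c < m then phi (q c) (p1 j c) (p2 j c)
                              else chi (q c) (p1 j c) * chi (q c) (p2 j c)).
have S x : x \in C m -> bwd a m (code W (setq q b x)) =
    \sum_j w j * ((chi x (p1 j b) * chi x (p2 j b)) * R j).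
  move=> xC; rewrite IH 1?ltnW // => [|c]; last by rewrite ffunE; case: eqP => [->|_].
  apply: eq_bigr => j _; rewrite (bigD1 b) //= ltnn ffunE eqxx; congr (_ * (_ * _)).
  by apply: eq_bigr => c /negPf nc; rewrite ffunE nc.
have dq : digit W (code W q) m = q b by exact: (@digit_code W (ltn0Sn d) n q b).
have Eq : setq q b (q b) = q by apply/ffunP => c; rewrite ffunE; case: eqP => [->|].
have S0 := S _ (hq b); rewrite Eq in S0; rewrite /= dq S0.
set s := nxt m (q b).
have -> : (s < d) * bwd a m (code W q + s * W ^ m - q b * W ^ m) =
    \sum_j w j * ((s < d) * (chi s (p1 j b) * chi s (p2 j b)) * R j).
  rewrite -(@code_setq W n q b); case hs : (s < d); last first.
    by rewrite mul0n big1 // => j _; rewrite mul0n muln0.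
  by rewrite mul1n S ?nxt_C ?hq //; apply: eq_bigr => j _; rewrite mul1n.
rewrite (eq_bigr (fun j => collision_weight (q b) * (w j * (phi (q b) (p1 j b) (p2 j b) * R j)) +
  w j * ((s < d) * (chi s (p1 j b) * chi s (p2 j b)) * R j))); last first.
  move=> j _; rewrite (chi_phi (hq b) (p1C j b) (p2C j b)) -/s.
  by rewrite mulnDl mulnDr -!mulnA; congr (_ + _); rewrite mulnCA.
(* By [chi_phi] the minuend is the subtrahend plus a multiple of the collision weight, so neither
   operation loses anything. *)
rewrite big_split /= addnK -big_distrr mulKn ?cz_gt0 //; apply: eq_bigr => j _.
rewrite [in RHS](bigD1 b) //= ltnSn; congr (_ * (_ * _)).
apply: eq_bigr => c nc; rewrite ltnS [c <= m]leq_eqVlt.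
by have -> : (c == m :> nat) = false by apply: contraNF nc.
Qed.

(** Modulo [t] the constants [phi] reduce to [glue], and the right side is at most the total weight,
    which is below [t]. *)
Lemma bwd_mod a (q : {ffun 'I_n -> nat}) :
  (forall q : {ffun 'I_n -> nat}, (forall b : 'I_n, q b \in C b) ->
    a (code W q) = \sum_j w j * \prod_(b < n) (chi (q b) (p1 j b) * chi (q b) (p2 j b))) ->
  (forall b : 'I_n, q b \in C b) -> \sum_j w j < t ->
  bwd a n (code W q) %% t =
  \sum_j w j * [forall b, glue d (q b) (p1 j b) (p2 j b)].
Proof.
move=> aE hq wt; rewrite (bwdE (leqnn n) aE hq).
have phiE z x y : phi z x y = glue d z x y + t * [&& low d z, x == z & y == z].
  have hz : high d z z = false by rewrite /high /threshold; lia.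
  rewrite /phi /glue /collision_weight; case: (low d z);
    case: (x =P z) => [->|_]; case: (y =P z) => [->|_];
    rewrite ?hz /= ?muln0 ?muln1 ?mul1n ?mul0n ?addn0 ?add0n ?orbF //.
rewrite -[RHS](@modn_small _ t); last first.
  apply: leq_ltn_trans wt; apply: leq_sum => j _.
  by case: [forall _, _]; rewrite ?muln1 // muln0.
rewrite -modn_summ -[in RHS]modn_summ; congr (_ %% t); apply: eq_bigr => j _.
rewrite -modnMmr -[in RHS]modnMmr; congr ((_ * _) %% t).
have -> : [forall b, glue d (q b) (p1 j b) (p2 j b)] =
    \prod_(b < n) glue d (q b) (p1 j b) (p2 j b) :> nat.
  case: (boolP [forall _, _]) => [/forallP h|].
    by rewrite big1 // => b _; rewrite h.
  by rewrite negb_forall => /existsP[b hb]; rewrite (bigD1 b) //= (negPf hb).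
apply: (big_ind2 (fun x y => x %% t = y %% t)) => //.
  by move=> x1 x2 y1 y2 h1 h2; rewrite -modnMm h1 h2 modnMm.
by move=> b _; rewrite ltn_ord phiE addnC mulnC modnMDl.
Qed.

End Pairs.
End Transform.

(** * Table entries and their recurrences *)

Section Tables.
Variables (n d : nat) (D : 'I_n -> 'I_n -> nat).
Hypothesis d2 : 1 < d.
Hypothesis D_refl : forall u, D u u = 0.
Hypothesis D_gt0 : forall u v, u != v -> 0 < D u v.
Hypothesis D_sym : forall u v, D u v = D v u.
Hypothesis D_tri : forall u v w, D u w <= D u v + D v w.
Implicit Types (u v w b : 'I_n) (U B K : {set 'I_n}).
Notation W := d.+1.
Notation X := (2 ^ n.+1).
Notation t := (X ^ (2 * n.+1)).
Notation prof := (prof d D).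
Notation scat := (scat d D).
Notation code := (code W).
Notation digit := (digit W).

(** The choice [u = b] yields [d - 1], the state of a vertex far from all forgotten members. Thus
    the [n] choices of [u], together with the state [d] of a member, cover all states of a bag
    vertex. *)
Definition xval b u := minn d.-1 (D b u + (b == u) * d).
Definition add_new (x : nat) s := if x \in s then s else rcons s x.
Definition cands b (us : seq 'I_n) := foldl (fun s u => add_new (xval b u) s) [:: d] us.

Lemma cands_rcons b us u : cands b (rcons us u) = add_new (xval b u) (cands b us).
Proof. by rewrite /cands -cats1 foldl_cat. Qed.

Lemma mem_cands b us x : (x \in cands b us) = (x == d) || (x \in map (xval b) us).
Proof.
elim/last_ind: us x => [|us u IH] x; first by rewrite /cands /= !inE orbF.
rewrite cands_rcons map_rcons mem_rcons inE /add_new; case: ifP => h.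
  rewrite IH; case: (eqVneq x (xval b u)) => [->|//].
  by rewrite -IH h orbT.
by rewrite mem_rcons inE IH orbCA.
Qed.

Lemma cands_uniq b us : uniq (cands b us).
Proof.
elim/last_ind: us => [|us u IH] //.
by rewrite cands_rcons /add_new; case: ifP => // h; rewrite rcons_uniq h.
Qed.

Lemma size_cands b us : size (cands b us) <= (size us).+1.
Proof.
elim/last_ind: us => [|us u IH] //.
rewrite cands_rcons /add_new size_rcons; case: ifP => _; first exact: leqW.
by rewrite size_rcons.
Qed.

Lemma xval_bounds b u : 0 < xval b u < d.
Proof.
rewrite /xval leq_min; case: eqVneq => [_|h]; last by have := D_gt0 h; lia.
by rewrite mul1n; lia.
Qed.

Lemma cands_bounds b us x : x \in cands b us -> 0 < x <= d.
Proof.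
rewrite mem_cands => /orP[/eqP->|/mapP[u _ ->]]; first by lia.
by have := xval_bounds b u; lia.
Qed.

Lemma size_cands_d b us : size (cands b us) <= d.
Proof.
rewrite -[leqRHS](size_iota 1); apply: uniq_leq_size; first exact: cands_uniq.
by move=> x /cands_bounds; rewrite mem_iota add1n ltnS.
Qed.

Definition candidates i := if insub i is Some b then cands b (enum 'I_n) else [::].
Definition bagcand B i :=
  if insub i is Some b then if b \in B then cands b (enum 'I_n) else [:: 0] else [:: 0].

Lemma candE b : candidates b = cands b (enum 'I_n). Proof. by rewrite /candidates valK. Qed.
Lemma bagcandE B b : bagcand B b = if b \in B then candidates b else [:: 0].
Proof. by rewrite /bagcand /candidates valK. Qed.

Lemma cand_uniq i : uniq (candidates i).
Proof. by rewrite /candidates; case: insubP => [b _ _|_]; rewrite ?cands_uniq. Qed.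

Lemma cand_bounds i x : x \in candidates i -> 0 < x <= d.
Proof. by rewrite /candidates; case: insubP => [b _ _|_] //; exact: cands_bounds. Qed.

Lemma bagcand_cand B i : bagcand B i = candidates i \/ bagcand B i = [:: 0].
Proof.
rewrite /bagcand /candidates; case: insubP => [b _ _|_]; last by right.
by case: ifP; [left | right].
Qed.

Lemma prof_bagcand B K b : prof B K b \in bagcand B b.
Proof.
rewrite bagcandE; case: ifPn => bB; last by rewrite profN // inE.
rewrite candE mem_cands; case: (boolP (b \in K)) => bK; first by rewrite profK ?eqxx.
apply/orP; right; case: (ltnP (prof B K b) d.-1) => h.
  have [u [uK uB E]] := prof_attained bB bK h.
  apply/mapP; exists u; rewrite ?mem_enum // /xval.
  have -> : (b == u) = false by apply: contraNF bK => /eqP->.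
  rewrite mul0n addn0 D_sym -E; apply/esym/minn_idPr; exact: ltnW.
apply/mapP; exists b; rewrite ?mem_enum // /xval D_refl eqxx mul1n add0n.
have := prof_mid d2 D_gt0 bB bK; lia.
Qed.

Lemma prof_lt B K b : prof B K b < W.
Proof. by rewrite ltnS prof_le. Qed.

Definition bagkeys B := radix_keys W (bagcand B) n.

Lemma bagkeys_uniq B : uniq (bagkeys B).
Proof.
apply: keys_uniq => // i; first by move=> x; exact: C_lt (@cand_bounds) (@bagcand_cand B) i x.
exact: C_uniq (@cand_uniq) (@bagcand_cand B) i.
Qed.

Lemma code_prof_bagkeys B K : code (prof B K) \in bagkeys B.
Proof. by apply: code_keys => b; exact: prof_bagcand. Qed.

Lemma size_bagkeys B m : #|B| <= m.+1 -> size (bagkeys B) <= n.+1 * d ^ m.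
Proof.
move=> hB; rewrite size_keys.
have -> : \prod_(i < n) size (bagcand B i) = \prod_(b in B) size (candidates b).
  rewrite [RHS]big_mkcond /=; apply: eq_bigr => b _.
  by rewrite bagcandE; case: ifP.
case: (set_0Vmem B) => [->|[b0 b0B]].
  by rewrite big_set0 muln_gt0 expn_gt0 (ltnW d2).
rewrite (bigD1 b0) //= leq_mul //.
  by rewrite candE (leq_trans (size_cands _ _)) // size_enum_ord.
apply: (@leq_trans (\prod_(b in B | b != b0) d)).
  by apply: leq_prod => b _; rewrite candE size_cands_d.
rewrite (eq_bigl (mem (B :\ b0))); last by move=> b; rewrite !inE andbC.
rewrite prod_nat_const leq_exp2l //; move: hB; rewrite (cardsD1 b0) b0B; lia.
Qed.

Lemma bagkeys_lt B key : key \in bagkeys B -> key < W ^ n.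
Proof.
by apply: keys_lt => // i x; exact: C_lt (@cand_bounds) (@bagcand_cand B) i x.
Qed.

Lemma digit_prof B K b : digit (code (prof B K)) b = prof B K b.
Proof. by apply: digit_code => // c; exact: prof_lt. Qed.

(** The exponent leaves out the bag, so that weights of two sets that agree on the bag multiply at a
    join; a member contributes its factor [X] when it is forgotten. *)
Definition set_weight U B K := (K \subset U) * scat K * X ^ #|K :\: B|.
Definition tab U B key := \sum_K set_weight U B K * (key == code (prof B K)).

Lemma sum_weight U B (F : {set 'I_n} -> nat) : \sum_K set_weight U B K * F K =
  \sum_(K : {set 'I_n} | K \subset U) scat K * X ^ #|K :\: B| * F K.
Proof.
rewrite [RHS]big_mkcond /=; apply: eq_bigr => K _; rewrite /set_weight.
by case: ifP => _; rewrite ?mul1n ?mul0n.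
Qed.

(** Lets a recurrence that treats a table key by key be checked one set [K] at a time. *)
Lemma tab_push U B (F : nat -> nat) :
  \sum_(key <- bagkeys B) tab U B key * F key = \sum_K set_weight U B K * F (code (prof B K)).
Proof.
under eq_bigr do rewrite big_distrl.
rewrite exchange_big /=; apply: eq_bigr => K _.
rewrite (bigD1_seq (code (prof B K))) ?bagkeys_uniq ?code_prof_bagkeys //= eqxx muln1.
by rewrite big1 ?addn0 // => key /negPf->; rewrite muln0.
Qed.

Lemma scat_set0 : scat set0.
Proof. by apply/scatP => u v; rewrite inE. Qed.

Lemma scat_set1 v : scat [set v].
Proof. by apply/scatP => u w; rewrite !inE => /eqP-> /eqP->; rewrite eqxx. Qed.

Lemma code_pick (f : 'I_n -> nat) v x : code [ffun b => if b == v then x else 0] = x * W ^ v.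
Proof.
rewrite /code (bigD1 v) //= ffunE eqxx big1 ?addn0 // => b /negPf h.
by rewrite ffunE h.
Qed.

Lemma tab_leaf v key : tab [set v] [set v] key = (key == d * W ^ v) + (key == d.-1 * W ^ v).
Proof.
rewrite /tab sum_weight -[[set v] in LHS]setU0 /=.
rewrite sum_subset_setU1 ?inE //.
rewrite (eq_bigl (pred1 set0)) => [|K]; last by rewrite subset0.
rewrite big_pred1_eq setU0 scat_set0 scat_set1 set0D setDv cards0 !mul1n addnC.
have E0 : prof [set v] set0 = [ffun b => if b == v then d.-1 else 0].
  apply/ffunP => b; rewrite !ffunE !inE; case: eqP => //= _.
  by rewrite big_pred0 // => u; rewrite !inE andbF.
have E1 : prof [set v] [set v] = [ffun b => if b == v then d else 0].
  by apply/ffunP => b; rewrite !ffunE !inE; case: eqP.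
by rewrite E0 E1 !code_pick.
Qed.

Definition key_dist key v :=
  \big[minn/d.-1]_(b < n) (digit key b + D b v + (1 - digit key b) * d).
Definition key_flag key v :=
  [forall b : 'I_n, (0 < digit key b) ==> (d <= digit key b %% d + D b v)].

Lemma tab_intro U B v : B \subset U -> v \notin U -> sep d D U B -> forall key',
  tab (v |: U) (v |: B) key' = \sum_(key <- bagkeys B) tab U B key *
    ((key' == key + key_dist key v * W ^ v) +
     (key' == key + d * W ^ v) * key_flag key v).
Proof.
move=> BU vU sUB key'; rewrite tab_push /tab !sum_weight sum_subset_setU1 //.
have vB := intro_notin_bag BU vU.
apply: eq_bigr => K KU.
have vK : v \notin K by apply: contra vU; exact: (subsetP KU).
have E1 : K :\: (v |: B) = K :\: B.
  apply/setP => u; rewrite !inE; case: (eqVneq u v) => [->|//].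
  by rewrite (negPf vK) !andbF.
have E2 : (v |: K) :\: (v |: B) = K :\: B.
  apply/setP => u; rewrite !inE; case: (eqVneq u v) => [->|//].
  by rewrite (negPf vK) !andbF.
rewrite E1 E2.
case: (boolP (scat K)) => sK; last first.
  rewrite !mul0n; case: (boolP (scat (v |: K))) => // /scatP h; case/negP: sK.
  by apply/scatP => x y xK yK; apply: h; rewrite inE ?xK ?yK orbT.
have kd : key_dist (code (prof B K)) v = intro_dist d D (prof B K) v.
  by apply: eq_bigr => b _; rewrite digit_prof.
have kf : key_flag (code (prof B K)) v = intro_flag d D (prof B K) v.
  by apply: eq_forallb => b; rewrite digit_prof.
rewrite kd kf (prof_intro_out d2 D_gt0 D_tri BU vU sUB KU sK) (prof_intro_in d D B vU KU).
rewrite (scat_intro d2 D_gt0 D_sym D_tri BU vU sUB KU sK) !code_setq profN //.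
by rewrite mul0n !subn0 mulnDr !mul1n; congr (_ + _); rewrite -mulnA mulnCA; congr (_ * _); exact: mulnC.
Qed.

Definition key_forget key v :=
  \sum_(b < n) forget_digit d D v (digit key v == d) b (digit key b) * W ^ b.

Lemma tab_forget U B v key' : tab U (B :\ v) key' =
  \sum_(key <- bagkeys B) tab U B key *
    ((key' == key_forget key v) * (if digit key v == d then X else 1)).
Proof.
rewrite tab_push /tab !sum_weight; apply: eq_bigr => K KU.
case: (boolP (scat K)) => sK; last by rewrite !mul0n.
have -> : key_forget (code (prof B K)) v = code (prof (B :\ v) K).
  rewrite (prof_forget d2 D_refl D_gt0 D_sym) //; apply: eq_bigr => b _.
  by congr (_ * _); rewrite [RHS]ffunE !digit_prof.
rewrite digit_prof prof_flag //.
have -> : #|K :\: (B :\ v)| = ((v \in B) && (v \in K)) + #|K :\: B|.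
  case: (boolP (v \in B)) => vB /=; last first.
    by have -> : B :\ v = B by apply/setDidPl; rewrite disjoint_sym disjoints1.
  rewrite (cardsD1 v) !inE eqxx /=; congr (_ + _); apply: eq_card => u; rewrite !inE.
  by case: (eqVneq u v) => [->|//]; rewrite vB.
by rewrite mul1n expnD; case: (_ && _); rewrite /= ?expn1 ?mul1n ?muln1 // mulnAC mulnC [X * _]mulnC mulnCA.
Qed.

Lemma X_gt1 : 1 < X.
Proof. by rewrite (@leq_trans (2 ^ 1)) // leq_exp2l. Qed.

Lemma weight_le U B K : set_weight U B K <= X ^ n.
Proof.
have h : X ^ #|K :\: B| <= X ^ n.
  by rewrite leq_exp2l ?X_gt1 // -[leqRHS]card_ord max_card.
rewrite /set_weight; apply: leq_trans h; move: (X ^ _) => x.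
by case: (K \subset U); case: (scat K); rewrite ?mul0n ?mul1n.
Qed.

Lemma weight_sum U B : \sum_K set_weight U B K < X ^ n.+1.
Proof.
apply: (@leq_ltn_trans (\sum_(K : {set 'I_n}) X ^ n)).
  by apply: leq_sum => K _; exact: weight_le.
rewrite sum_nat_const -cardsT -powersetT card_powerset cardsT card_ord.
have h : 2 ^ n < X by rewrite ltn_exp2l.
have h0 : 0 < X ^ n by rewrite expn_gt0 (ltnW X_gt1).
by rewrite [X ^ n.+1]expnS ltn_mul2r h0.
Qed.

Lemma tab_le U B key : tab U B key <= \sum_K set_weight U B K.
Proof. by apply: leq_sum => K _; case: (_ == _); rewrite ?muln1 ?muln0. Qed.

Lemma tab_notin U B key : key \notin bagkeys B -> tab U B key = 0.
Proof.
move=> h; rewrite /tab big1 // => K _; case: eqP => [E|_]; rewrite ?muln0 //.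
by rewrite E code_prof_bagkeys in h.
Qed.

Lemma t_gt0 : 0 < t. Proof. by rewrite !expn_gt0. Qed.

Lemma scat_sub K K' : K \subset K' -> scat K' -> scat K.
Proof.
move=> /subsetP s /scatP h; apply/scatP => u v uK vK; exact: h (s _ uK) (s _ vK).
Qed.

Lemma tab_join U1 U2 B key : U1 :&: U2 = B -> sep d D U1 B -> key \in bagkeys B ->
  bwd d t candidates (fun key => fwd d t candidates (tab U1 B) n key * fwd d t candidates (tab U2 B) n key) n key %% t
  = tab (U1 :|: U2) B key.
Proof.
move=> UB s1 /keys_code[q hq ->].
pose w (j : {set 'I_n} * {set 'I_n}) := set_weight U1 B j.1 * set_weight U2 B j.2.
rewrite (@bwd_mod n d t d2 t_gt0 candidates (bagcand B) cand_bounds (bagcand_cand B)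
  ({set 'I_n} * {set 'I_n})%type w (fun j => prof B j.1) (fun j => prof B j.2)) //;
  try by [move=> *; exact: prof_bagcand]; last 2 first.
- move=> q' hq'; rewrite !(fwdE d2 t_gt0 cand_uniq cand_bounds (bagcand_cand B)) //;
    try by move=> *; exact: prof_bagcand.
  rewrite big_distrlr pair_bigA /=; apply: eq_bigr => -[K1 K2] _ /=.
  by rewrite mulnACA -big_split /=; congr (_ * _); apply: eq_bigr => b _; rewrite ltn_ord.
(* Each side weighs less than [X ^ n.+1] in total; this fixes the exponent [2 * n.+1] in [t]. *)
- rewrite -(pair_bigA _ (fun K1 K2 => w (K1, K2))) /= /w /=.
  under eq_bigr do rewrite -big_distrr.
  rewrite -big_distrl mul2n -addnn expnD.
  by rewrite ltn_mul ?weight_sum.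
rewrite -(pair_bigA _ (fun K1 K2 => w (K1, K2) *
  [forall b, glue d (q b) (prof B K1 b) (prof B K2 b)])) /=.
rewrite /tab sum_weight (sum_subset_setU _ UB) [RHS]big_mkcond /=.
apply: eq_bigr => K1 _; case: ifP => K1U; last first.
  by rewrite big1 // => K2 _; rewrite /w /set_weight /= K1U !mul0n.
rewrite [RHS]big_mkcond /=; apply: eq_bigr => K2 _; case: ifP => K2U; last first.
  by rewrite /w /set_weight /= K2U !mul0n muln0.
rewrite /w /set_weight /= K1U K2U !mul1n.
case: (boolP (scat K1)) => sK1; last first.
  rewrite !mul0n; case: (boolP (scat (K1 :|: K2))) => h; rewrite ?mul0n ?muln0 //.
  by rewrite (scat_sub (subsetUl _ _) h) in sK1.
case: (boolP (scat K2)) => sK2; last first.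
  rewrite !mul0n muln0; case: (boolP (scat (K1 :|: K2))) => h; rewrite ?mul0n ?muln0 //.
  by rewrite (scat_sub (subsetUr _ _) h) in sK2.
rewrite (prof_join d2 D_gt0 D_sym D_tri UB s1 K1U K2U sK1 sK2 q) !mul1n -expnD.
have -> : (code q == code (prof B (K1 :|: K2))) = (q == prof B (K1 :|: K2)).
  apply/eqP/eqP => [|->//]; apply: code_inj => // b; last exact: prof_lt.
  exact: (C_lt cand_bounds (bagcand_cand B) (hq b)).
have -> : #|(K1 :|: K2) :\: B| = #|K1 :\: B| + #|K2 :\: B|.
  rewrite setDUl cardsU (_ : _ :&: _ = set0) ?cards0 ?subn0 //.
  apply/setP => u; rewrite !inE.
  case: (boolP (u \in K1)) => h1; rewrite ?andbF //.
  case: (boolP (u \in K2)) => h2; rewrite ?andbF //.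
  by rewrite -UB inE (subsetP K1U u h1) (subsetP K2U u h2).
by case: (K1 :&: B == K2 :&: B); case: (scat (K1 :|: K2)); case: (q == _);
  rewrite /= ?muln0 ?mul0n ?mul1n ?muln1.
Qed.

Lemma chi_le z x : chi d t z x <= t.
Proof.
rewrite /chi; case: eqP => [->|_].
  have -> : high d z z = false by rewrite /high /threshold; lia.
  by rewrite muln1 addn0 /collision_weight; case: ifP => // _; exact: t_gt0.
by rewrite muln0 add0n; apply: leq_trans t_gt0; case: (high _ _ _).
Qed.

(** Controls the length of numbers: each of the [n] digits contributes a character value of at most
    [t]. The largest numbers of a join are products of two such entries. *)
Lemma fwd_le U B m key : m <= n -> key \in bagkeys B ->
  fwd d t candidates (tab U B) m key <= X ^ n.+1 * t ^ n.
Proof.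
move=> mn /keys_code[q hq ->].
rewrite (fwdE d2 t_gt0 cand_uniq cand_bounds (bagcand_cand B)) //; last first.
  by move=> *; exact: prof_bagcand.
apply: leq_trans (leq_mul (ltnW (weight_sum U B)) (leqnn _)).
rewrite big_distrl; apply: leq_sum => K _; rewrite leq_mul2l; apply/orP; right.
rewrite -[X in _ <= _ ^ X]card_ord -prod_nat_const; apply: leq_prod => b _.
case: ifP => _; first exact: chi_le.
by apply: leq_trans t_gt0; case: (_ == _).
Qed.

(** Keeps intermediate values short: every level only subtracts and divides. *)
Lemma bwd_le a m key : bwd d t candidates a m key <= a key.
Proof.
elim: m => //= m IH; apply: leq_trans (leq_div _ _) _.
exact: leq_trans (leq_subr _ _) IH.
Qed.

End Tables.

(** * Reading the count off the final number *)

Section Counting.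
Variables (n : nat) (P : pred {set 'I_n}).
Notation X := (2 ^ n.+1).

(** The word [k] may be exponential in its length, so it is capped at [n.+1] to keep the number of
    divisions by [X] polynomial. For [k > n] the quotient and the count are both 0. *)
Lemma count_digit k :
  (\sum_(K : {set 'I_n}) P K * X ^ #|K|) %/ X ^ minn k n.+1 %% X =
  #|[set K : {set 'I_n} | P K && (#|K| == k)]|.
Proof.
pose f j := #|[set K : {set 'I_n} | P K && (#|K| == j)]|.
have fX j : f j < X.
  apply: leq_ltn_trans (max_card _) _.
  by rewrite -cardsT -powersetT card_powerset cardsT card_ord ltn_exp2l.
have -> : \sum_(K : {set 'I_n}) P K * X ^ #|K| = radix X f n.+1.
  have hK (K : {set 'I_n}) : #|K| < n.+1 by rewrite ltnS -[leqRHS]card_ord max_card.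
  rewrite (partition_big (fun K : {set 'I_n} => Ordinal (hK K)) predT) //=.
  apply: eq_bigr => j _; rewrite /f -sum1_card big_distrl /= big_mkcond [RHS]big_mkcond /=.
  apply: eq_bigr => K _; rewrite inE -val_eqE /=.
  by case: (P K); case: eqP => [->|]; rewrite ?mul1n ?mul0n.
have X0 : 0 < X by rewrite expn_gt0.
case: (leqP k n) => kn.
  by rewrite (minn_idPl (leqW kn)) -/(digit X _ k) digit_radix.
rewrite (minn_idPr kn) divn_small ?mod0n; last exact: radix_lt.
apply/esym/eqP; rewrite cards_eq0; apply/eqP/setP => K; rewrite !inE.
apply/negbTE; rewrite negb_and; apply/orP; right.
rewrite neq_ltn; apply/orP; left; apply: leq_ltn_trans kn.
by rewrite -[leqRHS]card_ord max_card.
Qed.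

End Counting.

Lemma tab_final n d (D : 'I_n -> 'I_n -> nat) :
  tab d D setT set0 0 = \sum_(K : {set 'I_n}) scat d D K * (2 ^ n.+1) ^ #|K|.
Proof.
apply: eq_bigr => K _; rewrite /set_weight subsetT setD0 mul1n.
have -> : code d.+1 (prof d D set0 K) = 0.
  by rewrite /code big1 // => b _; rewrite profN ?inE.
by rewrite muln1.
Qed.

(** * The program *)

Declare Scope prog_scope.
Delimit Scope prog_scope with prog.
Local Infix "+" := (Bin Add) : prog_scope.
Local Infix "-" := (Bin Defs.Sub) : prog_scope.
Local Infix "*" := (Bin Mul) : prog_scope.
Local Infix "/" := (Bin Div) : prog_scope.
Local Notation "x ::= e" := (Let x e) (at level 90, right associativity).
Local Infix ";;" := Then (at level 94, right associativity).

Local Open Scope prog_scope.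

Local Coercion Var : nat >-> aexp.
Local Notation "# a" := (Lit a) (at level 1, format "# a") : prog_scope.

Definition eMin a b := (a - (a - b))%prog.
Definition eMod a b := (a - (a / b) * b)%prog.
Definition eEq a b := (#1 - ((a - b) + (b - a)))%prog.
Definition eLe a b := (#1 - (a - b))%prog.
Definition eLt a b := (#1 - (#1 - (b - a)))%prog.

Local Notation vout := 0. Local Notation vn := 1. Local Notation vk := 2. Local Notation vd := 3.
Local Notation vX := 4. Local Notation vt := 5. Local Notation vW := 6. Local Notation vpos := 7.
Local Notation vsp := 8. Local Notation vtag := 9. Local Notation vv := 10. Local Notation vsl := 11.
Local Notation vlen := 12. Local Notation vi := 13. Local Notation vb := 14. Local Notation va := 15.
Local Notation vj := 16. Local Notation vu := 17. Local Notation vr := 18. Local Notation vw := 19.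
Local Notation vkey := 20. Local Notation vval := 21. Local Notation vx := 22. Local Notation vy := 23.
Local Notation vz := 24. Local Notation vp := 25. Local Notation vm := 26. Local Notation vf := 27.
Local Notation vg := 28. Local Notation vsb := 29. Local Notation vcnt := 30. Local Notation vq := 31.

Local Notation aPW := 0. Local Notation aD := 1. Local Notation aCC := 2. Local Notation aCA := 3.
Local Notation aSEEN := 4. Local Notation aDOM := 5. Local Notation aT := 6. Local Notation aBAG := 7.
Local Notation aSTK := 8. Local Notation aF := 9. Local Notation aG := 10. Local Notation aH := 11.

Definition ePW (b : aexp) := Arr aPW b #0.
Definition eDist (b v : aexp) := Arr aD vn (b * vn + v).
Definition eDig (key b : aexp) := eMod (key / ePW b) vW.

Definition c_init :=
  vn ::= Inp #0 ;; vk ::= Inp #1 ;; vd ::= Inp #2 ;; vW ::= vd + #1 ;;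
  vX ::= #2 ;; For false vb vn (vX ::= vX * #2) ;;
  vt ::= #1 ;; For false vb (vn + #1) (vt ::= vt * (vX * vX)) ;;
  vpos ::= #3 + vn * vn ;; vcnt ::= (Len - (vpos + #1)) / #2.

Definition c_pw :=
  vx ::= #1 ;; For false vb vn (Put aPW vb #0 vx ;; vx ::= vx * vW).

(** Layer [r] of the array holds [bford r]; separate layers up to the [n]-th avoid overwriting
    values still in use. The word 0 of a non-edge is turned into [d]. *)
Definition c_dist :=
  For false vu vn (For false vq vn (
    vx ::= Inp (#3 + vu * vn + vq) ;;
    Put aD #0 (vu * vn + vq) ((#1 - eEq vu vq) * eMin vd (vx + (#1 - vx) * vd)))) ;;
  For false vr vn (For false vu vn (For false vq vn (
    vf ::= vd ;;
    For false vw vn (vf ::= eMin vf (Arr aD #0 (vu * vn + vw) + Arr aD vr (vw * vn + vq))) ;;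
    Put aD (vr + #1) (vu * vn + vq) vf))).

(** The marks in [aSEEN] replace a search in the list. The leading entry [d] stays unmarked, as all
    later values are below [d]. *)
Definition c_cand :=
  For false vb vn (
    Put aCA vb #0 vd ;; vm ::= #1 ;;
    For false vu vn (
      vx ::= eMin (vd - #1) (eDist vb vu + eEq vb vu * vd) ;;
      Cond (Arr aSEEN vb vx) Nop
        (Put aSEEN vb vx #1 ;; Put aCA vb vm vx ;; vm ::= vm + #1)) ;;
    Put aCC vb #0 vm).

(** Layer [vb + 1] lists the partial keys on the first [vb + 1] vertices. The code of the bag has
    digits 0 and 1; outside the bag the only choice is the digit 0. *)
Definition c_dom :=
  Put aDOM #0 #0 #0 ;; vlen ::= #1 ;;
  For false vb vn (
    vz ::= eDig (Arr aBAG vsl #0) vb ;;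
    vm ::= vz * Arr aCC vb #0 + (#1 - vz) ;;
    vp ::= #0 ;;
    For true va vlen (For false vj vm (
      Put aDOM (vb + #1) vp (Arr aDOM vb va + vz * Arr aCA vb vj * ePW vb) ;;
      vp ::= vp + #1)) ;;
    vlen ::= vp).

Definition each_key c := For true va vlen (vkey ::= Arr aDOM vn va ;; c).

Definition c_leaf :=
  Put aT vi (vd * ePW vv) #1 ;; Put aT vi ((vd - #1) * ePW vv) #1 ;;
  Put aBAG vi #0 (ePW vv) ;; Put aSTK vsp #0 vi ;; vsp ::= vsp + #1.

Definition c_intro :=
  each_key (
    vval ::= Arr aT vsl vkey ;; vm ::= vd - #1 ;; vy ::= #1 ;;
    For false vb vn (
      vz ::= eDig vkey vb ;;
      vm ::= eMin vm (vz + eDist vb vv + (#1 - vz) * vd) ;;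
      vy ::= vy * (#1 - vz * (vd - (eMod vz vd + eDist vb vv)))) ;;
    Put aT vi (vkey + vm * ePW vv) (Arr aT vi (vkey + vm * ePW vv) + vval) ;;
    Put aT vi (vkey + vd * ePW vv) (Arr aT vi (vkey + vd * ePW vv) + vval * vy)) ;;
  Put aBAG vi #0 (Arr aBAG vsl #0 + ePW vv) ;; Put aSTK (vsp - #1) #0 vi.

Definition c_forget :=
  each_key (
    vval ::= Arr aT vsl vkey ;; vy ::= eEq (eDig vkey vv) vd ;; vp ::= #0 ;;
    For false vb vn (
      vz ::= eDig vkey vb ;;
      vp ::= vp + eMin vz (eDist vb vv + (#1 - vy) * (#1 - eEq vb vv) * vd) * ePW vb) ;;
    Put aT vi vp (Arr aT vi vp + vval * (#1 + vy * (vX - #1)))) ;;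
  Put aBAG vi #0 (Arr aBAG vsl #0 - eDig (Arr aBAG vsl #0) vv * ePW vv) ;;
  Put aSTK (vsp - #1) #0 vi.

(** With truncated subtraction, [z * (d - 2 * z)] is positive exactly when [z] is low. *)
Definition e_cz := (#1 + (vt - #1) * eMin #1 (vz * (vd - #2 * vz)))%prog.
Definition e_thr := (vz + #1 + (vd - vz - (vz + #1)))%prog.

Definition c_forward :=
  For false vb vn (each_key (
    vz ::= eDig vkey vb ;; vx ::= e_cz ;; vy ::= e_thr ;;
    vf ::= vx * Arr aF vb vkey ;; vg ::= vx * Arr aG vb vkey ;;
    For false vj (Arr aCC vb #0) (
      vp ::= Arr aCA vb vj ;; vm ::= eLe vy vp * eLt vp vd ;;
      vw ::= vkey + vp * ePW vb - vz * ePW vb ;;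
      vf ::= vf + vm * Arr aF vb vw ;; vg ::= vg + vm * Arr aG vb vw) ;;
    Put aF (vb + #1) vkey vf ;; Put aG (vb + #1) vkey vg)).

Definition c_backward :=
  For false vb vn (each_key (
    vz ::= eDig vkey vb ;; vx ::= e_cz ;; vy ::= e_thr ;; vp ::= vd ;;
    For false vj (Arr aCC vb #0) (
      vm ::= Arr aCA vb vj ;; vp ::= eMin vp (vm + (#1 - eLe vy vm) * vd)) ;;
    vw ::= vkey + vp * ePW vb - vz * ePW vb ;;
    Put aH (vb + #1) vkey ((Arr aH vb vkey - eLt vp vd * Arr aH vb vw) / vx))).

Definition c_join :=
  vsb ::= Arr aSTK (vsp - #2) #0 ;;
  each_key (Put aF #0 vkey (Arr aT vsb vkey) ;; Put aG #0 vkey (Arr aT vsl vkey)) ;;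
  c_forward ;;
  each_key (Put aH #0 vkey (Arr aF vn vkey * Arr aG vn vkey)) ;;
  c_backward ;;
  each_key (Put aT vi vkey (eMod (Arr aH vn vkey) vt)) ;;
  Put aBAG vi #0 (Arr aBAG vsl #0) ;;
  vsp ::= vsp - #1 ;; Put aSTK (vsp - #1) #0 vi.

Definition c_node :=
  Cond (eEq vtag #1) c_leaf (
    vsl ::= Arr aSTK (vsp - #1) #0 ;; c_dom ;;
    Cond (eEq vtag #2) c_intro (Cond (eEq vtag #3) c_forget c_join)).

(** After the nodes of the tree, every vertex is forgotten once, which empties the root bag. A
    vertex outside the bag has digit 0 in every key, and forgetting it leaves the table as it is. *)
Definition c_step :=
  Cond (eLt vi vcnt)
    (vtag ::= Inp (vpos + #2 * vi) ;; vv ::= Inp (vpos + #2 * vi + #1))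
    (vtag ::= #3 ;; vv ::= vi - vcnt) ;;
  c_node.

(** At [d = 1] the state [d - 1] would coincide with the mark 0 of vertices outside the bag. There
    every set is scattered, and the final number is [(X + 1) ^ n]. *)
Definition c_main :=
  Cond (eLt #1 vd)
    (c_pw ;; c_dist ;; c_cand ;; vsp ::= #0 ;; For false vi (vcnt + vn) c_step ;;
     vf ::= Arr aT (Arr aSTK #0 #0) #0)
    (vf ::= #1 ;; For false vb vn (vf ::= vf * (vX + #1))) ;;
  For false vb (eMin vk (vn + #1)) (vf ::= vf / vX) ;;
  vout ::= eMod vf vX.

Definition program := c_init ;; c_main.

Local Close Scope prog_scope.

Lemma program_wf : wf program. Proof. by []. Qed.

Section Eval.
Variable I : seq nat.
Implicit Types (s : store) (a b : aexp).

Lemma ev_num s x : ev I s #x%prog = x. Proof. by []. Qed.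
Lemma ev_var s i : ev I s (Var i) = rg s i. Proof. by []. Qed.
Lemma ev_len s : ev I s Len = size I. Proof. by []. Qed.
Lemma ev_inp s a : ev I s (Inp a) = nth 0 I (ev I s a). Proof. by []. Qed.
Lemma ev_arr s k a b : ev I s (Arr k a b) = ar s k (ev I s a) (ev I s b). Proof. by []. Qed.
Lemma ev_add s a b : ev I s (a + b)%prog = ev I s a + ev I s b. Proof. by []. Qed.
Lemma ev_sub s a b : ev I s (a - b)%prog = ev I s a - ev I s b. Proof. by []. Qed.
Lemma ev_mul s a b : ev I s (a * b)%prog = ev I s a * ev I s b. Proof. by []. Qed.
Lemma ev_div s a b : ev I s (a / b)%prog = ev I s a %/ ev I s b. Proof. by []. Qed.
Lemma ev_min s a b : ev I s (eMin a b) = minn (ev I s a) (ev I s b).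
Proof. by rewrite /eMin !ev_sub; lia. Qed.
Lemma ev_mod s a b : ev I s (eMod a b) = ev I s a %% ev I s b.
Proof. by rewrite /eMod ev_sub ev_mul ev_div {1}(divn_eq (ev I s a) (ev I s b)) addKn. Qed.
Lemma ev_eq s a b : ev I s (eEq a b) = (ev I s a == ev I s b).
Proof. by rewrite /eEq ev_sub ev_add !ev_sub ev_num; lia. Qed.
Lemma ev_le s a b : ev I s (eLe a b) = (ev I s a <= ev I s b).
Proof. by rewrite /eLe !ev_sub ev_num; lia. Qed.
Lemma ev_lt s a b : ev I s (eLt a b) = (ev I s a < ev I s b).
Proof. by rewrite /eLt !ev_sub ev_num; lia. Qed.

Definition evE := (ev_min, ev_mod, ev_eq, ev_le, ev_lt, ev_num, ev_var, ev_len,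
  ev_inp, ev_arr, ev_add, ev_sub, ev_mul, ev_div).

End Eval.

Arguments ev : simpl never.

Lemma tri_let_eq I l bnd s i e x (Q : store -> Prop) :
  ev I s e = x -> x < 2 ^ l -> Q (setr i x s) -> tri I l bnd s (Let i e) Q.
Proof. by move=> <-; exact: tri_let. Qed.

Lemma tri_put_eq I l bnd s k a b e a' b' x (Q : store -> Prop) :
  ev I s a = a' -> ev I s b = b' -> ev I s e = x -> x < 2 ^ l ->
  Q (putr k a' b' x s) -> tri I l bnd s (Put k a b e) Q.
Proof. by move=> <- <- <-; exact: tri_put. Qed.

Tactic Notation "assign" uconstr(v) :=
  try apply: tri_then; refine (@tri_let_eq _ _ _ _ _ _ v _ _ _ _).
Tactic Notation "store_at" constr(a) constr(b) uconstr(v) :=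
  try apply: tri_then; refine (@tri_put_eq _ _ _ _ _ _ _ _ a b v _ _ _ _ _ _).

(** * Correctness of the operations on tables *)

Section Verify.
Variables (I : seq nat) (l : nat) (bnd : bool -> nat).
Notation tri := (tri I l bnd).

Lemma tri_for_eq (Inv : nat -> store -> Prop) m s b i e c (Q : store -> Prop) :
  i \notin wr c -> ev I s e = m -> m <= bnd b ->
  Inv 0 (setr i 0 s) ->
  (forall k s', k < m -> rg s' i = k -> frame (i :: wr c) (wa c) s s' ->
     Inv k s' -> tri s' c (fun s2 => Inv k.+1 (setr i k.+1 s2))) ->
  (forall s', frame (i :: wr c) (wa c) s s' -> Inv m s' -> Q s') ->
  tri s (For b i e c) Q.
Proof. by move=> h1 <- h2 h3 h4 h5; apply: (tri_for (Inv := Inv)) => // s' _; exact: h5. Qed.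

Lemma frame_trans R1 A1 R2 A2 s1 s2 s3 : frame R1 A1 s1 s2 -> frame R2 A2 s2 s3 ->
  frame (R1 ++ R2) (A1 ++ A2) s1 s3.
Proof.
move=> [h1 h2] [h3 h4]; split=> r; rewrite mem_cat negb_or => /andP[n1 n2].
  by rewrite h3 ?h1.
by rewrite h4 ?h2.
Qed.

(** The invariant sees only the keys already treated and the arrays; registers are scratch space
    within a round. *)
Lemma tri_each_key (Inv : seq nat -> (nat -> nat -> nat -> nat) -> Prop) n L s c
    (Q : store -> Prop) :
  vn \notin wr c -> va \notin wr c -> aDOM \notin wa c -> size L <= bnd true ->
  (forall key, key \in L -> key < 2 ^ l) ->
  rg s vn = n -> rg s vlen = size L -> (forall i, i < size L -> ar s aDOM n i = nth 0 L i) ->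
  Inv [::] (ar s) ->
  (forall pre key post s', L = rcons pre key ++ post -> rg s' vkey = key ->
     frame (va :: vkey :: wr c) (wa c) s s' ->
     Inv pre (ar s') -> tri s' c (fun s2 => Inv (rcons pre key) (ar s2))) ->
  (forall s', frame (va :: vkey :: wr c) (wa c) s s' -> Inv L (ar s') -> Q s') ->
  tri s (each_key c) Q.
Proof.
move=> h1 h2 h3 hb hl En El Ed I0 IS IQ.
apply: (@tri_for_eq (fun k s' => Inv (take k L) (ar s')) (size L)) => //.
- by rewrite /= take0.
- move=> k s' kL Ek fr Ik; apply: tri_then.
  have key_in : nth 0 L k \in L by exact: mem_nth.
  assign (nth 0 L k).
  + by rewrite !evE Ek (proj1 fr) ?En ?(proj2 fr) ?Ed // !inE negb_or h1.
  + exact: hl.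
  have EL : L = rcons (take k L) (nth 0 L k) ++ drop k.+1 L.
    by rewrite -take_nth ?cat_take_drop.
  apply: tri_weaken (IS (take k L) (nth 0 L k) (drop k.+1 L) _ EL _ _ _) _ => //.
  + split=> [r|a] h; last by rewrite /= (proj2 fr).
    move: h; rewrite !inE !negb_or => /and3P[r1 r2 r3].
    by rewrite /= -[eqn r vkey]/(r == vkey) (negPf r2) (proj1 fr) // !inE !negb_or r1 r2.
  by move=> s2 /=; rewrite (take_nth 0).
by move=> s' fr; rewrite take_size; exact: IQ.
Qed.

Lemma tri_ord (Inv : nat -> store -> Prop) n s i c (Q : store -> Prop) :
  i \notin wr c -> n <= bnd false -> rg s vn = n -> Inv 0 (setr i 0 s) ->
  (forall (b : 'I_n) s', rg s' i = b -> frame (i :: wr c) (wa c) s s' ->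
     Inv b s' -> tri s' c (fun s2 => Inv b.+1 (setr i b.+1 s2))) ->
  (forall s', frame (i :: wr c) (wa c) s s' -> Inv n s' -> Q s') ->
  tri s (For false i vn c) Q.
Proof.
move=> h1 h2 En I0 IS IQ; apply: (@tri_for_eq Inv n) => //.
move=> k s' kn Ek fr; exact: (IS (Ordinal kn)).
Qed.

Section Static.
Variables (n d : nat) (D : 'I_n -> 'I_n -> nat).
Notation W := d.+1.
Notation X := (2 ^ n.+1).
Notation t := (X ^ (2 * n.+1)).
Notation cand := (candidates d D).

Record params s : Prop := Params {
  p_n : rg s vn = n;
  p_d : rg s vd = d;
  p_W : rg s vW = W;
  p_X : rg s vX = X;
  p_t : rg s vt = t
}.

Record tables s : Prop := Tables {
  t_pw : forall b : 'I_n, ar s aPW b 0 = W ^ b;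
  t_D : forall b v : 'I_n, ar s aD n (b * n + v) = D b v;
  t_cc : forall b : 'I_n, ar s aCC b 0 = size (cand b);
  t_ca : forall (b : 'I_n) j, j < size (cand b) -> ar s aCA b j = nth 0 (cand b) j
}.

Lemma params_frame R A s s' : frame R A s s' ->
  all (fun r => r \notin R) [:: vn; vd; vW; vX; vt] -> params s -> params s'.
Proof.
move=> [h _] /=; rewrite andbT => /and5P[h1 h2 h3 h4 h5] [? ? ? ? ?].
by split; rewrite h.
Qed.

Lemma tables_frame R A s s' : frame R A s s' ->
  all (fun k => k \notin A) [:: aPW; aD; aCC; aCA] -> tables s -> tables s'.
Proof.
move=> [_ h] /=; rewrite andbT => /and4P[h1 h2 h3 h4] [? ? ? ?].
by split; rewrite h.
Qed.

Lemma params_setr i x s : i \notin [:: vn; vd; vW; vX; vt] -> params s -> params (setr i x s).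
Proof.
rewrite !inE !negb_or => /and5P[h1 h2 h3 h4 h5] [? ? ? ? ?].
split; rewrite /= -[eqn _ i]/(_ == i) eq_sym; [rewrite (negPf h1) | rewrite (negPf h2)
 | rewrite (negPf h3) | rewrite (negPf h4) | rewrite (negPf h5)]; done.
Qed.

Lemma params_putr k a b x s : params s -> params (putr k a b x s).
Proof. by case=> *; split. Qed.

Lemma tables_setr i x s : tables s -> tables (setr i x s).
Proof. by case=> *; split. Qed.

Lemma tables_putr k a b x s : k \notin [:: aPW; aD; aCC; aCA] -> tables s ->
  tables (putr k a b x s).
Proof.
rewrite !inE !negb_or => /and4P[h1 h2 h3 h4] [? ? ? ?].
split=> *; rewrite /= -[eqn _ k]/(_ == k) eq_sym; [rewrite (negPf h1) | rewrite (negPf h2)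
 | rewrite (negPf h3) | rewrite (negPf h4)]; auto.
Qed.

Ltac static :=
  repeat first [ eassumption
    | apply: params_setr; [by [] |] | apply: params_putr
    | apply: tables_setr | apply: tables_putr; [by [] |]
    | match goal with
      | fr : frame _ _ ?s0 ?s1 |- params ?s1 => apply: (params_frame fr); [by [] |]
      | fr : frame _ _ ?s0 ?s1 |- tables ?s1 => apply: (tables_frame fr); [by [] |]
      end ].

Hypothesis d2 : 1 < d.
Hypothesis D_refl : forall u, D u u = 0.
Hypothesis D_gt0 : forall u v, u != v -> 0 < D u v.
Hypothesis D_sym : forall u v, D u v = D v u.
Hypothesis D_tri : forall u v w, D u w <= D u v + D v w.
Variable m : nat.
Hypothesis Yn : n.+1 <= bnd false.
Hypothesis Dm : n.+1 * d ^ m <= bnd true.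
Hypothesis bndl : forall b, bnd b < 2 ^ l.
Hypothesis Ml : (X ^ n.+1 * t ^ n) * (X ^ n.+1 * t ^ n) < 2 ^ l.
Hypothesis Wl : W ^ n.+1 < 2 ^ l.

Lemma n_lt : n.+1 < 2 ^ l. Proof. exact: leq_ltn_trans Yn (bndl false). Qed.

Section Dom.
Variable B : {set 'I_n}.
Hypothesis Bm : #|B| <= m.+1.
Notation keys := (bagkeys d D B).

Definition bagcode (B : {set 'I_n}) := \sum_(b in B) W ^ b.

Lemma digit_bagcode (A : {set 'I_n}) (b : 'I_n) : digit W (bagcode A) b = (b \in A).
Proof.
have -> : bagcode A = code W [ffun b => (b \in A) : nat].
  by rewrite /bagcode big_mkcond; apply: eq_bigr => c _; rewrite ffunE; case: ifP; rewrite ?mul1n.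
rewrite digit_code ?ffunE // => c; rewrite ffunE; apply: leq_ltn_trans (leq_b1 _) _.
exact: ltnW.
Qed.

Lemma keys_le : size keys <= bnd true.
Proof. by apply: leq_trans Dm; exact: (size_bagkeys d2 D_gt0 Bm). Qed.


Definition dom_rep s :=
  rg s vlen = size keys /\ forall i, i < size keys -> ar s aDOM n i = nth 0 keys i.

Lemma nth_allpairs (T1 T2 : Type) (f : T1 -> T2 -> nat) x0 y0 s1 s2 i j :
  i < size s1 -> j < size s2 ->
  nth 0 (allpairs f s1 s2) (i * size s2 + j) = f (nth x0 s1 i) (nth y0 s2 j).
Proof.
elim: s1 i => // x s1 IH [|i] /= il jl.
  by rewrite nth_cat size_map jl (nth_map y0).
by rewrite nth_cat size_map mulSn -addnA ltnNge leq_addr /= addKn IH.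
Qed.

Lemma size_bagcand_gt0 i : 0 < size (bagcand d D B i).
Proof.
rewrite /bagcand; case: insubP => // b _ _; case: ifP => // _.
have : d \in cands d D b (enum 'I_n) by rewrite mem_cands eqxx.
by case: cands.
Qed.

(** The partial lists must also obey the bound on the table size. Every digit has at least one
    choice, so the lists never shrink as digits are added. *)
Lemma size_keys_mono b : b < n -> size (radix_keys W (bagcand d D B) b.+1) <= size keys.
Proof.
rewrite /bagkeys => bn; move: (bagcand d D B) size_bagcand_gt0 => C C0.
rewrite -(subnKC bn); elim: (n - b.+1) => [|j IH]; first by rewrite addn0.
have E k : size (radix_keys W C k.+1) = size (radix_keys W C k) * size (C k).
  by rewrite /= size_allpairs.
by apply: (leq_trans IH); rewrite addnS [leqRHS]E leq_pmulr.
Qed.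

Lemma tri_dom s sl Q : params s -> tables s -> rg s vsl = sl ->
  ar s aBAG sl 0 = bagcode B ->
  (forall s', frame (wr c_dom) (wa c_dom) s s' -> dom_rep s' -> Q s') ->
  tri s c_dom Q.
Proof.
move=> ps ts Esl Eb HQ.
suff H : tri s c_dom dom_rep by apply: tri_weaken (tri_frame H) _ => s' [h1 h2]; exact: HQ.
have l1 : 1 < 2 ^ l by apply: leq_ltn_trans n_lt.
pose K := radix_keys W (bagcand d D B).
rewrite /c_dom; store_at 0 0 0 => //; first exact: ltnW.
assign 1 => //.
apply: (@tri_ord (fun b s' => rg s' vlen = size (K b) /\
  forall i, i < size (K b) -> ar s' aDOM b i = nth 0 (K b) i) n) => //.
- exact: ltnW.
- by rewrite /= (p_n ps).
- by split=> //= -[|i].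
- move=> b s1 E1 fr1 [I1 I2].
  pose C := bagcand d D B b.
  have p1 : params s1 by static.
  have t1 : tables s1 by static.
  have Es1 : rg s1 vsl = sl by rewrite (proj1 fr1).
  have Eb1 : ar s1 aBAG sl 0 = bagcode B by rewrite (proj2 fr1).
  have bn := ltn_ord b.
  have Ez : size C = (b \in B) * size (cand b) + (1 - (b \in B)).
    by rewrite /C bagcandE; case: ifP => _; rewrite /= ?mul1n ?addn0.
  have Cn : size C <= n.+1.
    rewrite /C bagcandE; case: ifP => // _; rewrite candE.
    by rewrite (leq_trans (size_cands _ _ _ _)) // size_enum_ord.
  assign (b \in B).
  + by rewrite /eDig !evE Es1 Eb1 E1 (t_pw t1) (p_W p1) -digit_bagcode.
  + exact: leq_ltn_trans (leq_b1 _) l1.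
  assign (size C).
  + by rewrite !evE /= E1 (t_cc t1) -Ez.
  + exact: leq_ltn_trans Cn n_lt.
  assign 0; rewrite ?expn_gt0 //.
  apply: tri_then.
  have EK : K b.+1 = [seq k + x * W ^ b | k <- K b, x <- C] by [].
  have SK : size (K b.+1) = size (K b) * size C by rewrite EK size_allpairs.
  have SL : size (K b.+1) <= bnd true by apply: leq_trans (size_keys_mono bn) keys_le.
  have C0 : 0 < size C := size_bagcand_gt0 b.
  apply: (@tri_for_eq (fun a s' => [/\ rg s' vp = a * size C,
     (forall i, i < size (K b) -> ar s' aDOM b i = nth 0 (K b) i)
     & forall i, i < a * size C -> ar s' aDOM b.+1 i = nth 0 (K b.+1) i]) (size (K b))) => //.
  + by apply: leq_trans SL; rewrite SK leq_pmulr.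
  + move=> a s2 aK Ea fr2 [J1 J2 J3].
    apply: (@tri_for_eq (fun j s' => [/\ rg s' vp = a * size C + j,
       (forall i, i < size (K b) -> ar s' aDOM b i = nth 0 (K b) i)
       & forall i, i < a * size C + j -> ar s' aDOM b.+1 i = nth 0 (K b.+1) i]) (size C)) => //.
    * by rewrite evE (proj1 fr2).
    * exact: leq_trans Cn Yn.
    * by rewrite addn0.
    * move=> j s3 jC Ej fr3 [L1 L2 L3].
      have t3 : tables s3 by static.
      have Eb3 : rg s3 vb = b by rewrite (proj1 fr3) // (proj1 fr2).
      have Ez3 : rg s3 vz = (b \in B) by rewrite (proj1 fr3) // (proj1 fr2).
      have Ea3 : rg s3 va = a by rewrite (proj1 fr3).
      have Ex : nth 0 (K b.+1) (a * size C + j) = nth 0 (K b) a + nth 0 C j * W ^ b.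
        by rewrite EK (nth_allpairs _ 0 0).
      have pos : a * size C + j < size (K b.+1).
        rewrite SK; apply: (@leq_trans (a.+1 * size C)).
          by rewrite mulSn [size C + _]addnC ltn_add2l.
        by rewrite leq_mul2r aK orbT.
      store_at b.+1 (a * size C + j) (nth 0 (K b.+1) (a * size C + j)).
      - by rewrite !evE Eb3 addn1.
      - by rewrite !evE.
      - rewrite /ePW !evE Ej Eb3 Ez3 Ea3 L2 // Ex (t_pw t3).
        congr (_ + _ * _); rewrite /C bagcandE in jC *; case: ifP jC => bB jC.
          by rewrite (t_ca t3) // mul1n.
        by case: j jC {L1 L3 Ej Ex pos} => // _; rewrite mul0n.
      - apply: leq_ltn_trans Wl; apply: ltnW.
        have := mem_nth 0 pos; move: (nth _ _ _) => k kK.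
        have kl : k < W ^ b.+1.
          apply: keys_lt kK => i x.
          exact: C_lt (@cand_bounds n d D d2 D_gt0) (@bagcand_cand n d D B) i x.
        by apply: leq_trans kl _; rewrite leq_exp2l // ltnW.
      assign (a * size C + j).+1.
      - by rewrite !evE /= L1 addn1.
      - exact: leq_ltn_trans (leq_trans pos SL) (bndl true).
      split=> /=.
      - by rewrite addnS.
      - by move=> i iK; rewrite ltn_eqF //= L2.
      - move=> i; rewrite addnS ltnS leq_eqVlt eqxx /=; case: eqP => [->|_ h] //; exact: L3.
    move=> s3 fr3 [L1 L2 L3] /=; split=> //.
    + by rewrite mulSn addnC.
    + by move=> i; rewrite mulSn addnC; exact: L3.
  move=> s2 fr2 [J1 J2 J3].
  assign (size (K b.+1)).
  + by rewrite !evE J1 SK.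
  + exact: leq_ltn_trans SL (bndl true).
  by split=> //= i; rewrite SK; exact: J3.
Qed.

Lemma dom_rep_frame R A s s' : frame R A s s' -> vlen \notin R -> aDOM \notin A ->
  dom_rep s -> dom_rep s'.
Proof. by move=> [h1 h2] lR dA [d1 d3]; split; rewrite ?h1 ?h2. Qed.

Lemma tri_keys (Inv : seq nat -> (nat -> nat -> nat -> nat) -> Prop) s c Q :
  vn \notin wr c -> va \notin wr c -> aDOM \notin wa c -> params s -> dom_rep s ->
  Inv [::] (ar s) ->
  (forall pre key post s', keys = rcons pre key ++ post -> key \in keys ->
     rg s' vkey = key -> frame (va :: vkey :: wr c) (wa c) s s' ->
     Inv pre (ar s') -> tri s' c (fun s2 => Inv (rcons pre key) (ar s2))) ->
  (forall s', frame (va :: vkey :: wr c) (wa c) s s' -> Inv keys (ar s') -> Q s') ->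
  tri s (each_key c) Q.
Proof.
move=> h1 h2 h3 ps [dl dk] I0 IS IQ.
apply: (@tri_each_key Inv n keys) => //.
- exact: keys_le.
- move=> key /(bagkeys_lt d2 D_gt0) h; apply: ltn_trans h (leq_ltn_trans _ Wl).
  by rewrite leq_pexp2l.
- exact: p_n.
- move=> pre key post s' E; apply: IS (E) _.
  by rewrite E mem_cat mem_rcons inE eqxx.
Qed.

End Dom.

Lemma bigminn_step e (F : 'I_n -> nat) (b : 'I_n) :
  \big[minn/e]_(i < n | i < b.+1) F i = minn (\big[minn/e]_(i < n | i < b) F i) (F b).
Proof.
apply: eq_of_leq => x; rewrite leq_min !bigminn_leP -andbA; congr (_ && _).
apply/forallP/andP => [h|[/forallP h1 h2] i].
  split; last by have := h b; rewrite ltnSn.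
  by apply/forallP => i; apply/implyP => ib; have := h i; rewrite ltnW.
by apply/implyP; rewrite ltnS leq_eqVlt => /orP[/eqP/val_inj->//|ib]; have := h1 i; rewrite ib.
Qed.

Lemma sum_step (F : 'I_n -> nat) (b : 'I_n) :
  \sum_(i < n | i < b.+1) F i = \sum_(i < n | i < b) F i + F b.
Proof.
rewrite (bigD1 b) //= addnC; congr (_ + _); apply: eq_bigl => i.
by rewrite ltnS [RHS]ltn_neqAle andbC.
Qed.

Lemma forall_step (P : pred 'I_n) (b : 'I_n) :
  [forall i : 'I_n, (i < b.+1) ==> P i] = [forall i : 'I_n, (i < b) ==> P i] && P b.
Proof.
apply/forallP/andP => [h|[/forallP h1 h2] i].
  split; last by have := h b; rewrite ltnSn.
  by apply/forallP => i; apply/implyP => ib; have := h i; rewrite ltnS (ltnW ib).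
by apply/implyP; rewrite ltnS leq_eqVlt => /orP[/eqP/val_inj->//|ib]; have := h1 i; rewrite ib.
Qed.

Lemma dig_lt key b : digit W key b < W. Proof. exact: ltn_pmod. Qed.
Lemma l1 : 1 < 2 ^ l. Proof. exact: leq_ltn_trans n_lt. Qed.
Lemma W1 : 1 < W. Proof. exact: ltnW. Qed.
Lemma W_lt : W < 2 ^ l.
Proof. by apply: leq_ltn_trans Wl; rewrite -[leqLHS]expn1 leq_exp2l ?W1. Qed.
Lemma d_lt : d < 2 ^ l. Proof. exact: ltnW W_lt. Qed.
Lemma Wn_lt : W ^ n < 2 ^ l.
Proof. by apply: leq_ltn_trans Wl; rewrite leq_exp2l ?W1. Qed.

Lemma XT_gt0 : 0 < X ^ n.+1 * t ^ n.
Proof. by rewrite muln_gt0 !expn_gt0. Qed.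
Lemma XT_lt : X ^ n.+1 * t ^ n < 2 ^ l.
Proof. by apply: leq_ltn_trans Ml; rewrite leq_pmulr // XT_gt0. Qed.
Lemma Xn_lt : X ^ n.+1 < 2 ^ l.
Proof. by apply: leq_ltn_trans XT_lt; rewrite leq_pmulr // !expn_gt0. Qed.

Lemma tab_lt U B key : tab d D U B key < 2 ^ l.
Proof.
apply: leq_ltn_trans Xn_lt; apply: leq_trans (tab_le _ _ _ _ _) _.
exact: ltnW (weight_sum _ _ _ _).
Qed.

Lemma key_lt B key : key \in bagkeys d D B -> key < W ^ n.
Proof. exact: (bagkeys_lt d2 D_gt0). Qed.

Lemma key_lt_l B key : key \in bagkeys d D B -> key < 2 ^ l.
Proof. by move=> /key_lt h; exact: ltn_trans Wn_lt. Qed.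

Lemma key_sum B key : key \in bagkeys d D B ->
  \sum_(b < n) digit W key b * W ^ b = key.
Proof.
move=> /keys_code[q hq ->]; apply: eq_bigr => b _; rewrite digit_code // => c.
exact: (C_lt (@cand_bounds n d D d2 D_gt0) (@bagcand_cand n d D B) (hq c)).
Qed.

Definition entry := (nat * {set 'I_n} * {set 'I_n})%type.

Fixpoint stack_rep i (stk : seq entry) s : Prop :=
  if stk is (sl, U, B) :: r then
    [/\ ar s aSTK (size r) 0 = sl, sl < i, ar s aBAG sl 0 = bagcode B,
        forall key, ar s aT sl key = tab d D U B key & #|B| <= m.+1]
    /\ stack_rep i r s
  else True.

Lemma stack_rep_ext i i' r s s' : i <= i' ->
  (forall j, j < size r -> ar s' aSTK j 0 = ar s aSTK j 0) ->
  (forall sl, sl < i -> ar s' aBAG sl 0 = ar s aBAG sl 0) ->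
  (forall sl key, sl < i -> ar s' aT sl key = ar s aT sl key) ->
  stack_rep i r s -> stack_rep i' r s'.
Proof.
move=> ii' hS hB hT; elim: r hS => //= -[[sl U] B] r IH hS [[h1 h2 h3 h4 h5] hr].
split; last by apply: IH => // j jr; apply: hS; rewrite ltnS ltnW.
by split=> //; rewrite ?hS ?hB ?(leq_trans h2) // => key; rewrite hT.
Qed.

(** Node [i] writes its table into slot [i]. By [m_new] the slots from [i] on are blank, so a node
    can accumulate sums in its own slot. *)
Record mach i (stk : seq entry) s : Prop := Mach {
  m_sp : rg s vsp = size stk;
  m_stk : stack_rep i stk s;
  m_new : forall j key, i <= j -> ar s aT j key = 0;
  m_size : size stk <= i
}.

Section Node.
Variables (i : nat) (v : 'I_n) (s : store).
Hypotheses (il : i.+1 < 2 ^ l) (ps : params s) (ts : tables s).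
Hypotheses (Ei : rg s vi = i) (Ev : rg s vv = v).

Lemma bagcode_lt (B : {set 'I_n}) : bagcode B < 2 ^ l.
Proof.
apply: leq_ltn_trans Wn_lt; apply: ltnW.
have -> : bagcode B = code W [ffun b => (b \in B) : nat].
  by rewrite /bagcode big_mkcond; apply: eq_bigr => c _; rewrite ffunE; case: ifP; rewrite ?mul1n.
apply: code_lt => // c; rewrite ffunE; apply: leq_ltn_trans (leq_b1 _) _; exact: ltnW.
Qed.

Lemma tri_leaf stk : mach i stk s -> tri s c_leaf (mach i.+1 ((i, [set v], [set v]) :: stk)).
Proof.
move=> ms; rewrite /c_leaf /ePW.
store_at i (d * W ^ v) 1.
- by rewrite evE.
- by rewrite !evE Ev (t_pw ts) (p_d ps).
- by [].
- exact: l1.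
store_at i (d.-1 * W ^ v) 1.
- by rewrite evE.
- by rewrite !evE /= Ev (t_pw ts) (p_d ps) subn1.
- by [].
- exact: l1.
have bE : bagcode [set v] = W ^ v by rewrite /bagcode big_set1.
store_at i 0 (W ^ v).
- by rewrite evE.
- by [].
- by rewrite !evE /= Ev (t_pw ts).
- by rewrite -bE bagcode_lt.
store_at (size stk) 0 i.
- by rewrite evE /= (m_sp ms).
- by [].
- by rewrite evE.
- exact: ltnW.
assign (size stk).+1.
- by rewrite !evE /= (m_sp ms) addn1.
- by apply: leq_ltn_trans il; rewrite ltnS; exact: (m_size ms).
have kne : d.-1 * W ^ v != d * W ^ v.
  by rewrite eqn_pmul2r ?expn_gt0 //; lia.
split=> //=.
- split.
    split; rewrite ?eqxx ?bE ?cards1 //= => key; rewrite tab_leaf (m_new ms) //.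
    by case: (key =P d.-1 * W ^ v) => [->|_]; case: (_ =P d * W ^ v) => // E; rewrite E eqxx in kne.
  apply: stack_rep_ext (m_stk ms) => //= [j jr|sl sli|sl key sli].
  + by rewrite ltn_eqF.
  + by rewrite ltn_eqF.
  + by rewrite ltn_eqF.
- by move=> j key ij; rewrite gtn_eqF // (m_new ms) // ltnW.
- by rewrite ltnS (m_size ms).
Qed.

Section OneChild.
Variables (sl : nat) (U B : {set 'I_n}) (r : seq entry).
Hypotheses (ms : mach i ((sl, U, B) :: r) s) (Esl : rg s vsl = sl) (dom : dom_rep B s).

Lemma sum_prefix (F : nat -> nat) pre key post L : L = rcons pre key ++ post ->
  \sum_(k <- rcons pre key) F k <= \sum_(k <- L) F k.
Proof. by move=> ->; rewrite big_cat leq_addr. Qed.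

Lemma mach_replace U' B' s1 : rg s1 vsp = (size r).+1 ->
  ar s1 aSTK = ar s aSTK -> ar s1 aBAG = ar s aBAG ->
  (forall j key, j != i -> ar s1 aT j key = ar s aT j key) ->
  (forall key, ar s1 aT i key = tab d D U' B' key) -> #|B'| <= m.+1 ->
  mach i.+1 ((i, U', B') :: r) (putr aSTK (size r) 0 i (putr aBAG i 0 (bagcode B') s1)).
Proof.
move=> Esp ES EB ET ET' cB.
have [_] := m_stk ms; rewrite -/(stack_rep i r s) => hr.
split=> //=.
- split; first by split; rewrite ?eqxx.
  apply: stack_rep_ext hr => //= [j jr|sl' sli|sl' key sli].
  + by rewrite ltn_eqF //= ES.
  + by rewrite ltn_eqF //= EB.
  + by rewrite ET // neq_ltn sli.
- move=> j key ij; rewrite ET ?(m_new ms) //; first exact: ltnW.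
  by rewrite neq_ltn ij orbT.
- exact: leq_trans (m_size ms) _.
Qed.

Lemma tri_intro : B \subset U -> v \notin U -> sep d D U B -> #|v |: B| <= m.+1 ->
  tri s c_intro (mach i.+1 ((i, v |: U, v |: B) :: r)).
Proof.
move=> BU vU sUB cB; have vB := intro_notin_bag BU vU.
have [[hS sli hB hT hc]] := m_stk ms; rewrite -/(stack_rep i r s) => hr.
pose F key' key := tab d D U B key *
    ((key' == key + key_dist d D key v * W ^ v) +
     (key' == key + d * W ^ v) * key_flag d D key v).
have FT key' : \sum_(key <- bagkeys d D B) F key' key = tab d D (v |: U) (v |: B) key'.
  by rewrite (tab_intro d2 D_refl D_gt0 D_sym D_tri).
rewrite /c_intro; apply: tri_then.
apply: (@tri_keys B hc (fun pre A => (forall j key, j != i -> A aT j key = ar s aT j key) /\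
   forall key', A aT i key' = \sum_(key <- pre) F key' key)) => //.
- by split=> // key'; rewrite (m_new ms) // big_nil.
- move=> pre key post s1 EL kL Ek fr1 [I1 I2].
  have p1 : params s1 by static.
  have t1 : tables s1 by static.
  have Esl1 : rg s1 vsl = sl by rewrite (proj1 fr1).
  have Ei1 : rg s1 vi = i by rewrite (proj1 fr1).
  have Ev1 : rg s1 vv = v by rewrite (proj1 fr1).
  assign (tab d D U B key).
  + by rewrite !evE Esl1 Ek I1 ?hT // neq_ltn sli.
  + exact: tab_lt.
  assign d.-1.
  + by rewrite !evE /= (p_d p1) subn1.
  + by apply: leq_ltn_trans d_lt; exact: leq_pred.
  assign 1 => //; first exact: l1.
  apply: tri_then.
  apply: (@tri_ord (fun b s' =>
     rg s' vm = \big[minn/d.-1]_(c < n | c < b) (digit W key c + D c v + (1 - digit W key c) * d) /\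
     rg s' vy = [forall c : 'I_n, (c < b) ==> ((0 < digit W key c) ==>
         (d <= digit W key c %% d + D c v))]) n) => //.
  + exact: ltnW.
  + by rewrite /= (p_n p1).
  + split; first by rewrite big_pred0.
    by have -> : [forall c : 'I_n, (c < 0) ==> ((0 < digit W key c) ==>
         (d <= digit W key c %% d + D c v))] by apply/forallP.
  + move=> b s2 Eb fr2 [J1 J2].
    have p2 : params s2 by static.
    have t2 : tables s2 by static.
    have Ek2 : rg s2 vkey = key by rewrite (proj1 fr2).
    have Ev2 : rg s2 vv = v by rewrite (proj1 fr2).
    assign (digit W key b).
    * by rewrite /eDig /ePW !evE Ek2 Eb (t_pw t2) (p_W p2).
    * exact: ltn_trans (dig_lt _ _) W_lt.
    assign (minn (rg s2 vm)
      (digit W key b + D b v + (1 - digit W key b) * d)).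
    * by rewrite /eDist !evE /= Eb Ev2 (p_n p2) (p_d p2) (t_D t2).
    * rewrite J1; apply: leq_ltn_trans (geq_minl _ _) _.
      by apply: leq_ltn_trans (bigminn_le_idx _ _ _ _) _; apply: leq_ltn_trans d_lt; exact: leq_pred.
    assign ([forall c : 'I_n, (c < b.+1) ==> ((0 < digit W key c) ==>
         (d <= digit W key c %% d + D c v))]).
    * rewrite /eDist !evE /= Eb Ev2 (p_n p2) (p_d p2) (t_D t2) J2 forall_step.
      case: [forall c, _] => //=; rewrite mul1n.
      case: (posnP (digit W key b)) => [->|z0] //=.
      case: leqP => h; first by move/eqP: h => ->; rewrite muln0.
      by apply/eqP; rewrite subn_eq0 muln_gt0 z0 subn_gt0.
    * by apply: leq_ltn_trans l1; exact: leq_b1.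
    by split=> //=; rewrite bigminn_step J1.
  move=> s2 fr2 [J1 J2].
  have {}J1 : rg s2 vm = key_dist d D key v.
    by rewrite J1 /key_dist; apply: eq_bigl => c; rewrite ltn_ord.
  have {}J2 : rg s2 vy = key_flag d D key v.
    rewrite J2 /key_flag; congr nat_of_bool; apply: eq_forallb => c; by rewrite ltn_ord.
  have Ek2 : rg s2 vkey = key by rewrite (proj1 fr2).
  have Ev2 : rg s2 vv = v by rewrite (proj1 fr2).
  have Ei2 : rg s2 vi = i by rewrite (proj1 fr2).
  have Ed2 : rg s2 vd = d by rewrite (proj1 fr2) //= (p_d p1).
  have Eval : rg s2 vval = tab d D U B key by rewrite (proj1 fr2).
  have Epw : ar s2 aPW v 0 = W ^ v by rewrite (proj2 fr2) //= (t_pw t1).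
  have AT j k : ar s2 aT j k = ar s1 aT j k by rewrite (proj2 fr2).
  set k1 := key + key_dist d D key v * W ^ v.
  set k2 := key + d * W ^ v.
  (* The distance state is at most [d - 1], whereas a member has digit [d]: the two updates hit
     different cells. *)
  have k12 : (k2 == k1) = false.
    rewrite /k1 /k2 eqn_add2l eqn_pmul2r ?expn_gt0 //.
    have : key_dist d D key v <= d.-1 := bigminn_le_idx _ _ _ _; lia.
  (* A partial sum never exceeds the finished entry, which is known to fit in [l] bits. *)
  have bound key' : \sum_(k <- pre) F key' k + F key' key < 2 ^ l.
    apply: leq_ltn_trans (tab_lt (v |: U) (v |: B) key').
    by rewrite -FT -big_rcons -/(_ <= _) ; exact: sum_prefix EL.
  store_at i k1 (ar s1 aT i k1 + tab d D U B key).
  + by rewrite !evE.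
  + by rewrite /ePW !evE Ek2 J1 Ev2 Epw.
  + by rewrite /ePW !evE Ei2 Ek2 J1 Ev2 Epw AT Eval.
  + rewrite I2; apply: leq_ltn_trans (bound k1); rewrite leq_add2l /F -/k1 -/k2 eqxx.
    by rewrite mulnDr muln1 leq_addr.
  store_at i k2 (ar s1 aT i k2 + tab d D U B key * key_flag d D key v).
  + by rewrite !evE.
  + by rewrite /ePW !evE /= Ek2 Ed2 Ev2 Epw.
  + by rewrite /ePW !evE /= Ei2 Ek2 Ed2 Ev2 Epw Eval J2 k12 andbF AT.
  + rewrite I2; apply: leq_ltn_trans (bound k2); rewrite leq_add2l /F -/k1 -/k2 eqxx k12.
    by rewrite mul1n add0n.
  split=> [j k ji|key'].
    by rewrite /= (negPf ji) /= AT I1.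
  have EF : F key' key = tab d D U B key * ((key' == k1) + (key' == k2) * key_flag d D key v) by [].
  rewrite /= eqxx /= big_rcons /= AT !I2 EF.
  case: (key' =P k2) => [->|_]; first by rewrite k12 mul1n add0n.
  by case: (key' =P k1) => [->|_]; rewrite ?addn0 ?muln1 ?muln0 ?addn0.
move=> s1 fr1 [I1 I2].
have t1 : tables s1 by static.
have Esl1 : rg s1 vsl = sl by rewrite (proj1 fr1).
have Ei1 : rg s1 vi = i by rewrite (proj1 fr1).
have Ev1 : rg s1 vv = v by rewrite (proj1 fr1).
have Esp1 : rg s1 vsp = (size r).+1 by rewrite (proj1 fr1) // (m_sp ms).
store_at i 0 (bagcode (v |: B)) => //.
- rewrite /ePW !evE Esl1 Ev1 (t_pw t1) (proj2 fr1) // hB.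
  by rewrite /bagcode big_setU1 //= addnC.
- exact: bagcode_lt.
store_at (size r) 0 i => //.
- by rewrite !evE /= Esp1 subn1.
- exact: ltnW.
by apply: mach_replace => // [||key]; [rewrite (proj2 fr1) | rewrite (proj2 fr1) | rewrite I2 FT].
Qed.

Lemma tri_forget : tri s c_forget (mach i.+1 ((i, U, B :\ v) :: r)).
Proof.
have [[hS sli hB hT hc]] := m_stk ms; rewrite -/(stack_rep i r s) => hr.
pose F key' key := tab d D U B key *
    ((key' == key_forget d D key v) * (if digit W key v == d then X else 1)).
have FT key' : \sum_(key <- bagkeys d D B) F key' key = tab d D U (B :\ v) key'.
  by rewrite (tab_forget d2 D_refl D_gt0 D_sym).
rewrite /c_forget; apply: tri_then.
apply: (@tri_keys B hc (fun pre A => (forall j key, j != i -> A aT j key = ar s aT j key) /\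
   forall key', A aT i key' = \sum_(key <- pre) F key' key)) => //.
- by split=> // key'; rewrite (m_new ms) // big_nil.
- move=> pre key post s1 EL kL Ek fr1 [I1 I2].
  have p1 : params s1 by static.
  have t1 : tables s1 by static.
  have Esl1 : rg s1 vsl = sl by rewrite (proj1 fr1).
  have Ei1 : rg s1 vi = i by rewrite (proj1 fr1).
  have Ev1 : rg s1 vv = v by rewrite (proj1 fr1).
  assign (tab d D U B key).
  + by rewrite !evE Esl1 Ek I1 ?hT // neq_ltn sli.
  + exact: tab_lt.
  pose y := digit W key v == d.
  assign y.
  + by rewrite /eDig /ePW !evE /= Ek Ev1 (t_pw t1) (p_W p1) (p_d p1).
  + by apply: leq_ltn_trans l1; exact: leq_b1.
  assign 0 => //; first exact: ltnW l1.
  apply: tri_then.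
  pose f c := forget_digit d D v y c (digit W key c) * W ^ c.
  (* Forgetting never raises a digit, so the new key stays at most [key] while it is being
     assembled. *)
  have fs (P : pred 'I_n) : \sum_(c < n | P c) f c < 2 ^ l.
    apply: leq_ltn_trans (key_lt_l kL); rewrite -[leqRHS](key_sum kL) big_mkcond /=.
    apply: leq_sum => c _; case: ifP => // _; rewrite /f leq_mul2r.
    by rewrite geq_minl orbT.
  apply: (@tri_ord (fun b s' => rg s' vp = \sum_(c < n | c < b) f c) n) => //.
  + exact: ltnW.
  + by rewrite /= (p_n p1).
  + by rewrite big_pred0.
  + move=> b s2 Eb fr2 J.
    have p2 : params s2 by static.
    have t2 : tables s2 by static.
    have Ek2 : rg s2 vkey = key by rewrite (proj1 fr2).
    have Ev2 : rg s2 vv = v by rewrite (proj1 fr2).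
    have Ey2 : rg s2 vy = y by rewrite (proj1 fr2).
    assign (digit W key b).
    * by rewrite /eDig /ePW !evE Ek2 Eb (t_pw t2) (p_W p2).
    * exact: ltn_trans (dig_lt _ _) W_lt.
    assign (\sum_(c < n | c < b.+1) f c) => //.
    by rewrite sum_step /eDist /ePW !evE /= Eb Ev2 Ey2 (p_n p2) (p_d p2) (t_D t2) (t_pw t2) J.
  move=> s2 fr2 J.
  have {}J : rg s2 vp = key_forget d D key v.
    by rewrite J /key_forget; apply: eq_bigl => c; rewrite ltn_ord.
  have Ei2 : rg s2 vi = i by rewrite (proj1 fr2).
  have Ey2 : rg s2 vy = y by rewrite (proj1 fr2).
  have EX2 : rg s2 vX = X by rewrite (proj1 fr2) //= (p_X p1).
  have Eval : rg s2 vval = tab d D U B key by rewrite (proj1 fr2).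
  have AT j k : ar s2 aT j k = ar s1 aT j k by rewrite (proj2 fr2).
  set k1 := key_forget d D key v in J.
  store_at i k1 (ar s1 aT i k1 + F k1 key).
  + by rewrite evE.
  + by rewrite evE.
  + rewrite !evE Ei2 J Eval Ey2 EX2 AT /F -/k1 eqxx mul1n /y.
    by case: (digit W key v == d); rewrite ?mul1n ?mul0n ?addn0 // subnKC // expn_gt0.
  + rewrite I2; apply: leq_ltn_trans (tab_lt U (B :\ v) k1).
    by rewrite -FT -big_rcons; exact: sum_prefix EL.
  split=> [j k ji|key'].
    by rewrite /= (negPf ji) /= AT I1.
  rewrite /= eqxx /= big_rcons /= AT !I2.
  case: (key' =P k1) => [->|ne] //.
  by rewrite /F -/k1; case: eqP => //; rewrite mul0n muln0 addn0.
move=> s1 fr1 [I1 I2].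
have p1 : params s1 by static.
have t1 : tables s1 by static.
have Esl1 : rg s1 vsl = sl by rewrite (proj1 fr1).
have Ei1 : rg s1 vi = i by rewrite (proj1 fr1).
have Ev1 : rg s1 vv = v by rewrite (proj1 fr1).
have Esp1 : rg s1 vsp = (size r).+1 by rewrite (proj1 fr1) // (m_sp ms).
store_at i 0 (bagcode (B :\ v)) => //.
- rewrite /eDig /ePW !evE Esl1 Ev1 (t_pw t1) (p_W p1) (proj2 fr1) // hB.
  rewrite -/(digit W _ v) digit_bagcode; case: (boolP (v \in B)) => vB.
    by rewrite /bagcode [in LHS](big_setD1 v) //= mul1n addKn.
  have -> : B :\ v = B by apply/setDidPl; rewrite disjoint_sym disjoints1.
  by rewrite mul0n subn0.
- exact: bagcode_lt.
store_at (size r) 0 i => //.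
- by rewrite !evE /= Esp1 subn1.
- exact: ltnW.
apply: mach_replace => // [||key|]; first by rewrite (proj2 fr1).
- by rewrite (proj2 fr1).
- by rewrite I2 FT.
by apply: leq_trans hc; rewrite subset_leq_card ?subsetDl.
Qed.

End OneChild.

Section TwoChildren.
Variables (sa sb : nat) (U1 U2 B : {set 'I_n}) (r : seq entry).
Hypotheses (ms : mach i ((sb, U2, B) :: (sa, U1, B) :: r) s).
Hypotheses (Esl : rg s vsl = sb) (dom : dom_rep B s).
Hypotheses (UB : U1 :&: U2 = B) (sU : sep d D U1 B) (Bm : #|B| <= m.+1).
Notation L := (bagkeys d D B).
Notation cz := (collision_weight d t).
Notation thr := (threshold d).

Lemma ev_cz s' z : rg s' vt = t -> rg s' vd = d -> rg s' vz = z -> ev I s' e_cz = cz z.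
Proof.
move=> Et Ed Ez; rewrite /e_cz !evE Et Ed Ez /collision_weight /low.
have t0 : 0 < t by rewrite !expn_gt0.
case: (posnP z) => [->|z0] /=; first by rewrite mul0n minn0 muln0.
case: ltnP => h /=.
  by rewrite (minn_idPl _) ?muln1 ?subnKC // muln_gt0 z0 subn_gt0.
by have /eqP -> : d - 2 * z == 0 by []; rewrite muln0 minn0 muln0.
Qed.

Lemma ev_thr s' z : rg s' vd = d -> rg s' vz = z -> ev I s' e_thr = thr z.
Proof. by move=> Ed Ez; rewrite /e_thr !evE Ed Ez /threshold; lia. Qed.

Lemma t_le_XT : 0 < n -> t <= X ^ n.+1 * t ^ n.
Proof.
move=> n0; have t0 : 0 < t by rewrite !expn_gt0.
apply: (@leq_trans (t ^ n)); first by rewrite -{1}[t]expn1 leq_pexp2l.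
by rewrite leq_pmull // !expn_gt0.
Qed.

Lemma cz_lt z : cz z < 2 ^ l.
Proof.
have n0 : 0 < n by case: (n) v => [[]|].
rewrite /collision_weight; case: ifP => _; last exact: l1.
exact: leq_ltn_trans (t_le_XT n0) XT_lt.
Qed.

Lemma thr_lt z : z <= d -> thr z < 2 ^ l.
Proof. by move=> h; apply: leq_ltn_trans W_lt; rewrite /threshold; lia. Qed.

Notation fw U := (fwd d t cand (tab d D U B)).
Notation fw1 := (fw U1).
Notation fw2 := (fw U2).
Notation bw := (bwd d t cand (fun key => fw1 n key * fw2 n key)).

Lemma fwd_lt U b key : b <= n -> key \in L -> fw U b key < 2 ^ l.
Proof.
move=> bn kL; apply: leq_ltn_trans XT_lt; exact: (fwd_le d2 D_refl D_gt0 D_sym).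
Qed.

Lemma bw_lt b key : key \in L -> bw b key < 2 ^ l.
Proof.
move=> kL; apply: leq_ltn_trans (bwd_le _ _ _ _ _) _; apply: leq_ltn_trans Ml.
by rewrite leq_mul // (fwd_le d2 D_refl D_gt0 D_sym).
Qed.

Lemma digit_key_le key (b : 'I_n) : digit W key b <= d.
Proof. by rewrite -ltnS dig_lt. Qed.

Lemma key_move_lt key (b : 'I_n) x : key \in L -> x <= d ->
  key + x * W ^ b - digit W key b * W ^ b < 2 ^ l.
Proof.
move=> kL xd; apply: leq_ltn_trans (leq_subr _ _) _; apply: leq_ltn_trans Wl.
rewrite expnS mulSn leq_add //; first by rewrite ltnW // (key_lt kL).
by rewrite leq_mul // leq_exp2l ?W1 // ltnW.
Qed.

Lemma key_in_move key (b : 'I_n) x : key \in L -> x \in cand b ->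
  high d (digit W key b) x -> key + x * W ^ b - digit W key b * W ^ b \in L.
Proof.
move=> kL xc hx.
apply: (@key_step n d cand (bagcand d D B) (@cand_bounds n d D d2 D_gt0)
  (@bagcand_cand n d D B)) => //.
have [q hq Eq] := keys_code kL.
have qW c : q c < W.
  exact: (C_lt (@cand_bounds n d D d2 D_gt0) (@bagcand_cand n d D B) (hq c)).
have zq : digit W key b = q b by rewrite Eq digit_code.
by rewrite zq in hx; rewrite (high_cand d2 (t_gt0 n) (@bagcand_cand n d D B) (hq b) hx).
Qed.

Lemma cand_le (b : 'I_n) x : x \in cand b -> x <= d.
Proof. by move=> /(@cand_bounds n d D d2 D_gt0) /andP[]. Qed.

Lemma size_cand_le (b : 'I_n) : size (cand b) <= n.+1.
Proof. by rewrite candE (leq_trans (size_cands _ _ _ _)) // size_enum_ord. Qed.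

Lemma tri_forward s0 Q : params s0 -> tables s0 -> dom_rep B s0 ->
  (forall key, key \in L -> ar s0 aF 0 key = tab d D U1 B key) ->
  (forall key, key \in L -> ar s0 aG 0 key = tab d D U2 B key) ->
  (forall s', frame (wr c_forward) (wa c_forward) s0 s' ->
     (forall key, key \in L -> ar s' aF n key = fw1 n key) ->
     (forall key, key \in L -> ar s' aG n key = fw2 n key) -> Q s') ->
  tri s0 c_forward Q.
Proof.
move=> p0 t0 dm0 F0 G0 HQ.
suff H : tri s0 c_forward (fun s' => forall key, key \in L ->
    ar s' aF n key = fw1 n key /\ ar s' aG n key = fw2 n key).
  apply: tri_weaken (tri_frame H) _ => s' [h1 h2]; apply: HQ => // key kL; by case: (h1 key kL).
apply: (@tri_ord (fun b s' => forall key, key \in L ->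
    ar s' aF b key = fw1 b key /\ ar s' aG b key = fw2 b key) n) => //.
- exact: ltnW.
- exact: p_n.
- by move=> key kL; rewrite /= F0 // G0.
move=> b s1 Eb fr1 I1.
have p1 : params s1 by static.
have dm1 : dom_rep B s1 := dom_rep_frame fr1 isT isT dm0.
apply: (@tri_keys B Bm (fun pre A =>
   (forall key, key \in L -> A aF b key = fw1 b key /\ A aG b key = fw2 b key) /\
   (forall key, key \in pre -> A aF b.+1 key = fw1 b.+1 key /\ A aG b.+1 key = fw2 b.+1 key))) => //.
- move=> pre key post s2 EL kL Ek fr2 [J1 J2].
  have p2 : params s2 by static.
  have t2 : tables s2 by static.
  have Eb2 : rg s2 vb = b by rewrite (proj1 fr2).
  set z := digit W key b.
  have [f1 f2] := J1 _ kL.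
  assign z.
  + by rewrite /eDig /ePW !evE Ek Eb2 (t_pw t2) (p_W p2).
  + exact: ltn_trans (dig_lt _ _) W_lt.
  assign (cz z).
  + by apply: ev_cz => //=; [exact: p_t | exact: p_d].
  + exact: cz_lt.
  assign (thr z).
  + by apply: ev_thr => //=; exact: p_d.
  + exact/thr_lt/digit_key_le.
  pose part U j := cz z * fw U b key + \sum_(x <- take j (cand b))
    high d z x * fw U b (key + x * W ^ b - z * W ^ b).
  (* All summands are nonnegative, so a partial sum is at most the full transform at [b.+1]. *)
  have part_lt U j : part U j < 2 ^ l.
    apply: leq_ltn_trans (@fwd_lt U b.+1 key (ltn_ord b) kL).
    rewrite [leqRHS]/= -/z leq_add2l.
    by rewrite -[in leqRHS](cat_take_drop j (cand b)) big_cat leq_addr.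
  have part0 U : part U 0 = cz z * fw U b key by rewrite /part take0 big_nil addn0.
  assign (part U1 0).
  + by rewrite !evE /= Eb2 Ek f1 part0.
  + exact: part_lt.
  assign (part U2 0).
  + by rewrite !evE /= Eb2 Ek f2 part0.
  + exact: part_lt.
  apply: tri_then.
  apply: (@tri_for_eq (fun j s' => rg s' vf = part U1 j /\ rg s' vg = part U2 j)
    (size (cand b))) => //.
  + by rewrite !evE /= Eb2 (t_cc t2).
  + exact: leq_trans (size_cand_le b) Yn.
  + move=> j s3 jC Ej fr3 [K1 K2].
    have p3 : params s3 by static.
    have t3 : tables s3 by static.
    have Eb3 : rg s3 vb = b by rewrite (proj1 fr3).
    have Ek3 : rg s3 vkey = key by rewrite (proj1 fr3).
    have Ez3 : rg s3 vz = z by rewrite (proj1 fr3).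
    have Ey3 : rg s3 vy = thr z by rewrite (proj1 fr3).
    have AF : ar s3 aF = ar s2 aF by rewrite (proj2 fr3).
    have AG : ar s3 aG = ar s2 aG by rewrite (proj2 fr3).
    set x := nth 0 (cand b) j.
    have xc : x \in cand b by exact: mem_nth.
    have xd : x <= d by exact: cand_le xc.
    assign x.
    * by rewrite !evE Eb3 Ej (t_ca t3).
    * exact: leq_ltn_trans xd d_lt.
    assign (high d z x).
    * by rewrite !evE /= Ey3 (p_d p3) /high mulnb.
    * by apply: leq_ltn_trans l1; exact: leq_b1.
    set key' := key + x * W ^ b - z * W ^ b.
    assign key'.
    * by rewrite /ePW !evE /= Eb3 Ek3 Ez3 (t_pw t3).
    * exact: key_move_lt.
    (* For an incompatible [x] the key [key'] may point to a cell that is stale or unset; its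
       content is multiplied by 0. *)
    have partS U g : (forall key, key \in L -> g key = fw U b key) ->
      part U j + high d z x * g key' = part U j.+1.
      move=> hg; rewrite /part (take_nth 0) // -/x big_rcons /= -/key' addnA.
      by case hx : (high d z x); rewrite ?mul0n // !mul1n hg //; exact: key_in_move.
    assign (part U1 j.+1).
    * rewrite !evE /= Eb3 K1 AF; apply: partS => k' /J1; by case.
    * exact: part_lt.
    assign (part U2 j.+1).
    * rewrite !evE /= Eb3 K2 AG; apply: partS => k' /J1; by case.
    * exact: part_lt.
    by [].
  move=> s3 fr3 [K1 K2].
  rewrite /part take_size in K1 K2.
  have Eb3 : rg s3 vb = b by rewrite (proj1 fr3).
  have Ek3 : rg s3 vkey = key by rewrite (proj1 fr3).
  have AF : ar s3 aF = ar s2 aF by rewrite (proj2 fr3).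
  have AG : ar s3 aG = ar s2 aG by rewrite (proj2 fr3).
  store_at b.+1 key (fw1 b.+1 key).
  + by rewrite !evE Eb3 addn1.
  + by rewrite !evE.
  + by rewrite !evE K1.
  + exact: fwd_lt.
  store_at b.+1 key (fw2 b.+1 key).
  + by rewrite !evE /= Eb3 addn1.
  + by rewrite !evE.
  + by rewrite !evE /= K2.
  + exact: fwd_lt.
  split=> key' kL'.
    by rewrite /= ltn_eqF //= AF AG; exact: J1.
  rewrite /= !eqxx /= AF AG; case: (key' =P key) => [->|ne] //.
  by apply: J2; move: kL'; rewrite mem_rcons inE => /orP[/eqP|].
by move=> s2 fr2 [_ J2].
Qed.

Lemma bigminn_rcons e (P : pred nat) q y :
  \big[minn/e]_(x <- rcons q y | P x) x =
  minn (\big[minn/e]_(x <- q | P x) x) (if P y then y else e).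
Proof.
elim: q => [|x q IH] /=.
  by rewrite big_cons !big_nil; case: ifP; rewrite ?minnn // minnC.
by rewrite !big_cons IH; case: ifP => _; rewrite ?minnA.
Qed.

Lemma tri_backward s0 Q : params s0 -> tables s0 -> dom_rep B s0 ->
  (forall key, key \in L -> ar s0 aH 0 key = fw1 n key * fw2 n key) ->
  (forall s', frame (wr c_backward) (wa c_backward) s0 s' ->
     (forall key, key \in L -> ar s' aH n key = bw n key) -> Q s') ->
  tri s0 c_backward Q.
Proof.
move=> p0 t0 dm0 H0 HQ.
suff H : tri s0 c_backward (fun s' => forall key, key \in L -> ar s' aH n key = bw n key).
  by apply: tri_weaken (tri_frame H) _ => s' [h1 h2]; exact: HQ.
apply: (@tri_ord (fun b s' => forall key, key \in L -> ar s' aH b key = bw b key) n) => //.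
- exact: ltnW.
- exact: p_n.
move=> b s1 Eb fr1 I1.
have p1 : params s1 by static.
have dm1 : dom_rep B s1 := dom_rep_frame fr1 isT isT dm0.
apply: (@tri_keys B Bm (fun pre A =>
   (forall key, key \in L -> A aH b key = bw b key) /\
   (forall key, key \in pre -> A aH b.+1 key = bw b.+1 key))) => //.
- move=> pre key post s2 EL kL Ek fr2 [J1 J2].
  have p2 : params s2 by static.
  have t2 : tables s2 by static.
  have Eb2 : rg s2 vb = b by rewrite (proj1 fr2).
  set z := digit W key b.
  assign z.
  + by rewrite /eDig /ePW !evE Ek Eb2 (t_pw t2) (p_W p2).
  + exact: ltn_trans (dig_lt _ _) W_lt.
  assign (cz z).
  + by apply: ev_cz => //=; [exact: p_t | exact: p_d].
  + exact: cz_lt.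
  assign (thr z).
  + by apply: ev_thr => //=; exact: p_d.
  + exact/thr_lt/digit_key_le.
  assign d.
  + by rewrite !evE /= (p_d p2).
  + exact: d_lt.
  apply: tri_then.
  apply: (@tri_for_eq (fun j s' =>
     rg s' vp = \big[minn/d]_(x <- take j (cand b) | thr z <= x) x)
    (size (cand b))) => //.
  + by rewrite !evE /= Eb2 (t_cc t2).
  + exact: leq_trans (size_cand_le b) Yn.
  + by rewrite take0 big_nil.
  + move=> j s3 jC Ej fr3 K1.
    have p3 : params s3 by static.
    have t3 : tables s3 by static.
    have Eb3 : rg s3 vb = b by rewrite (proj1 fr3).
    have Ey3 : rg s3 vy = thr z by rewrite (proj1 fr3).
    set x := nth 0 (cand b) j.
    have xc : x \in cand b by exact: mem_nth.
    have xd : x <= d by exact: cand_le xc.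
    assign x.
    * by rewrite !evE Eb3 Ej (t_ca t3).
    * exact: leq_ltn_trans xd d_lt.
    have pd : rg s3 vp <= d by rewrite K1; exact: bigminn_le_idx.
    assign (minn (rg s3 vp) (if thr z <= x then x else d)).
    * rewrite !evE /= Ey3 (p_d p3); case: leqP => h; first by rewrite mul0n addn0.
      by rewrite mul1n (minn_idPl pd) (minn_idPl _) // (leq_trans pd) // leq_addl.
    * by apply: leq_ltn_trans (geq_minl _ _) _; exact: leq_ltn_trans pd d_lt.
    by rewrite /= (take_nth 0) // -/x bigminn_rcons K1.
  move=> s3 fr3 K1; rewrite take_size -/(nxt d cand b z) in K1.
  set p := nxt _ _ _ _ in K1.
  have p3 : params s3 by static.
  have t3 : tables s3 by static.
  have Eb3 : rg s3 vb = b by rewrite (proj1 fr3).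
  have Ek3 : rg s3 vkey = key by rewrite (proj1 fr3).
  have Ez3 : rg s3 vz = z by rewrite (proj1 fr3).
  have Ex3 : rg s3 vx = cz z by rewrite (proj1 fr3).
  have AH : ar s3 aH = ar s2 aH by rewrite (proj2 fr3).
  assign (key + p * W ^ b - z * W ^ b).
  + by rewrite /ePW !evE Eb3 Ek3 Ez3 K1 (t_pw t3).
  + by apply: key_move_lt => //; exact: bigminn_le_idx.
  store_at b.+1 key (bw b.+1 key).
  + by rewrite !evE /= Eb3 addn1.
  + by rewrite !evE.
  + rewrite !evE /= -/z -/p Eb3 Ek3 K1 (p_d p3) Ex3 AH J1 //.
    (* If [p = d] there is no next candidate, and whatever was read at the moved key is multiplied
       by 0. *)
    case: (ltnP p d) => pd; rewrite ?mul0n // !mul1n J1 //.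
    have [x [xc tx Ex]] := bigminn_attained pd.
    have Epx : p = x by [].
    by rewrite Epx; apply: key_in_move => //; rewrite /high tx -Epx.
  + exact: bw_lt.
  split=> key' kL'.
    by rewrite /= ltn_eqF //= AH; exact: J1.
  rewrite /= eqxx /= AH; case: (key' =P key) => [->|ne] //.
  by apply: J2; move: kL'; rewrite mem_rcons inE => /orP[/eqP|].
by move=> s2 fr2 [_ J2].
Qed.

Lemma tri_join : tri s c_join (mach i.+1 ((i, U1 :|: U2, B) :: r)).
Proof.
have [[hS sbi hB hT hc] [[hS' sai hB' hT' _]]] := m_stk ms.
rewrite -/(stack_rep i r s) => hr.
have Esp : rg s vsp = (size r).+2 := m_sp ms.
rewrite /c_join; assign sa.
- by rewrite !evE Esp subn2 /= hS'.
- by apply: ltn_trans sai _; exact: ltnW.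
set s1 := setr _ _ s.
have dm1 : dom_rep B s1 := dom.
have p1 : params s1 by static.
apply: tri_then.
apply: (@tri_keys B Bm (fun pre A => forall key, key \in pre ->
   A aF 0 key = tab d D U1 B key /\ A aG 0 key = tab d D U2 B key)) => //.
- move=> pre key post s2 EL kL Ek fr2 J.
  have Ea2 : rg s2 vsb = sa by rewrite (proj1 fr2).
  have Eb2 : rg s2 vsl = sb by rewrite (proj1 fr2).
  have AT : ar s2 aT = ar s aT by rewrite (proj2 fr2).
  store_at 0 key (tab d D U1 B key) => //.
  + by rewrite !evE Ek Ea2 AT hT'.
  + exact: tab_lt.
  store_at 0 key (tab d D U2 B key) => //.
  + by rewrite !evE /= Ek Eb2 AT hT.
  + exact: tab_lt.
  move=> key'; rewrite mem_rcons inE /=; case: (key' =P key) => [->|_] //=; exact: J.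
move=> s2 fr2 J2.
have p2 : params s2 by static.
have t2 : tables s2 by static.
have dm2 : dom_rep B s2 := dom_rep_frame fr2 isT isT dm1.
apply: tri_then; apply: tri_forward => //.
- by move=> key /J2[].
- by move=> key /J2[].
move=> s3 fr3 F3 G3.
have p3 : params s3 by static.
have dm3 : dom_rep B s3 := dom_rep_frame fr3 isT isT dm2.
apply: tri_then.
apply: (@tri_keys B Bm (fun pre A => (forall key, key \in L -> A aF n key = fw1 n key) /\
   (forall key, key \in L -> A aG n key = fw2 n key) /\
   (forall key, key \in pre -> A aH 0 key = fw1 n key * fw2 n key))) => //.
- move=> pre key post s4 EL kL Ek fr4 [K1 [K2 K3]].
  have p4 : params s4 by static.
  store_at 0 key (fw1 n key * fw2 n key) => //.
  + by rewrite !evE Ek (p_n p4) K1 // K2.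
  + exact: (@bw_lt 0).
  split=> //; split=> // key'; rewrite mem_rcons inE /=; case: (key' =P key) => [->|_] //=.
  exact: K3.
move=> s4 fr4 [_ [_ H4]].
have p4 : params s4 by static.
have t4 : tables s4 by static.
have dm4 : dom_rep B s4 := dom_rep_frame fr4 isT isT dm3.
apply: tri_then; apply: tri_backward => //.
move=> s5 fr5 H5.
have p5 : params s5 by static.
have t5 : tables s5 by static.
have dm5 : dom_rep B s5 := dom_rep_frame fr5 isT isT dm4.
have fr25 := frame_trans fr2 (frame_trans fr3 (frame_trans fr4 fr5)).
apply: tri_then.
apply: (@tri_keys B Bm (fun pre A =>
   (forall key, key \in L -> A aH n key = bw n key) /\
   (forall j key, A aT j key = if (j == i) && (key \in pre) then tab d D (U1 :|: U2) B key
      else ar s aT j key))) => //.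
- by split=> // j key; rewrite andbF (proj2 fr25).
- move=> pre key post s6 EL kL Ek fr6 [K1 K2].
  have p6 : params s6 by static.
  store_at i key (tab d D (U1 :|: U2) B key) => //.
  + by rewrite evE (proj1 fr6) // (proj1 fr25).
  + rewrite !evE Ek (p_n p6) (p_t p6) K1 //.
    exact: (tab_join d2 D_refl D_gt0 D_sym D_tri).
  + exact: tab_lt.
  split=> // j key'; rewrite mem_rcons inE /=.
  case: (j =P i) => [->|/eqP/negPf ne] /=; last by rewrite K2 ne.
  case: (key' =P key) => [->|_] //=; by rewrite K2 eqxx.
move=> s6 fr6 [_ K2].
have fr26 := frame_trans fr25 fr6.
store_at i 0 (bagcode B) => //.
- by rewrite evE (proj1 fr26).
- by rewrite !evE (proj1 fr26) // (proj2 fr26) //= Esl hB.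
- exact: bagcode_lt.
assign (size r).+1.
- by rewrite !evE /= (proj1 fr26) //= Esp subn1.
- apply: ltn_trans il; apply: leq_trans (m_size ms) _; exact: leqnSn.
store_at (size r) 0 i => //.
- by rewrite !evE /= subn1.
- by rewrite evE /= (proj1 fr26).
- exact: ltnW.
split=> //=.
- split.
    (* Keys that are not keys of the bag are never written: the slot was blank there, and their
       entry is 0. *)
    split; rewrite ?eqxx //= => key; rewrite K2 eqxx /=; case: ifPn => // kL.
    by rewrite (m_new ms) // (tab_notin d2 D_refl D_gt0 D_sym).
  apply: stack_rep_ext hr => //= [j jr|sl' sli'|sl' key sli'].
  + by rewrite ltn_eqF //= (proj2 fr26).
  + by rewrite ltn_eqF //= (proj2 fr26).
  + by rewrite K2 ltn_eqF.
- by move=> j key ij; rewrite K2 gtn_eqF // (m_new ms) // ltnW.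
- by have := m_size ms => /=; lia.
Qed.

End TwoChildren.
End Node.
End Static.
End Verify.

(** * Correctness of the precomputed powers, distances and candidates *)

Section Setup.
Variables (I : seq nat) (l : nat) (bnd : bool -> nat).
Notation tri := (tri I l bnd).
Variables (n d : nat) (G : wgraph n).
Notation D := (dcap G d).
Notation W := d.+1.
Notation X := (2 ^ n.+1).
Notation t := (X ^ (2 * n.+1)).
Notation params := (params n d).
Hypothesis n0 : 0 < n.
Hypothesis d0 : 0 < d.
Hypothesis Yn : n.+1 <= bnd false.
Hypothesis bndl : forall b, bnd b < 2 ^ l.
Hypothesis Wl : W ^ n.+1 < 2 ^ l.
Hypothesis Il : forall j, nth 0 I j < 2 ^ l.
Hypothesis IG : forall u v : 'I_n,
  nth 0 I (3 + u * n + v) = if adj G u v then weight G u v else 0.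

Lemma n_lt' : n.+1 < 2 ^ l. Proof. exact: leq_ltn_trans Yn (bndl false). Qed.
Lemma one_lt : 1 < 2 ^ l. Proof. exact: leq_ltn_trans n_lt'. Qed.
Lemma Wp_lt b : b <= n.+1 -> W ^ b < 2 ^ l.
Proof. by move=> h; apply: leq_ltn_trans Wl; rewrite leq_pexp2l. Qed.
Lemma d_lt' : d < 2 ^ l.
Proof. by have := @Wp_lt 1 isT; rewrite expn1 => /ltnW. Qed.

Lemma tri_pw s Q : params s ->
  (forall s', frame (wr c_pw) (wa c_pw) s s' -> (forall b : 'I_n, ar s' aPW b 0 = W ^ b) -> Q s') ->
  tri s c_pw Q.
Proof.
move=> ps HQ.
suff H : tri s c_pw (fun s' => forall b : 'I_n, ar s' aPW b 0 = W ^ b).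
  by apply: tri_weaken (tri_frame H) _ => s' [h1 h2]; exact: HQ.
assign 1 => //; first exact: one_lt.
apply: (@tri_ord _ _ _ (fun b s' => rg s' vx = W ^ b /\ forall c, c < b -> ar s' aPW c 0 = W ^ c) n) => //.
- exact: ltnW.
- by rewrite /= (p_n ps).
- move=> b s1 Eb fr [J1 J2].
  have EW : rg s1 vW = W by rewrite (proj1 fr) //= (p_W ps).
  store_at b 0 (W ^ b).
  + by rewrite evE.
  + by [].
  + by rewrite evE.
  + by apply: Wp_lt; rewrite ltnW // ltnS ltnW.
  assign (W ^ b.+1).
  + by rewrite !evE /= J1 EW expnSr.
  + by apply: Wp_lt; rewrite ltnS ltnW.
  split=> //= c; rewrite ltnS leq_eqVlt => /orP[/eqP->|cb]; first by rewrite eqxx.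
  by rewrite ltn_eqF //= J2.
by move=> s1 fr [_ J2] b; exact: J2.
Qed.

Lemma pos_inj (u u' v v' : 'I_n) : u * n + v = u' * n + v' -> u = u' /\ v = v'.
Proof.
move=> E; have := congr1 (divn^~ n) E; have := congr1 (modn^~ n) E.
rewrite !modnMDl !modn_small // !divnMDl // !divn_small // !addn0 => h1 h2.
by split; exact: val_inj.
Qed.

Lemma bfordS r u v :
  bford G d r.+1 u v = \big[minn/d]_(w < n) (bford G d 0 u w + bford G d r w v).
Proof. by []. Qed.

Lemma bford_lt r u v : bford G d r u v < 2 ^ l.
Proof. exact: leq_ltn_trans (bford_le _ _ _ _ _) d_lt'. Qed.

Lemma tri_dist s Q : params s ->
  (forall s', frame (wr c_dist) (wa c_dist) s s' ->
     (forall u v : 'I_n, ar s' aD n (u * n + v) = D u v) -> Q s') ->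
  tri s c_dist Q.
Proof.
move=> ps HQ.
suff H : tri s c_dist (fun s' => forall u v : 'I_n, ar s' aD n (u * n + v) = D u v).
  by apply: tri_weaken (tri_frame H) _ => s' [h1 h2]; exact: HQ.
have nb : n <= bnd false by exact: ltnW.
(* Layer [r] is filled at all pairs that precede [(u, v)] in row-major order. *)
pose done r (u v : nat) A := forall u' v' : 'I_n, (u' < u) || (u' == u :> nat) && (v' < v) ->
  A aD r (u' * n + v') = bford G d r u' v' : Prop.
have done_next r (u : 'I_n) A : done r u n A -> done r u.+1 0 A.
  move=> h u' v'; rewrite ltn0 andbF orbF ltnS leq_eqVlt orbC => h'.
  by apply: h; rewrite ltn_ord andbT.
have done_put r (u v : 'I_n) A : done r u v A ->
    done r u v.+1 (fun k' => if eqn k' aD then fun a b =>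
      if (a == r) && (b == u * n + v) then bford G d r u v else A aD a b else A k').
  move=> h u' v' h' /=; rewrite eqxx /=; case: eqP => [/pos_inj[-> ->]//|ne].
  apply: h; move: h'; rewrite ltnS [v' <= v]leq_eqVlt.
  case: (ltnP u' u) => //= _; case: eqP => //= Eu /orP[/eqP Ev|//].
  by case: ne; rewrite Eu Ev.
apply: tri_then; apply: (@tri_ord _ _ _ (fun u s' => done 0 u 0 (ar s')) n) => //.
- exact: (p_n ps).
- by move=> u' v'; rewrite !ltn0 andbF.
- move=> u s1 Eu fr1 J1.
  have p1 : params s1 by apply: (params_frame fr1).
  apply: (@tri_ord _ _ _ (fun v s' => done 0 u v (ar s')) n) => //; first exact: p_n p1.
  + move=> v s2 Ev fr2 J2.
    have p2 : params s2 by apply: (params_frame fr2).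
    have Eu2 : rg s2 vu = u by rewrite (proj1 fr2).
    assign (if adj G u v then weight G u v else 0).
    * by rewrite !evE Eu2 Ev (p_n p2) -IG.
    * by rewrite -IG.
    store_at 0 (u * n + v) (bford G d 0 u v).
    * by [].
    * by rewrite !evE /= Eu2 Ev (p_n p2).
    * rewrite !evE /= Eu2 Ev (p_d p2) -[_ == _ :> nat]/(u == v); case: eqVneq => // _.
      rewrite mul1n; case: ifP => [uv|_]; last by rewrite add0n mul1n.
      have -> : 1 - weight G u v = 0 by have := weight_gt0 uv; lia.
      by rewrite addn0.
    * exact: bford_lt.
    exact: done_put.
  by move=> s2 fr2 J2; exact: done_next.
move=> s1 fr1 J1.
have p1 : params s1 by apply: (params_frame fr1).
apply: (@tri_ord _ _ _ (fun r s' => forall r', r' <= r -> done r' n 0 (ar s')) n) => //.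
- exact: p_n p1.
- by move=> r'; rewrite leqn0 => /eqP->.
- move=> r s2 Er fr2 J2.
  have p2 : params s2 by apply: (params_frame fr2).
  apply: (@tri_ord _ _ _ (fun u s' =>
    (forall r', r' <= r -> done r' n 0 (ar s')) /\ done r.+1 u 0 (ar s')) n) => //.
  + exact: p_n p2.
  + by split=> // u' v'; rewrite !ltn0 andbF.
  + move=> u s3 Eu fr3 [J3 K3].
    have p3 : params s3 by apply: (params_frame fr3).
    apply: (@tri_ord _ _ _ (fun v s' =>
    (forall r', r' <= r -> done r' n 0 (ar s')) /\ done r.+1 u v (ar s')) n) => //.
    * exact: p_n p3.
    * move=> v s4 Ev fr4 [J4 K4].
      have p4 : params s4 by apply: (params_frame fr4).
      assign d.
      - by rewrite evE (p_d p4).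
      - exact: d_lt'.
      apply: tri_then.
      apply: (@tri_ord _ _ _ (fun w s' => rg s' vf =
        \big[minn/d]_(i < n | i < w) (bford G d 0 u i + bford G d r i v)) n) => //.
      - by rewrite /= (p_n p4).
      - by rewrite big_pred0.
      - move=> w s5 Ew fr5 J5.
        have p5 : params s5 by apply: (params_frame fr5) => //; apply: params_setr.
        have Er5 : rg s5 vr = r by rewrite (proj1 fr5) //= (proj1 fr4) // (proj1 fr3).
        have Eu5 : rg s5 vu = u by rewrite (proj1 fr5) //= (proj1 fr4).
        have Ev5 : rg s5 vq = v by rewrite (proj1 fr5).
        have AD : ar s5 aD = ar s4 aD by rewrite (proj2 fr5).
        assign (\big[minn/d]_(i < n | i < w.+1) (bford G d 0 u i + bford G d r i v)) => //.
        + rewrite !evE J5 Eu5 Ev5 Er5 Ew (p_n p5) AD (J4 0) // ?ltn_ord // (J4 r) ?ltn_ord //.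
          by rewrite bigminn_step.
        + exact: leq_ltn_trans (bigminn_le_idx _ _ _ _) d_lt'.
      move=> s5 fr5 J5.
      have p5 : params s5 by apply: (params_frame fr5) => //; apply: params_setr.
      have Er5 : rg s5 vr = r by rewrite (proj1 fr5) //= (proj1 fr4) // (proj1 fr3).
      have Eu5 : rg s5 vu = u by rewrite (proj1 fr5) //= (proj1 fr4).
      have Ev5 : rg s5 vq = v by rewrite (proj1 fr5).
      have AD : ar s5 aD = ar s4 aD by rewrite (proj2 fr5).
      store_at r.+1 (u * n + v) (bford G d r.+1 u v).
      - by rewrite !evE Er5 addn1.
      - by rewrite !evE Eu5 Ev5 (p_n p5).
      - by rewrite evE J5 bfordS; apply: eq_bigl => i; rewrite ltn_ord.
      - exact: bford_lt.
      split.
      - move=> r' rr' u' v' h /=; rewrite ltn_eqF ?ltnS //= AD; exact: J4.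
      have := done_put r.+1 u v _ K4; rewrite /done => h u' v' h'.
      by have := h u' v' h'; rewrite /= AD.
    * by move=> s4 fr4 [J4 K4]; split=> //; exact: done_next.
  + move=> s3 fr3 [J3 K3] r'; rewrite leq_eqVlt ltnS => /orP[/eqP->|]; [|exact: J3].
    by move=> u' v' h; apply: K3; rewrite ltn_ord.
move=> s2 fr2 J2 u v; rewrite (J2 n) ?bfordE // ltn_ord //.
Qed.

Lemma xval_lt (b u : 'I_n) : xval d D b u < 2 ^ l.
Proof.
apply: leq_ltn_trans (geq_minl _ _) _; apply: leq_ltn_trans d_lt'; exact: leq_pred.
Qed.

Lemma tri_cand s Q : 1 < d -> params s ->
  (forall u v : 'I_n, ar s aD n (u * n + v) = D u v) ->
  (forall b x, ar s aSEEN b x = 0) ->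
  (forall s', frame (wr c_cand) (wa c_cand) s s' ->
     (forall b : 'I_n, ar s' aCC b 0 = size (candidates d D b)) ->
     (forall (b : 'I_n) j, j < size (candidates d D b) -> ar s' aCA b j = nth 0 (candidates d D b) j) -> Q s') ->
  tri s c_cand Q.
Proof.
move=> d2 ps HD H0 HQ.
pose full b s' := ar s' aCC b 0 = size (candidates d D b) /\
  forall j, j < size (candidates d D b) -> ar s' aCA b j = nth 0 (candidates d D b) j.
suff H : tri s c_cand (fun s' => forall b : 'I_n, full b s').
  apply: tri_weaken (tri_frame H) _ => s' [h1 h2]; apply: HQ => // b; by case: (h1 b).
have nb : n <= bnd false by exact: ltnW.
apply: (@tri_ord _ _ _ (fun b s' => (forall b' : 'I_n, b' < b -> full b' s') /\
  forall b' x, b <= b' -> ar s' aSEEN b' x = 0) n) => //; first exact: p_n ps.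
- by split=> [b'|b' x _] //=; rewrite H0.
- move=> b s1 Eb fr1 [J1 K1].
  have p1 : params s1 by apply: (params_frame fr1).
  store_at b 0 d.
  + by rewrite evE.
  + by [].
  + by rewrite evE (p_d p1).
  + exact: d_lt'.
  assign 1 => //; first exact: one_lt.
  pose cs u := cands d D b (take u (enum 'I_n)).
  have cs_small u : u <= n -> size (cs u) < 2 ^ l.
    move=> un; apply: leq_ltn_trans n_lt'; apply: leq_trans (size_cands _ _ _ _) _.
    by rewrite size_takel // size_enum_ord.
  apply: tri_then.
  apply: (@tri_ord _ _ _ (fun u s' => [/\ rg s' vm = size (cs u),
     (forall j, j < size (cs u) -> ar s' aCA b j = nth 0 (cs u) j),
     (forall x, ar s' aSEEN b x = (x != d) && (x \in cs u)) &
     (forall (b' : 'I_n), b' < b -> full b' s') /\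
     forall b' x, b < b' -> ar s' aSEEN b' x = 0]) n) => //.
  + by rewrite /= (p_n p1).
  + rewrite /cs take0; split=> //=.
    * by case=> // _; rewrite !eqxx.
    * by move=> x; rewrite K1 // inE; case: eqP.
    split=> [b' bb'|b' x bb']; last by rewrite K1 // ltnW.
    have [h1 h2] := J1 b' bb'; split=> //= j jl.
    by rewrite ltn_eqF //= h2.
  + move=> u s2 Eu fr2 [L1 L2 L3 [L4 L5]].
    have p2 : params s2 by apply: (params_frame fr2) => //; apply: params_setr => //; apply: params_putr.
    have Eb2 : rg s2 vb = b by rewrite (proj1 fr2).
    have AD : ar s2 aD = ar s aD by rewrite (proj2 fr2) //= (proj2 fr1).
    set x := xval d D b u.
    assign x.
    * by rewrite /eDist !evE Eb2 Eu (p_n p2) (p_d p2) AD HD subn1.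
    * exact: xval_lt.
    have csS : cs u.+1 = add_new x (cs u).
      rewrite /cs (take_nth u) ?size_enum_ord // nth_ord_enum cands_rcons.
      by rewrite /x.
    have xd : x != d.
      by have := xval_bounds d2 (fun u v uv => dcap_gt0 G d0 uv) b u; rewrite -/x; lia.
    apply: tri_cond => h.
    * apply: tri_nop; move: h; rewrite !evE /= Eb2 L3 xd /= eqb0 negbK => h.
      by rewrite csS /add_new h; split.
    move: h; rewrite !evE /= Eb2 L3 xd /= => /eqP; rewrite eqb0 => /negbTE h.
    store_at b x 1.
    * by rewrite evE.
    * by rewrite evE.
    * by [].
    * exact: one_lt.
    store_at b (size (cs u)) x.
    * by rewrite evE.
    * by rewrite evE.
    * by rewrite evE.
    * exact: xval_lt.
    assign (size (cs u.+1)).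
    * by rewrite !evE /= L1 csS /add_new h size_rcons addn1.
    * exact: cs_small.
    rewrite csS /add_new h; split=> //=.
    * move=> j; rewrite size_rcons ltnS nth_rcons eqxx /=.
      by case: ltngtP => // jl _; exact: L2.
    * move=> y; rewrite eqxx mem_rcons inE /=; case: (y =P x) => [->|_]; first by rewrite xd.
      by rewrite L3.
    split=> [b' bb'|b' y bb']; last by rewrite gtn_eqF //= L5.
    have [h1 h2] := L4 b' bb'; split=> //= j jl.
    by rewrite ltn_eqF //= h2.
  move=> s2 fr2 [L1 L2 L3 [L4 L5]].
  have csn : cs n = candidates d D b by rewrite /cs candE take_oversize // size_enum_ord.
  rewrite csn in L1 L2 L3.
  store_at b 0 (size (candidates d D b)).
  + by rewrite evE (proj1 fr2).
  + by [].
  + by rewrite evE.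
  + by rewrite -csn cs_small.
  split=> [b'|b' x bb'] /=; last by rewrite L5.
  rewrite ltnS leq_eqVlt => /orP[/eqP/val_inj->|bb'].
    by split=> /=; rewrite ?eqxx.
  by have [h1 h2] := L4 b' bb'; split=> //=; rewrite ltn_eqF.
by move=> s1 fr1 [J1 _] b; exact: J1.
Qed.

End Setup.

(** * The decomposition as a postorder word in the input *)

Fixpoint nodes n (T : ntd n) : seq (nat * nat) :=
  match T with
  | Leaf v => [:: (1, val v)]
  | Introduce v T1 => rcons (nodes T1) (2, val v)
  | Forget v T1 => rcons (nodes T1) (3, val v)
  | Join T1 T2 => rcons (nodes T1 ++ nodes T2) (4, 0)
  end.

Definition unpair (ps : seq (nat * nat)) := flatten [seq [:: p.1; p.2] | p <- ps].

Lemma unpair_cat ps qs : unpair (ps ++ qs) = unpair ps ++ unpair qs.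
Proof. by rewrite /unpair map_cat flatten_cat. Qed.

Lemma encode_ntdE n (T : ntd n) : encode_ntd T = unpair (nodes T).
Proof.
elim: T => [v|v T1 IH|v T1 IH|T1 IH1 T2 IH2] //=.
- by rewrite -cats1 unpair_cat IH.
- by rewrite -cats1 unpair_cat IH.
by rewrite -cats1 !unpair_cat IH1 IH2 catA.
Qed.

Lemma size_unpair ps : size (unpair ps) = 2 * size ps.
Proof. by elim: ps => //= p ps IH; rewrite IH mulnS. Qed.

Lemma nth_unpair ps j : nth 0 (unpair ps) (2 * j) = (nth (0, 0) ps j).1 /\
  nth 0 (unpair ps) (2 * j).+1 = (nth (0, 0) ps j).2.
Proof.
elim: ps j => [|p ps IH] j; first by rewrite !nth_nil.
case: j => [|j] //; rewrite mulnS; exact: IH.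
Qed.

(** Tags are nonzero, so the closing 0 can be recognized when it is read in place of a tag. *)
Lemma nodes_tag n (T : ntd n) p : p \in nodes T -> 0 < p.1 <= 4.
Proof.
elim: T p => [v|v T1 IH|v T1 IH|T1 IH1 T2 IH2] p /=.
- by rewrite inE => /eqP->.
- by rewrite mem_rcons inE => /orP[/eqP->|/IH].
- by rewrite mem_rcons inE => /orP[/eqP->|/IH].
by rewrite mem_rcons inE mem_cat => /or3P[/eqP->|/IH1|/IH2].
Qed.

Section Input.
Variables (n : nat) (G : wgraph n) (k d : nat) (T : ntd n).
Notation I := (encode G k d T).

Lemma size_graph : size (encode_graph G) = n * n.
Proof. by rewrite size_allpairs size_enum_ord. Qed.

Lemma size_input : size I = 3 + n * n + 2 * size (nodes T) + 1.
Proof. by rewrite /encode !size_cat size_graph encode_ntdE size_unpair /= !addnA. Qed.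

Lemma input_graph (u v : 'I_n) :
  nth 0 I (3 + u * n + v) = if adj G u v then Defs.weight G u v else 0.
Proof.
rewrite -addnA -[LHS]/(nth 0 (encode_graph G ++ encode_ntd T ++ [:: 0]) (u * n + v)).
rewrite nth_cat size_graph; have -> : u * n + v < n * n.
  apply: (@leq_trans (u.+1 * n)); first by rewrite mulSn addnC ltn_add2r.
  by rewrite leq_mul2r ltn_ord orbT.
rewrite /encode_graph.
have := @nth_allpairs _ _ (fun u v : 'I_n => if adj G u v then Defs.weight G u v else 0)
  u v (enum 'I_n) (enum 'I_n) u v.
by rewrite size_enum_ord !nth_ord_enum => ->.
Qed.

Lemma input_nodes j : j < size (nodes T) ->
  nth 0 I (3 + n * n + 2 * j) = (nth (0, 0) (nodes T) j).1 /\
  nth 0 I (3 + n * n + 2 * j + 1) = (nth (0, 0) (nodes T) j).2.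
Proof.
move=> jT; have [h1 h2] := nth_unpair (nodes T) j.
have N x : x < 2 * size (nodes T) -> nth 0 I (3 + n * n + x) = nth 0 (unpair (nodes T)) x.
  move=> hx; rewrite -addnA -[LHS]/(nth 0 (encode_graph G ++ encode_ntd T ++ [:: 0]) (n * n + x)).
  rewrite nth_cat size_graph ltnNge leq_addr /= addKn.
  by rewrite nth_cat encode_ntdE size_unpair hx.
have -> : 3 + n * n + 2 * j + 1 = 3 + n * n + (2 * j).+1 by rewrite -[LHS]addnA addn1.
by rewrite (N (2 * j)) 1?(N (2 * j).+1) ?h1 ?h2 //; lia.
Qed.

Lemma input_last : nth 0 I (3 + n * n + 2 * size (nodes T)) = 0.
Proof.
rewrite -addnA -[LHS]/(nth 0 (encode_graph G ++ encode_ntd T ++ [:: 0]) (n * n + _)).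
rewrite nth_cat size_graph ltnNge leq_addr /= addKn.
by rewrite nth_cat encode_ntdE size_unpair ltnn subnn.
Qed.

End Input.

(** * Evaluation of the whole decomposition *)

Section Main.
Variables (n : nat) (G : wgraph n) (k d : nat) (T : ntd n).
Variables (l : nat) (bnd : bool -> nat) (m : nat).
Notation I := (encode G k d T).
Notation tri := (tri I l bnd).
Notation D := (dcap G d).
Notation W := d.+1.
Notation X := (2 ^ n.+1).
Notation t := (X ^ (2 * n.+1)).
Notation params := (params n d).
Notation tables := (tables d D).
Notation mach := (mach d D m).
Hypothesis n0 : 0 < n.
Hypothesis d0 : 0 < d.
Hypothesis Yn : n.+1 <= bnd false.
Hypothesis YT : size (nodes T) + n <= bnd false.
Hypothesis Dm : n.+1 * d ^ m <= bnd true.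
Hypothesis bndl : forall b, bnd b < 2 ^ l.
Hypothesis Ml : (X ^ n.+1 * t ^ n) * (X ^ n.+1 * t ^ n) < 2 ^ l.
Hypothesis Wl : W ^ n.+1 < 2 ^ l.
Hypothesis Il : forall j, nth 0 I j < 2 ^ l.
Hypothesis Lm : size I < 2 ^ l.

Lemma t_lt : t < 2 ^ l.
Proof.
apply: leq_ltn_trans Ml; have t0 : 0 < t by rewrite !expn_gt0.
have X0 : 0 < X ^ n.+1 by rewrite !expn_gt0.
apply: (@leq_trans (X ^ n.+1 * t ^ n)); last by rewrite leq_pmulr // muln_gt0 X0 expn_gt0 t0.
apply: (@leq_trans (t ^ n)); last by rewrite leq_pmull.
by rewrite -{1}[t]expn1 leq_pexp2l.
Qed.

(** Postorder evaluation on a stack of slots, vertex sets and bags, without the store. Each step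
    carries the separation facts used by its recurrence, so the proof about the program never
    returns to the tree. [VForget] also covers a vertex outside the bag, as in the final forgetting
    of all vertices. *)
Inductive vstep (i : nat) : nat * nat -> seq (entry n) -> seq (entry n) -> Prop :=
  | VLeaf (v : 'I_n) r : vstep i (1, val v) r ((i, [set v], [set v]) :: r)
  | VIntro (v : 'I_n) sl (U B : {set 'I_n}) r :
      B \subset U -> v \notin U -> sep d D U B -> #|v |: B| <= m.+1 ->
      vstep i (2, val v) ((sl, U, B) :: r) ((i, v |: U, v |: B) :: r)
  | VForget (v : 'I_n) sl (U B : {set 'I_n}) r :
      vstep i (3, val v) ((sl, U, B) :: r) ((i, U, B :\ v) :: r)
  | VJoin sa sb (U1 U2 B : {set 'I_n}) r : U1 :&: U2 = B -> sep d D U1 B ->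
      vstep i (4, 0) ((sb, U2, B) :: (sa, U1, B) :: r) ((i, U1 :|: U2, B) :: r).

Inductive plays : nat -> seq (entry n) -> seq (nat * nat) -> seq (entry n) -> Prop :=
  | PNil i stk : plays i stk [::] stk
  | PCons i p ps stk1 stk2 stk3 :
      vstep i p stk1 stk2 -> plays i.+1 stk2 ps stk3 -> plays i stk1 (p :: ps) stk3.

Lemma plays_cat i ps qs stk1 stk2 stk3 : plays i stk1 ps stk2 ->
  plays (i + size ps) stk2 qs stk3 -> plays i stk1 (ps ++ qs) stk3.
Proof.
move=> h; elim: h qs stk3 => [j stk|j p ps' s1 s2 s3 hv _ IH] qs stk4 /=; first by rewrite addn0.
by rewrite -addSnnS => h; apply: PCons hv _; exact: IH.
Qed.

Lemma plays_rcons i ps p stk1 stk2 stk3 : plays i stk1 ps stk2 ->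
  vstep (i + size ps) p stk2 stk3 -> plays i stk1 (rcons ps p) stk3.
Proof. by rewrite -cats1 => h1 h2; apply: plays_cat h1 _; apply: PCons h2 _; exact: PNil. Qed.

Lemma plays_tree T' i r : nice T' -> separating G T' -> max_bag T' <= m.+1 ->
  exists sl, plays i r (nodes T') ((sl, verts T', bag T') :: r).
Proof.
elim: T' i r => [v|v T1 IH|v T1 IH|T1 IH1 T2 IH2] i r /=.
- by exists i; apply: PCons (VLeaf _ _ _) _; exact: PNil.
- move=> /andP[vB n1] [_ [vU s1]]; rewrite geq_max => /andP[c1 c2].
  have [sl h] := IH i r n1 s1 c2.
  exists (i + size (nodes T1)); apply: plays_rcons h _; apply: VIntro => //.
    exact: bag_verts.
  move=> w u; have c : closed_off G (verts T1) (bag T1) by case: (T1) s1 => [?|? ?|? ?|? ?] [].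
  exact: (dcap_sep c).
- move=> /andP[vB n1] [_ s1]; rewrite geq_max => /andP[c1 c2].
  have [sl h] := IH i r n1 s1 c2.
  exists (i + size (nodes T1)); apply: plays_rcons h _; exact: VForget.
move=> /and3P[/eqP eb n1 n2] [_ [_ /subsetP sUB s1 s2]]; rewrite !geq_max => /and3P[c1 c2 c3].
have [sa h1] := IH1 i r n1 s1 c2.
have [sb h2] := IH2 (i + size (nodes T1)) ((sa, verts T1, bag T1) :: r) n2 s2 c3.
exists (i + size (nodes T1 ++ nodes T2)).
apply: plays_rcons (plays_cat h1 h2) _; rewrite -eb; apply: VJoin.
  apply/setP => x; apply/idP/idP => [|xB]; first exact: sUB.
  by rewrite inE (subsetP (bag_verts n1)) //; apply: (subsetP (bag_verts n2)); rewrite -eb.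
move=> w u; have c : closed_off G (verts T1) (bag T1) by case: (T1) s1 => [?|? ?|? ?|? ?] [].
exact: (dcap_sep c).
Qed.

Lemma plays_forget i sl U B r (vs : seq 'I_n) : exists sl',
  plays i ((sl, U, B) :: r) [seq (3, val v) | v <- vs] ((sl', U, B :\: [set v in vs]) :: r).
Proof.
elim: vs i sl B => [|v vs IH] i sl B /=.
  by exists sl; rewrite set_nil setD0; exact: PNil.
have [sl' h] := IH i.+1 i (B :\ v).
exists sl'; apply: PCons (VForget _ _ _ _ _ _) _.
by rewrite set_cons -setDDl.
Qed.

Definition all_nodes := nodes T ++ [seq (3, val v) | v <- enum 'I_n].

Lemma plays_all : nice T -> tree_decomposition G T -> max_bag T <= m.+1 ->
  exists sl, plays 0 [::] all_nodes [:: (sl, setT, set0)].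
Proof.
move=> nT td mT.
have sT : separating G T := separating_subtree td nT (subtree_nil T).
have [sl h] := @plays_tree T 0 [::] nT sT mT.
have [sl' h'] := plays_forget (0 + size (nodes T)) sl (verts T) (bag T) [::] (enum 'I_n).
exists sl'; apply: plays_cat h _.
have EV : verts T = setT by apply/setP => v; rewrite inE; exact: (verts_root td).
have ES : bag T :\: [set v in enum 'I_n] = set0.
  by apply/setP => v; rewrite !inE mem_enum.
rewrite ES in h'; rewrite -EV; exact: h'.
Qed.

Section Big.
Hypothesis d2 : 1 < d.

Lemma mach_frame R A i stk s s' : frame R A s s' -> vsp \notin R ->
  all (fun k => k \notin A) [:: aSTK; aBAG; aT] -> mach i stk s -> mach i stk s'.
Proof.
move=> [h1 h2] sR /=; rewrite andbT => /and3P[a1 a2 a3] [m1 m2 m3 m4].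
split=> //; first by rewrite h1.
  by apply: stack_rep_ext m2 => // *; rewrite h2.
by move=> *; rewrite h2 // m3.
Qed.

Lemma mach_setr i stk x y s : x != vsp -> mach i stk s -> mach i stk (setr x y s).
Proof.
move=> h [m1 m2 m3 m4]; split=> //; last exact: stack_rep_ext m2.
by rewrite /= -[eqn _ x]/(_ == x) eq_sym (negPf h).
Qed.

Lemma tri_node i p stk stk' s : i.+1 < 2 ^ l -> params s -> tables s ->
  rg s vi = i -> rg s vtag = p.1 -> rg s vv = p.2 -> mach i stk s -> vstep i p stk stk' ->
  tri s c_node (mach i.+1 stk').
Proof.
move=> il ps ts Ei Et Ev ms.
have Dr u : D u u = 0 by exact: dcap_refl.
have Dp u v : u != v -> 0 < D u v by exact: dcap_gt0.
have Ds u v : D u v = D v u by exact: dcap_sym.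
have Dt u v w : D u w <= D u v + D v w by exact: dcap_tri.
have inner sl U B r s0 c Q : stk = (sl, U, B) :: r ->
   (forall s', frame (vsl :: wr c_dom) (wa c_dom) s s' -> params s' -> tables s' ->
      mach i stk s' -> rg s' vsl = sl -> dom_rep d D B s' -> tri s' c Q) ->
   s0 = s -> tri s0 (vsl ::= Arr aSTK (vsp - Lit 1)%prog (Lit 0) ;; c_dom ;; c) Q.
  move=> Es H ->; have := ms; rewrite Es => -[m1 [[m2 m2' m3 m4 m5] _] m6 m7].
  assign sl.
  + by rewrite !evE m1 subn1.
  + by apply: ltn_trans il; rewrite ltnS ltnW.
  apply: tri_then.
  apply: (@tri_dom I l bnd n d D d2 Dp m Yn Dm bndl Wl B m5 _ sl) => //.
  + exact: params_setr.
  + exact: tables_setr.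
  move=> s' fr dr.
  have fr' : frame (vsl :: wr c_dom) (wa c_dom) s s'.
    split=> x h; last by rewrite (proj2 fr).
    move: h; rewrite inE negb_or => /andP[h1 h2].
    by rewrite (proj1 fr) //= -[eqn x vsl]/(x == vsl) (negPf h1).
  apply: H => //.
  + exact: (params_frame fr').
  + exact: (tables_frame fr').
  + exact: (mach_frame fr').
  by rewrite (proj1 fr).
move=> hv; case: hv Et Ev ms inner =>
  [v r|v sl U B r BU vU sU cB|v sl U B r|sa sb U1 U2 B r UB sU] /= Et Ev ms inner.
- apply: tri_cond; rewrite !evE Et //= => _.
  exact: (@tri_leaf I l bnd n d D d2 m Yn Dm bndl Ml Wl i v s il ps ts Ei Ev r ms).
- apply: tri_cond; rewrite !evE Et //= => _.
  apply: inner erefl _ erefl => s' fr p' t' m' Esl dr.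
  have Et' : rg s' vtag = 2 by rewrite (proj1 fr).
  have Ei' : rg s' vi = i by rewrite (proj1 fr).
  have Ev' : rg s' vv = v by rewrite (proj1 fr).
  apply: tri_cond; rewrite !evE Et' //= => _.
  exact: (@tri_intro I l bnd n d D d2 Dr Dp Ds Dt m Yn Dm bndl Ml Wl i v s' il p' t' Ei' Ev'
            _ _ _ _ m' Esl dr BU vU sU cB).
- apply: tri_cond; rewrite !evE Et //= => _.
  apply: inner erefl _ erefl => s' fr p' t' m' Esl dr.
  have Et' : rg s' vtag = 3 by rewrite (proj1 fr).
  have Ei' : rg s' vi = i by rewrite (proj1 fr).
  have Ev' : rg s' vv = v by rewrite (proj1 fr).
  apply: tri_cond; rewrite !evE Et' //= => _.
  apply: tri_cond; rewrite !evE Et' //= => _.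
  exact: (@tri_forget I l bnd n d D d2 Dr Dp Ds m Yn Dm bndl Ml Wl i v s' il p' t' Ei'
            Ev' _ _ _ _ m' Esl dr).
apply: tri_cond; rewrite !evE Et //= => _.
apply: inner erefl _ erefl => s' fr p' t' m' Esl dr.
have Et' : rg s' vtag = 4 by rewrite (proj1 fr).
have Ei' : rg s' vi = i by rewrite (proj1 fr).
(* A join is encoded with the vertex word 0, which is read here as the first vertex. *)
have Ev' : rg s' vv = Ordinal n0 by rewrite (proj1 fr).
apply: tri_cond; rewrite !evE Et' //= => _.
apply: tri_cond; rewrite !evE Et' //= => _.
have [[_ _ _ _ cB] _] := m_stk ms.
exact: (@tri_join I l bnd n d D d2 Dr Dp Ds Dt m Yn Dm bndl Ml Wl i (Ordinal n0) s' il p'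
          t' Ei' Ev' _ _ _ _ _ _ m' Esl dr UB sU cB).
Qed.

Lemma size_all_nodes : size all_nodes = size (nodes T) + n.
Proof. by rewrite size_cat size_map size_enum_ord. Qed.

Lemma tri_loop s (Q : store -> Prop) sl : params s -> tables s ->
  rg s vpos = 3 + n * n -> rg s vcnt = size (nodes T) ->
  mach 0 [::] s -> plays 0 [::] all_nodes [:: (sl, setT, set0)] ->
  (forall s', frame (wr (For false vi (vcnt + vn)%prog c_step)) (wa c_step) s s' ->
     ar s' aT (ar s' aSTK 0 0) 0 = \sum_(K : {set 'I_n}) scat d D K * X ^ #|K| -> Q s') ->
  tri s (For false vi (vcnt + vn)%prog c_step) Q.
Proof.
move=> ps ts Ep Ec ms pl HQ.
apply: (@tri_for_eq _ _ _ (fun j s' => exists2 stk, mach j stk s' &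
   plays j stk (drop j all_nodes) [:: (sl, setT, set0)]) (size all_nodes)) => //.
- by rewrite !evE Ec (p_n ps) size_all_nodes.
- by rewrite size_all_nodes.
- by exists [::]; rewrite ?drop0 //; case: ms => *; split.
- move=> j s1 jA Ej fr [stk mj]; rewrite (drop_nth (0, 0)) //.
  set p := nth _ _ j => pj.
  have p1 : params s1 by apply: (params_frame fr).
  have t1 : tables s1 by apply: (tables_frame fr).
  have Ep1 : rg s1 vpos = 3 + n * n by rewrite (proj1 fr).
  have Ec1 : rg s1 vcnt = size (nodes T) by rewrite (proj1 fr).
  have jl : j.+1 < 2 ^ l.
    by apply: leq_ltn_trans (bndl false); apply: leq_trans YT; rewrite -size_all_nodes.
  have l4 : 4 < 2 ^ l.
    have nn : 0 < n * n by rewrite muln_gt0 n0.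
    by apply: leq_ltn_trans Lm; rewrite size_input; lia.
  apply: tri_then.
  apply: (@tri_weaken _ _ _ _ _ (fun s2 => [/\ params s2, tables s2, mach j stk s2,
    rg s2 vi = j & rg s2 vtag = p.1 /\ rg s2 vv = p.2])).
    apply: tri_cond; rewrite !evE Ej Ec1.
      case: ltnP => // jT _.
      have [e1 e2] := input_nodes G k d jT.
      have Epn : p = nth (0, 0) (nodes T) j by rewrite /p nth_cat jT.
      assign p.1.
      + by rewrite !evE Ep1 Ej e1 Epn.
      + by rewrite Epn -e1.
      assign p.2.
      + by rewrite !evE /= Ep1 Ej e2 Epn.
      + by rewrite Epn -e2.
      split=> //; first by do 2!apply: params_setr => //.
      + by do 2!apply: tables_setr.
      by do 2!apply: mach_setr => //.
    case: ltnP => // jT _.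
    have jn : j - size (nodes T) < n by move: jA; rewrite size_all_nodes; lia.
    have Epn : p = (3, j - size (nodes T)).
      rewrite /p nth_cat ltnNge jT /= (nth_map (Ordinal jn)) ?size_enum_ord //.
      by rewrite nth_enum_ord.
    assign p.1.
    + by rewrite !evE Epn.
    + by rewrite Epn; exact: ltn_trans l4.
    assign p.2.
    + by rewrite !evE /= Ec1 Ej Epn.
    + by rewrite Epn; apply: ltn_trans jn _; apply: leq_ltn_trans (bndl false); exact: ltnW.
    split=> //; first by do 2!apply: params_setr => //.
    + by do 2!apply: tables_setr.
    by do 2!apply: mach_setr => //.
  move=> s2 [p2 t2 m2 Ei2 [Et2 Ev2]].
  inversion pj as [|? ? ? ? stk' ? hv pj' E1 E2]; subst.
  apply: tri_weaken (tri_node jl p2 t2 Ei2 Et2 Ev2 m2 hv) _ => s3 m3.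
  exists stk' => //; exact: mach_setr.
move=> s1 fr [stk mj]; rewrite drop_size => pj.
inversion pj; subst.
apply: HQ => //; case: mj => _ [[h1 h2 h3 h4 h5] _] _ _.
by rewrite h1 h4 tab_final.
Qed.

Lemma tri_big s (Q : store -> Prop) sl : params s ->
  rg s vpos = 3 + n * n -> rg s vcnt = size (nodes T) ->
  (forall k a b, ar s k a b = 0) -> plays 0 [::] all_nodes [:: (sl, setT, set0)] ->
  (forall s', rg s' vX = X -> rg s' vn = n -> rg s' vk = rg s vk ->
     rg s' vf = \sum_(K : {set 'I_n}) scat d D K * X ^ #|K| -> Q s') ->
  tri s (c_pw ;; c_dist ;; c_cand ;; vsp ::= Lit 0 ;; For false vi (vcnt + vn)%prog c_step ;;
     vf ::= Arr aT (Arr aSTK (Lit 0) (Lit 0)) (Lit 0)) Q.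
Proof.
move=> ps Ep Ec H0 pl HQ.
apply: tri_then; apply: (@tri_pw I l bnd n d Yn bndl Wl) => // s1 fr1 PW1.
have p1 : params s1 by apply: (params_frame fr1).
apply: tri_then; apply: (@tri_dist I l bnd n d G n0 d0 Yn Wl Il (input_graph _ _ _ _)) => //.
move=> s2 fr2 D2.
have p2 : params s2 by apply: (params_frame fr2).
apply: tri_then; apply: (@tri_cand I l bnd n d G n0 d0 Yn bndl Wl) => //.
  by move=> b x; rewrite (proj2 fr2) // (proj2 fr1).
move=> s3 fr3 CC3 CA3.
have p3 : params s3 by apply: (params_frame fr3).
have fr13 := frame_trans fr1 (frame_trans fr2 fr3).
have t3 : tables s3.
  split=> //.
  - by move=> b; rewrite (proj2 fr3) // (proj2 fr2).
  - by move=> b v; rewrite (proj2 fr3).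
assign 0; rewrite ?expn_gt0 //.
apply: tri_then; apply: (@tri_loop _ _ sl) => //.
- exact: params_setr.
- exact: tables_setr.
- by rewrite /= (proj1 fr13).
- by rewrite /= (proj1 fr13).
- by split=> // j key _; rewrite /= (proj2 fr13).
move=> s4 fr4 E4.
assign (\sum_(K : {set 'I_n}) scat d D K * X ^ #|K|).
- by rewrite !evE E4.
- rewrite -tab_final; apply: leq_ltn_trans (tab_le _ _ _ _ _) _.
  apply: leq_ltn_trans (ltnW (weight_sum _ _ _ _)) _.
  apply: leq_ltn_trans Ml; apply: leq_trans (leq_pmulr _ _) (leq_pmulr _ _);
  by rewrite ?muln_gt0 !expn_gt0.
apply: HQ => //=.
- by rewrite (proj1 fr4) //= (p_X p3).
- by rewrite (proj1 fr4) //= (p_n p3).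
by rewrite (proj1 fr4) //= (proj1 fr13).
Qed.

End Big.

Lemma tri_init : tri (Sto (fun=> 0) (fun=> fun=> fun=> 0)) c_init (fun s =>
  [/\ params s, rg s vk = k, rg s vpos = 3 + n * n, rg s vcnt = size (nodes T)
    & forall k a b, ar s k a b = 0]).
Proof.
have nl : n.+1 < 2 ^ l by apply: leq_ltn_trans (bndl false).
have one : 1 < 2 ^ l by exact: leq_ltn_trans nl.
have Xt : X <= t by rewrite -{1}[X]expn1 leq_pexp2l // expn_gt0.
have Wl' : W < 2 ^ l by apply: leq_ltn_trans Wl; rewrite -{1}[W]expn1 leq_pexp2l.
assign n => //; first exact: ltnW.
assign k => //; first by have := Il 1.
assign d => //; first by have := Il 2.
assign W => //; first by rewrite !evE /= addn1.
assign 2 => //.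
  by apply: leq_ltn_trans Wl'.
apply: tri_then; apply: (@tri_ord _ _ _ (fun b s' => rg s' vX = 2 ^ b.+1) n) => //.
- exact: ltnW.
- move=> b s1 Eb fr1 J1; assign (2 ^ b.+2) => //.
  + by rewrite !evE J1 [RHS]expnSr.
  + by apply: leq_ltn_trans t_lt; apply: leq_trans Xt; rewrite leq_pexp2l // ltnS.
move=> s1 fr1 J1.
have En1 : rg s1 vn = n by rewrite (proj1 fr1).
assign 1 => //.
apply: tri_then; apply: (@tri_for_eq _ _ _ (fun b s' => rg s' vt = X ^ (2 * b)) n.+1) => //.
- by rewrite !evE /= En1 addn1.
- move=> b s2 bn Eb fr2 J2.
  have EX : rg s2 vX = X by rewrite (proj1 fr2).
  assign (X ^ (2 * b.+1)) => //.
  + by rewrite !evE J2 EX mulnn -expnD addnC -mulnS.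
  + by apply: leq_ltn_trans t_lt; rewrite leq_pexp2l ?expn_gt0 // leq_mul2l.
move=> s2 fr2 J2.
have En2 : rg s2 vn = n by rewrite (proj1 fr2).
assign (3 + n * n).
- by rewrite !evE En2.
- by apply: leq_ltn_trans Lm; rewrite size_input -addnA leq_addr.
assign (size (nodes T)).
- by rewrite !evE size_input [rg _ _]/=; lia.
- by apply: leq_ltn_trans Lm; rewrite size_input; lia.
split=> /=.
- by split; rewrite /= ?En2 ?J2 // (proj1 fr2) //= (proj1 fr1).
- by rewrite (proj1 fr2) //= (proj1 fr1).
- by [].
- by [].
by move=> *; rewrite (proj2 fr2) // (proj2 fr1).
Qed.

Lemma tri_final s (P : pred {set 'I_n}) (Q : store -> Prop) :
  rg s vX = X -> rg s vn = n -> rg s vk = k ->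
  rg s vf = \sum_(K : {set 'I_n}) P K * X ^ #|K| ->
  \sum_(K : {set 'I_n}) P K * X ^ #|K| < 2 ^ l ->
  (forall s', rg s' vout = #|[set K : {set 'I_n} | P K && (#|K| == k)]| -> Q s') ->
  tri s (For false vb (eMin vk (vn + Lit 1)%prog) (vf ::= vf / vX)%prog ;; vout ::= eMod vf vX) Q.
Proof.
move=> EX En Ek Ef fl HQ; move: Ef fl; set tot := \sum_(K : _) _ => Ef fl.
apply: tri_then; apply: (@tri_for_eq _ _ _ (fun b s' => rg s' vf = tot %/ X ^ b) (minn k n.+1)) => //.
- by rewrite !evE Ek En addn1.
- exact: leq_trans (geq_minr _ _) Yn.
- by rewrite /= expn0 divn1.
- move=> b s1 bk Eb fr1 J1; assign (tot %/ X ^ b.+1) => //.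
  + by rewrite !evE J1 (proj1 fr1) // EX -divnMA -expnSr.
  + exact: leq_ltn_trans (leq_div _ _) fl.
move=> s1 fr1 J1.
have E : ev I s1 (eMod vf vX) = #|[set K : {set 'I_n} | P K && (#|K| == k)]|.
  by rewrite !evE J1 (proj1 fr1) // EX count_digit.
apply: (@tri_let_eq _ _ _ _ _ _ _ _ E); last exact: HQ.
rewrite -E !evE J1 (proj1 fr1) // EX.
apply: leq_ltn_trans (leq_mod _ _) _; exact: leq_ltn_trans (leq_div _ _) fl.
Qed.

Lemma program_ok : nice T -> tree_decomposition G T -> max_bag T <= m.+1 ->
  tri (Sto (fun=> 0) (fun=> fun=> fun=> 0)) program
    (fun s => rg s vout = num_scattered G d k).
Proof.
move=> nT td mT.
apply: tri_then; apply: (tri_weaken tri_init) => s [ps Ek Ep Ec H0].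
have EN : num_scattered G d k = #|[set K : {set 'I_n} | scat d D K && (#|K| == k)]|.
  by apply: eq_card => K; rewrite !inE scatteredE.
have X1 : 1 < X by rewrite (@leq_trans (2 ^ 1)) // leq_exp2l.
have XT (F : pred {set 'I_n}) : \sum_(K : {set 'I_n}) F K * X ^ #|K| < 2 ^ l.
  apply: (@leq_ltn_trans (2 ^ n * X ^ n)).
    have -> : 2 ^ n = #|{set 'I_n}| by rewrite -cardsT -powersetT card_powerset cardsT card_ord.
    rewrite -sum_nat_const; apply: leq_sum => K _.
    apply: (@leq_trans (X ^ #|K|)); first by case: (F K); rewrite ?mul1n ?mul0n.
    by rewrite leq_exp2l // -[leqRHS]card_ord max_card.
  apply: leq_ltn_trans t_lt; apply: (@leq_trans (X ^ n.+1)).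
    by rewrite [X ^ n.+1]expnS leq_mul // leq_exp2l.
  by rewrite leq_exp2l // mul2n -addnn leq_addr.
apply: tri_then; apply: tri_cond; rewrite !evE (p_d ps) => hd.
  have d2 : 1 < d by move: hd; case: ltnP.
  have [sl pl] := plays_all nT td mT.
  apply: (tri_big d2 ps Ep Ec H0 pl) => s1 EX En Ek1 Ef.
  apply: (@tri_final s1 (scat d D)) => // [|s2 ->]; last exact: esym EN.
  by rewrite Ek1.
have d1 : d = 1 by apply/eqP; move: hd; rewrite eqn_leq d0 andbT; case: ltnP.
have Esum : \sum_(K : {set 'I_n}) scat d D K * X ^ #|K| = X.+1 ^ n.
  rewrite -[in RHS](card_ord n) -prod_nat_const.
  under [in RHS]eq_bigr do rewrite -addn1.
  (* Expanding the product of [n] factors [X + 1] gives one term per set [K]. *)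
  rewrite (bigA_distr 1 addn); apply: eq_bigr => K _.
  have -> : scat d D K.
    by apply/scatP => u v _ _ uv; have := dcap_gt0 G d0 uv; rewrite d1.
  by rewrite mul1n -big_mkcond prod_nat_const card_ord.
have tot : X.+1 ^ n < 2 ^ l by rewrite -Esum.
have l1 : 1 < 2 ^ l by apply: (leq_ltn_trans _ (bndl false)); exact: leq_trans Yn.
assign 1 => //.
apply: (@tri_ord _ _ _ (fun b s' => rg s' vf = (X.+1) ^ b) n) => //.
- exact: ltnW.
- exact: p_n ps.
- move=> b s1 Eb fr J; assign (X.+1 ^ b.+1) => //.
  + by rewrite !evE J (proj1 fr) //= (p_X ps) addn1 -expnSr.
  + by apply: leq_ltn_trans tot; rewrite leq_pexp2l.
move=> s1 fr1 J1.
apply: (@tri_final s1 (scat d D)) => // [||||s2 ->]; last exact: esym EN.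
- by rewrite (proj1 fr1) //= (p_X ps).
- by rewrite (proj1 fr1) //= (p_n ps).
- by rewrite (proj1 fr1).
- by rewrite J1 Esum.
Qed.

End Main.

(** * Running time *)

Fixpoint depth (b : bool) c : nat :=
  match c with
  | Nop | Let _ _ | Put _ _ _ _ => 0
  | Then c1 c2 | Cond _ c1 c2 => maxn (depth b c1) (depth b c2)
  | For b' _ _ c1 => (b' == b) + depth b c1
  end.

(** A loop multiplies the cost of its body by its bound, so [tm] is a polynomial in the two bounds
    whose degrees are at most the nesting depths. The bounds being positive, it is at most the sum
    of its coefficients times the top monomial. *)
Lemma tm_le bnd c : (forall b, 0 < bnd b) ->
  tm bnd c <= tm (fun=> 1) c * (bnd false ^ depth false c * bnd true ^ depth true c).
Proof.
move=> b0; pose P c := bnd false ^ depth false c * bnd true ^ depth true c.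
have P0 c' : 0 < P c' by rewrite muln_gt0 !expn_gt0 !b0.
have Pm c1 c2 : depth false c1 <= depth false c2 -> depth true c1 <= depth true c2 ->
    P c1 <= P c2.
  by move=> h1 h2; apply: leq_mul; rewrite leq_pexp2l.
rewrite -/(P c); elim: c => [|i e|k a b e|c1 IH1 c2 IH2|e c1 IH1 c2 IH2|b i e c1 IH].
- by [].
- by rewrite leq_pmulr.
- by rewrite leq_pmulr.
- rewrite [tm _ _]/= [tm (fun=> 1) _]/= mulnDl leq_add //.
    by apply: (leq_trans IH1); rewrite leq_mul2l Pm ?orbT //= leq_maxl.
  by apply: (leq_trans IH2); rewrite leq_mul2l Pm ?orbT //= leq_maxr.
- rewrite [tm _ _]/= [tm (fun=> 1) _]/= !mulnDl.
  apply: leq_add; first by apply: leq_add; rewrite leq_pmulr.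
  apply: leq_add.
    by apply: (leq_trans IH1); rewrite leq_mul2l Pm ?orbT //= leq_maxl.
  by apply: (leq_trans IH2); rewrite leq_mul2l Pm ?orbT //= leq_maxr.
have PE : P (For b i e c1) = bnd b * P c1.
  by rewrite /P /=; case: b => /=; rewrite add0n add1n expnS; [exact: mulnCA | rewrite -mulnA].
rewrite PE [tm _ _]/= [tm (fun=> 1) _]/= mul1n.
move: (setcost _ (cexp e)) (setcost _ (Cst 0)) (setcost _ (Op Add _ _)) => x y u.
move: (setcost _ _) IH (P0 c1) (b0 b) => w.
move: (i.*2.+3.+3) (tm bnd c1) (tm (fun=> 1) c1) (P c1) (bnd b) => q c c' p B IH p0 B0.
have Bp : 0 < B * p by rewrite muln_gt0 B0.
rewrite (mulnDl x) (mulnDl y) (mulnDl (q + _)).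
apply: leq_add; first by rewrite leq_pmulr.
apply: leq_add; first by rewrite leq_pmulr.
apply: leq_add; last by rewrite leq_pmulr.
rewrite [leqRHS]mulnCA leq_mul2l (mulnDl q) (mulnDl c'); apply/orP; right.
apply: leq_add; first by rewrite leq_pmulr.
by apply: leq_add => //; rewrite leq_pmulr.
Qed.

(** The compiled code expects the input length in register 1, which the machine does not supply.
    After the first [3 + n * n] words every second word is a nonzero tag, until the closing 0 is
    met; the length is one more than its position. *)
Definition scan : com :=
  Seq (Set_ 1 (Op Add (Cst 3) (Op Mul (Read (Cst 0)) (Read (Cst 0)))))
  (Seq (While (Read (Reg 1)) (Set_ 1 (Op Add (Reg 1) (Cst 2))))
       (Set_ 1 (Op Add (Reg 1) (Cst 1)))).

Definition full_program : com := Seq scan (compile program).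

Lemma ntd_gt0 n (T : ntd n) : 0 < n.
Proof. by elim: T => // v; apply: leq_trans (ltn_ord v). Qed.

Lemma max_bag_gt0 n (T : ntd n) : 0 < max_bag T.
Proof.
elim: T => [v|v T IH|v T IH|T1 IH1 T2 IH2] /=; first by rewrite cards1.
- by rewrite leq_max IH orbT.
- by rewrite leq_max IH orbT.
by rewrite !leq_max IH1 orbT.
Qed.

Lemma max_bag_le n (T : ntd n) : max_bag T <= n.
Proof.
have c (A : {set 'I_n}) : #|A| <= n by rewrite -[leqRHS]card_ord max_card.
by elim: T => [v|v T IH|v T IH|T1 IH1 T2 IH2] /=; rewrite ?geq_max ?c ?IH ?IH1 ?IH2.
Qed.

Lemma lt_bits a : a < 2 ^ bits a.
Proof. exact: trunc_log_ltn. Qed.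

Section Scan.
Variables (n : nat) (G : wgraph n) (k d : nat) (T : ntd n) (l : nat).
Notation I := (encode G k d T).
Hypothesis l0 : 0 < l.
Hypothesis Il : forall j, nth 0 I j < 2 ^ l.
Hypothesis Lm : size I < 2 ^ l.
Notation cnt := (size (nodes T)).

Definition scanning p s :=
  [/\ reg s 1 = p, forall j, j != 1 -> reg s j = 0 & forall j, Defs.mem s j = nth 0 I j].

Lemma scanning_bounded p s : p < 2 ^ l -> scanning p s -> bounded l s.
Proof.
move=> h [h1 h2 h3]; split=> j; last by rewrite h3.
by case: (eqVneq j 1) => [->|/h2->]; rewrite ?h1 ?expn_gt0.
Qed.

Lemma exec_set1 p q e s : p < 2 ^ l -> q < 2 ^ l -> scanning p s -> eval s e = q ->
  exists s' t, [/\ exec (Set_ 1 e) s s' t, t <= setcost 1 e * (l * l) & scanning q s'].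
Proof.
move=> pl ql sc eq; have el : eval s e < 2 ^ l by rewrite eq.
have [t et ht] := exec_set l0 1 (scanning_bounded pl sc) el.
case: sc => h1 h2 h3.
exists (State (upd (reg s) 1 (eval s e)) (Defs.mem s)), t; split=> //; split=> //= j.
by rewrite /upd => j1; rewrite (negPf j1) h2.
Qed.

Lemma exec_loop j s : j <= cnt -> scanning (3 + n * n + 2 * (cnt - j)) s ->
  exists s' t, [/\ exec (While (Read (Reg 1)) (Set_ 1 (Op Add (Reg 1) (Cst 2)))) s s' t,
    t <= (j * 30 + 7) * (l * l) & scanning (3 + n * n + 2 * cnt) s'].
Proof.
have SI := size_input G k d T.
elim: j s => [|j IH] s jc sc.
  rewrite subn0 in sc; have [h1 h2 h3] := sc.
  have b : bounded l s by apply: scanning_bounded sc; apply: leq_ltn_trans Lm; rewrite SI leq_addr.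
  exists s, (ecost s (Read (Reg 1)) + 1); split=> //.
    by apply: ExecWhileF; rewrite /= h1 h3 input_last.
  have := ecost_le l0 (Read (Reg 1)) b; rewrite /= => h.
  by apply: (@leq_trans (6 * (l * l) + l * l)); [|lia];
    apply: leq_add; [apply: leq_trans h _; rewrite leq_mul2r orbT | rewrite muln_gt0 l0].
have [h1 h2 h3] := sc.
have pl : 3 + n * n + 2 * (cnt - j.+1) < 2 ^ l by apply: leq_ltn_trans Lm; rewrite SI; lia.
have b : bounded l s by exact: scanning_bounded sc.
have ql : 3 + n * n + 2 * (cnt - j) < 2 ^ l by apply: leq_ltn_trans Lm; rewrite SI; lia.
have [|s1 [t1 [e1 c1 sc1]]] := @exec_set1 _ _ (Op Add (Reg 1) (Cst 2)) _ pl ql sc.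
  by rewrite /= h1 -addnA; congr (_ + _); lia.
have [s2 [t2 [e2 c2 sc2]]] := IH s1 (ltnW jc) sc1.
exists s2, (ecost s (Read (Reg 1)) + 1 + t1 + t2); split=> //.
  apply: ExecWhileT e1 e2; rewrite /= h1 h3.
  have jT : cnt - j.+1 < cnt by lia.
  have [-> _] := input_nodes G k d jT.
  by have /andP[] := nodes_tag (mem_nth (0, 0) jT); rewrite lt0n.
have := ecost_le l0 (Read (Reg 1)) b; rewrite /= => h.
have ll : 0 < l * l by rewrite muln_gt0 l0.
have c1' : t1 <= 20 * (l * l) by apply: leq_trans c1 _; rewrite leq_mul2r orbT.
have h' : ecost s (Read (Reg 1)) <= 6 * (l * l) by apply: leq_trans h _; rewrite leq_mul2r orbT.
apply: (@leq_trans (6 * (l * l) + l * l + 20 * (l * l) + (j * 30 + 7) * (l * l))).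
  by do 3!(apply: leq_add => //).
by rewrite -!mulSnr -!mulnDl; rewrite leq_mul2r; apply/orP; right; lia.
Qed.

Lemma exec_scan : exists s' t, [/\ exec scan (init I) s' t,
  t <= (cnt + 4) * 30 * (l * l) & scanning (size I) s'].
Proof.
have SI := size_input G k d T.
have sc0 : scanning 0 (init I) by [].
have l0' : 0 < 2 ^ l by rewrite expn_gt0.
have ql : 3 + n * n + 2 * (cnt - cnt) < 2 ^ l by apply: leq_ltn_trans Lm; rewrite SI; lia.
have [|s1 [t1 [e1 c1 sc1]]] := @exec_set1 _ _ (Op Add (Cst 3) (Op Mul (Read (Cst 0)) (Read (Cst 0)))) _ l0' ql sc0.
  by rewrite subnn muln0 addn0.
have [s2 [t2 [e2 c2 sc2]]] := exec_loop (leqnn _) sc1.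
have pl : 3 + n * n + 2 * cnt < 2 ^ l by apply: leq_ltn_trans Lm; rewrite SI leq_addr.
have [|s3 [t3 [e3 c3 sc3]]] := @exec_set1 _ (size I) (Op Add (Reg 1) (Cst 1)) _ pl Lm sc2.
  by have [h _ _] := sc2; rewrite SI [eval _ _]/= h.
exists s3, (t1 + (t2 + t3)); split=> //.
  by apply: ExecSeq e1 _; exact: ExecSeq e2 e3.
have ll : 0 < l * l by rewrite muln_gt0 l0.
have c1' : t1 <= 50 * (l * l) by apply: leq_trans c1 _; rewrite leq_mul2r orbT.
have c3' : t3 <= 30 * (l * l) by apply: leq_trans c3 _; rewrite leq_mul2r orbT.
apply: (@leq_trans (50 * (l * l) + ((cnt * 30 + 7) * (l * l) + 30 * (l * l)))).
  by do 2!(apply: leq_add => //).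
by rewrite -!mulnDl leq_mul2r; apply/orP; right; lia.
Qed.

Lemma scanning_rep s : scanning (size I) s -> rep I (Sto (fun=> 0) (fun=> fun=> fun=> 0)) s.
Proof.
move=> [h1 h2 h3]; split=> //= [i|k' a b].
  by rewrite h2 //; lia.
by rewrite h3 nth_default // leq_addr.
Qed.

End Scan.

(** * Input size and the final time bound *)

Section Bounds.
Variables (n : nat) (G : wgraph n) (k d : nat) (T : ntd n).
Notation I := (encode G k d T).
Notation N := (input_size I).
Notation L := (8 * N ^ 3).

Lemma size_le_input (J : seq nat) : size J <= input_size J.
Proof.
rewrite /input_size; elim: J => [|a J IH]; first by rewrite big_nil.
by rewrite big_cons /= -add1n leq_add.
Qed.

Lemma bits_le_input (J : seq nat) a : a \in J -> bits a <= input_size J.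
Proof.
rewrite /input_size; elim: J => // b J IH; rewrite inE big_cons => /orP[/eqP->|/IH h].
  exact: leq_addr.
exact: leq_trans h (leq_addl _ _).
Qed.

Lemma N_ge5 : 5 <= N.
Proof.
have n0 := ntd_gt0 T; have nn : 0 < n * n by rewrite muln_gt0 n0.
by apply: leq_trans (size_le_input _); rewrite size_input; lia.
Qed.

Lemma n_lt_N : n.+1 <= N.
Proof.
have n0 := ntd_gt0 T; have nn : n <= n * n by rewrite leq_pmulr.
by apply: leq_trans (size_le_input _); rewrite size_input; lia.
Qed.

Lemma input_lt j : nth 0 I j < 2 ^ N.
Proof.
case: (ltnP j (size I)) => h; last by rewrite nth_default // expn_gt0.
apply: leq_trans (lt_bits _) _; rewrite leq_exp2l //.
exact/bits_le_input/mem_nth.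
Qed.

End Bounds.

Lemma leq_expn a b e : a <= b -> a ^ e <= b ^ e.
Proof. by move=> h; elim: e => // e IH; rewrite !expnS leq_mul. Qed.

Theorem theorem2 :
  exists (P : com) (c : nat),
    forall (n : nat) (G : wgraph n) (k d : nat) (T : ntd n),
      0 < k -> 0 < d -> nice T -> tree_decomposition G T ->
      exists t : nat,
        runs P (encode G k d T) (num_scattered G d k) t /\
        t <= c * input_size (encode G k d T) ^ c * d ^ width T.
Proof.
pose K := 150 + tm (fun=> 1) program.
(* One constant serves as factor and as exponent. The total comes to [64 * K * N ^ 11 * d ^ m], with
   64 from [l * l = 64 * N ^ 6]; the 150 in [K] pays for [scan]. *)
exists full_program, (64 * K + 20) => n G k d T _ d0 nT td.
set I := encode G k d T; set N := input_size I; set m := width T.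
have n0 := ntd_gt0 T.
have N5 : 5 <= N := N_ge5 G k d T.
have nN : n.+1 <= N := n_lt_N G k d T.
have SN : size I <= N := size_le_input I.
have mT : max_bag T <= m.+1 by rewrite /m /width; case: (max_bag T).
have mn : m < n by have := max_bag_le T; have := max_bag_gt0 T; rewrite /m /width; lia.
have dN : bits d <= N by apply: bits_le_input; rewrite !inE eqxx !orbT.
have dlt : d.+1 <= 2 ^ N.
  by apply: leq_trans (lt_bits d) _; rewrite leq_exp2l.
(* The largest numbers are products of two transformed entries at a join, at most
   [2 ^ (6 * n.+1 ^ 3)], and [n.+1 <= N]. The other bounds only have exponents of order [N ^ 2]. *)
pose l := 8 * N ^ 3.
have N3 : N ^ 3 = N * N * N by rewrite !expnS expn0 muln1 mulnA.
have Nl : N <= l by rewrite /l N3; nia.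
have l0 : 0 < l by rewrite (leq_trans _ Nl) // (leq_trans _ N5).
have SI := size_input G k d T.
pose bnd (b : bool) := if b then n.+1 * d ^ m else N.
have dm : d ^ m <= 2 ^ (N * N).
  apply: (@leq_trans ((2 ^ N) ^ m)); first by rewrite leq_expn // ltnW.
  rewrite -expnM leq_exp2l // leq_mul2l; apply/orP; right; lia.
have Dml : n.+1 * d ^ m < 2 ^ l.
  apply: (@leq_ltn_trans (2 ^ N * 2 ^ (N * N))).
    by rewrite leq_mul // (leq_trans nN) // ltnW // ltn_expl.
  by rewrite -expnD ltn_exp2l // /l N3; nia.
have bndl b : bnd b < 2 ^ l.
  case: b => //=; apply: (@leq_trans (2 ^ N)); first exact: ltn_expl.
  by rewrite leq_exp2l.
have b0 b : 0 < bnd b.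
  by case: b => /=; rewrite ?muln_gt0 ?expn_gt0 ?d0 // (leq_trans _ N5).
have Il j : nth 0 I j < 2 ^ l.
  by apply: leq_trans (input_lt G k d T j) _; rewrite leq_exp2l.
have Lm : size I < 2 ^ l by apply: leq_ltn_trans (bndl false).
have Ml : ((2 ^ n.+1) ^ n.+1 * ((2 ^ n.+1) ^ (2 * n.+1)) ^ n) *
  ((2 ^ n.+1) ^ n.+1 * ((2 ^ n.+1) ^ (2 * n.+1)) ^ n) < 2 ^ l.
  rewrite -!expnM -!expnD ltn_exp2l // /l N3.
  have h1 : n.+1 * n.+1 * n.+1 <= N * N * N by rewrite !leq_mul.
  have h2 : n.+1 * n.+1 <= n.+1 * n.+1 * n.+1 by rewrite leq_pmulr.
  have h3 : n.+1 * n.+1 * n <= n.+1 * n.+1 * n.+1 by rewrite leq_mul2l leqnSn orbT.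
  have h4 : 0 < n.+1 * n.+1 * n.+1 by [].
  have -> : n.+1 * (2 * n.+1 * n) = 2 * (n.+1 * n.+1 * n) by rewrite -!mulnA [LHS]mulnCA.
  move: (n.+1 * n.+1 * n.+1) (N * N * N) h1 h2 h3 h4 => A E h1 h2 h3 h4.
  move: (n.+1 * n.+1 * n) h3 => B h3; move: (n.+1 * n.+1) h2 => C h2; lia.
have Wl : d.+1 ^ n.+1 < 2 ^ l.
  apply: (@leq_ltn_trans ((2 ^ N) ^ n.+1)); first exact: leq_expn.
  rewrite -expnM ltn_exp2l // /l N3; apply: (@leq_ltn_trans (N * N)).
    by rewrite leq_mul.
  nia.
have Yn : n.+1 <= bnd false by [].
have YT : size (nodes T) + n <= bnd false.
  apply: leq_trans SN; rewrite SI; have : n <= n * n by rewrite leq_pmulr.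
  lia.
have [Hok Hout] := @program_ok n G k d T l bnd m n0 d0 Yn YT (leqnn _) bndl Ml Wl Il Lm nT td mT.
have [g1 [t1 [e1 c1 sc1]]] := exec_scan l0 Il Lm.
have [g2 [t2 [e2 r2 _ c2 _]]] := compile_ok l0 bndl program_wf (scanning_rep l0 Lm sc1)
   (scanning_bounded Il Lm sc1) Hok.
exists (t1 + t2); split.
  exists g2; first exact: ExecSeq e1 e2.
  case: r2 => h _ _ _; exact: etrans (h 0) Hout.
have cN : (size (nodes T) + 4) * 30 <= 60 * N.
  by move: SI SN; move: (size I) => z ->; lia.
(* At most four polynomial loops and one table loop are nested. The factor [n.+1] of the table size
   raises the power of [N] from four to five. *)
have tmN : tm bnd program <= tm (fun=> 1) program * (N ^ 5 * d ^ m).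
  apply: leq_trans (tm_le _ b0) _; rewrite leq_mul2l; apply/orP; right.
  have -> : depth false program = 4 by [].
  have -> : depth true program = 1 by [].
  rewrite /bnd expn1 mulnA [N ^ 5]expnSr; apply: leq_mul => //.
  by rewrite leq_mul.
have D0 : 0 < d ^ m by rewrite expn_gt0 d0.
apply: (@leq_trans (K * (N ^ 5 * d ^ m) * (l * l))).
  rewrite /K mulnDl mulnDl leq_add //.
    apply: leq_trans c1 _; rewrite leq_mul2r; apply/orP; right.
    apply: leq_trans cN _; rewrite leq_mul //.
    rewrite [N ^ 5]expnS -mulnA leq_pmulr // muln_gt0 D0 expn_gt0.
    by rewrite (leq_trans _ N5).
  by apply: leq_trans c2 _; rewrite leq_mul2r tmN orbT.
have -> : K * (N ^ 5 * d ^ m) * (l * l) = 64 * K * N ^ 11 * d ^ m.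
  have -> : N ^ 11 = N ^ 5 * (N ^ 3 * N ^ 3) by rewrite -!expnD.
  rewrite /l; move: (N ^ 5) (N ^ 3) (d ^ m) => x y z; nia.
rewrite leq_mul2r; apply/orP; right; apply: leq_mul; first exact: leq_addr.
by rewrite leq_pexp2l //; lia.
Qed.
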